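(* Let $G=(V,E)$ be a countably infinite connected graph with finite degrees, let $(G_n)_{n\ge1}$ be an exhaustion of $G$, and let $w$ be a non-negative weight function on oriented cycles of $G$ (possibly taking values larger than $1$). Assume that the measures $\mu_n^F$ and $\mu_n^W$ on cycle-rooted spanning forests of $G_n$ associated with $w$, with free and wired boundary conditions respectively, both converge weakly to the same probability measure $\mu_w$, and that the weight function $w_-$ satisfies the uniform loop assumption (stated in the context) with a family of cycles $\Gamma\subset\mathcal C_-(G)$. Then, $\mu_w$-almost surely, every connected component of the random configuration that contains a cycle is finite.
   Context: **Forests.** For a subgraph $F$, $\mathcal C(F)$ is the set of its unoriented simple cycles; $\gamma,\gamma^{-1}$ are the two orientations of $[\gamma]$. A cycle-rooted spanning forest (CRSF) of a graph $H$ is a subgraph containing all vertices of $H$, each of whose connected components contains exactly one cycle. An essential CRSF (ECRSF) of $H$ with respect to a vertex set $W$ is a spanning subgraph each of whose connected components is either disjoint from $W$ and contains exactly one cycle, or is a tree containing exactly one vertex of $W$. **Exhaustion and finite-volume measures.** $(G_n)_{n\ge1}$ is an increasing sequence of finite connected induced subgraphs of $G$ with union $G$. For a finite subgraph $B$, $\partial B$ is the set of vertices of $B$ having a neighbour in $G$ outside $B$. $\mu_n^F$ is the probability measure on CRSFs $F$ of $G_n$ with $\mu_n^F(F)\propto\prod_{[\gamma]\in\mathcal C(F)}(w(\gamma)+w(\gamma^{-1}))$; $\mu_n^W$ is the probability measure on ECRSFs $F$ of $G_n$ with respect to $\partial G_n$ with $\mu_n^W(F)\propto\prod_{[\gamma]\in\mathcal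 C(F)}(w(\gamma)+w(\gamma^{-1}))$. Subgraphs are identified with elements of $\{0,1\}^E$ (extended by $0$ outside $G_n$); weak convergence means convergence of integrals of functions depending on finitely many edges. **Weight function $w_-$.** $\mathcal C_+(G)$ is the set of cycles of $G$ of weight strictly larger than $1$ (an unoriented cycle is regarded as being in $\mathcal C_+(G)$ if at least one orientation has weight $>1$), and $\mathcal C_-(G)$ is the set of all other cycles. $w_-=w$ on (both orientations of) cycles in $\mathcal C_-(G)$ and $w_-=0$ on (both orientations of) cycles in $\mathcal C_+(G)$. **Uniform loop assumption for $w_-$.** There exist $\alpha>0$, $\beta>0$, $M,M'>0$, $C>0$, $d\in\mathbb N$, a family $\Gamma$ of oriented cycles of $G$, and for every $x\in V$ an increasing sequence $(B_n^x)_{n\ge1}$ of finite connected induced subgraphs of $G$ containing $x$ and exhausting $G$ such that: - for every $\gamma\in\Gamma$, $\alpha\le w_-(\gamma)\le1$; - for every $x\in V$, $n\ge1$ and $v\in\partial B_n^x$ there is a cycle $\gamma_v\in\Gamma$ with all vertices in $B_{n+1}^x\setminus(B_n^x\cup\partial B_{n+1}^x)$ such that the probability that a simple random walk started at $v$ makes this loop, i.e. $\mathbb P_v((X_1,\dots,X_{|\gamma_v|})=\gamma_v)$, is greater than $\beta$ (with $\gamma_v$ written as a closed vertex sequence $(x_1,\dots,x_k)$, $x_k=x_1$, $|\gamma_v|=k$); - for every $x\in V$ and $n\ge1$, $M'n\le d(x,\partial B_n^x)\le Mn$ and $|\partial B_n^x|\le Cn^d$. Here $d(\cdot,\cdot)$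 is the graph distance and $\mathbb P_v$ is the law of the simple random walk $(X_k)_{k\ge0}$ on $G$ with $X_0=v$. *)

(* Defs.v *)
From mathcomp Require Import all_boot all_order all_algebra finmap.
From mathcomp Require Import all_classical all_reals all_analysis.
Import Order.TTheory GRing.Theory Num.Theory.
Import numFieldNormedType.Exports.

Set Implicit Arguments.
Unset Strict Implicit.
Unset Printing Implicit Defensive.

Local Open Scope fset_scope.
Local Open Scope classical_set_scope.
Local Open Scope ring_scope.

Record graph := Graph {
  vertex :> countType;
  adj : rel vertex;
  adj_sym : symmetric adj;
  adj_irr : irreflexive adj }.

Definition joined (V : Type) (e : rel V) (x y : V) : Prop :=
  exists2 p : seq V, path e x p & last x p = y.

Definition connected_graph (G : graph) : Prop :=
  forall x y : G, joined (@adj G) x y.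

Definition neighbours (G : graph) (x : G) : set G := [set y | adj x y].

Definition locally_finite_graph (G : graph) : Prop :=
  forall x : G, finite_set (neighbours x).

Definition degree (G : graph) (x : G) : nat := #|` fset_set (neighbours x)|.

Definition graph_dist (R : realType) (G : graph) (x y : G) : R :=
  inf [set (size p)%:R | p in [set p | path (@adj G) x p /\ last x p = y]].

Definition dist_to_set (R : realType) (G : graph) (x : G) (A : set G) : R :=
  inf [set graph_dist R x y | y in A].

(* A finite induced subgraph is given by its finite vertex set. *)
Definition connected_induced (G : graph) (B : {fset G}) : Prop :=
  forall x y : G, x \in B -> y \in B ->
    joined (fun a b => [&& a \in B, b \in B & adj a b]) x y.

Definition boundary (G : graph) (B : {fset G}) : {fset G} :=
  [fset x in B | `[< exists2 y, adj x y & y \notin B >]].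

(* Sequences are indexed by n >= 1; the term of index 0 is a dummy. *)
Definition exhaustion (G : graph) (B : nat -> {fset G}) : Prop :=
  [/\ forall n, (0 < n)%N -> B n != fset0 /\ connected_induced (B n),
      forall n, (0 < n)%N -> (B n `<=` B n.+1)%fset
    & forall x : G, exists2 n, (0 < n)%N & x \in B n].

(* An oriented simple cycle (x_1, ..., x_m, x_1) of the graph with adjacency
   relation e is represented by [:: x_1; ...; x_m], which is determined up to
   [rot]; its inverse is represented by [rev].  As graphs are simple, m >= 3. *)
Definition simple_cycle (V : eqType) (e : rel V) (c : seq V) : bool :=
  [&& (2 < size c)%N, cycle e c & uniq c].

Definition closed_sequence (V : Type) (c : seq V) : seq V :=
  if c is x :: _ then rcons c x else [::].

(* An unoriented simple cycle is identified with its set of edges. *)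
Definition cycle_edges (V : choiceType) (c : seq V) : {fset {fset V}} :=
  [fset [fset x; next c x] | x in c].

Definition cycle_weight (R : realType) (G : graph) (w : seq G -> R) : Prop :=
  (forall c, simple_cycle (@adj G) c -> 0 <= w c) /\
  (forall c i, simple_cycle (@adj G) c -> w (rot i c) = w c).

Definition cycles_plus (R : realType) (G : graph) (w : seq G -> R) :
    set (seq G) :=
  [set c | simple_cycle (@adj G) c /\ (1 < w c \/ 1 < w (rev c))].

Definition cycles_minus (R : realType) (G : graph) (w : seq G -> R) :
    set (seq G) :=
  [set c | simple_cycle (@adj G) c /\ ~ cycles_plus w c].

Definition weight_minus (R : realType) (G : graph) (w : seq G -> R) :
    seq G -> R :=
  fun c => if `[< cycles_plus w c >] then 0 else w c.

Definition edge (G : graph) : Type :=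
  {A : {fset G} | `[< exists x y : G, adj x y /\ A = [fset x; y] >]}.

Definition config (G : graph) : Type := edge G -> bool.

Definition edge_cylinders (G : graph) : set (set (config G)) :=
  [set [set F : config G | F e] | e in [set: edge G]].

(* {0,1}^E with its product sigma-algebra. *)
Notation configurations G := (g_sigma_algebraType (@edge_cylinders G)).

Definition open_adj (G : graph) (F : config G) : rel G :=
  fun x y => `[< exists2 e : edge G, val e = [fset x; y] & F e >].

Definition component (G : graph) (F : config G) (x : G) : set G :=
  [set y | joined (open_adj F) x y].

Definition cycles_in (G : graph) (F : config G) (S : set G) :
    set {fset {fset G}} :=
  [set cycle_edges c | c in
    [set c | simple_cycle (open_adj F) c /\ {in c, forall x, S x}]].

Definition cycles_of (G : graph) (F : config G) : set {fset {fset G}} :=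
  cycles_in F [set: G].

Definition has_unique_cycle (G : graph) (F : config G) (S : set G) : Prop :=
  exists A, cycles_in F S = [set A].

Definition config_in (G : graph) (B : {fset G}) (F : config G) : Prop :=
  forall e : edge G, F e -> (val e `<=` B)%fset.

Definition CRSF (G : graph) (B : {fset G}) : set (config G) :=
  [set F | config_in B F /\
    forall x, x \in B -> has_unique_cycle F (component F x)].

Definition ECRSF (G : graph) (B W : {fset G}) : set (config G) :=
  [set F | config_in B F /\
    forall x, x \in B ->
      (component F x `&` [set` W] = set0 /\
         has_unique_cycle F (component F x)) \/
      (cycles_in F (component F x) = set0 /\
         exists v, component F x `&` [set` W] = [set v])].

(* w(c) + w(c^-1) for an arbitrary orientation c of the unoriented cycle A;
   the value does not depend on the choice of c when [cycle_weight w]. *)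
Definition unoriented_weight (R : realType) (G : graph) (w : seq G -> R)
    (A : {fset {fset G}}) : R :=
  let c := xget [::] [set c | simple_cycle (@adj G) c /\ cycle_edges c = A] in
  w c + w (rev c).

Definition forest_weight (R : realType) (G : graph) (w : seq G -> R)
    (F : config G) : R :=
  \big[*%R/1]_(A \in cycles_of F) unoriented_weight w A.

(* S is meant to be finite: mu is carried by S and proportional there to
   [forest_weight w], which determines mu and forces its total weight on S to
   be positive. *)
Definition forest_measure (R : realType) (G : graph) (w : seq G -> R)
    (S : set (config G)) (mu : probability (configurations G) R) : Prop :=
  mu S = 1%E /\
  exists k : R, forall F, S F -> mu [set F] = (k * forest_weight w F)%:E.

Definition free_measure (R : realType) (G : graph) (w : seq G -> R)
    (B : {fset G}) (mu : probability (configurations G) R) : Prop :=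
  forest_measure w (CRSF B) mu.

Definition wired_measure (R : realType) (G : graph) (w : seq G -> R)
    (B : {fset G}) (mu : probability (configurations G) R) : Prop :=
  forest_measure w (ECRSF B (boundary B)) mu.

Definition depends_on_finitely_many (R : Type) (G : graph)
    (f : config G -> R) : Prop :=
  exists2 D : set (edge G), finite_set D &
    forall F F' : config G, (forall e, D e -> F e = F' e) -> f F = f F'.

Definition weak_convergence (R : realType) (G : graph)
    (mu_ : nat -> probability (configurations G) R)
    (mu : probability (configurations G) R) : Prop :=
  forall f : configurations G -> R, depends_on_finitely_many f ->
    (fun n => \int[mu_ n]_F (f F)%:E)%E @ \oo --> (\int[mu]_F (f F)%:E)%E.

Definition srw_step (R : realType) (G : graph) (x y : G) : R :=
  if adj x y then (degree x)%:R^-1 else 0.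

Definition simple_random_walk (R : realType) (G : graph)
    (d : measure_display) (T : measurableType d) (P : probability T R)
    (X : nat -> T -> G) (v : G) : Prop :=
  [/\ forall n x, measurable [set t | X n t = x],
      P [set t | X 0 t = v] = 1%E
    & forall (s : seq G) (x y : G),
        P [set t | mkseq (X ^~ t) (size s).+2 = rcons (rcons s x) y] =
        (P [set t | mkseq (X ^~ t) (size s).+1 = rcons s x] *
           (srw_step R x y)%:E)%E].

(* The event (X_1, ..., X_|s|) = s. *)
Definition follows (V T : Type) (X : nat -> T -> V) (s : seq V) : set T :=
  [set t | mkseq (fun i => X i.+1 t) (size s) = s].

(* P v is the law under which X is the simple random walk started at v.
   [rot i c] ranges over the choices of the starting point of the cycle c. *)
Definition uniform_loop_assumption (R : realType) (G : graph)
    (d : measure_display) (T : measurableType d) (P : G -> probability T R)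
    (X : nat -> T -> G) (w : seq G -> R) (Gamma : set (seq G)) : Prop :=
  exists (alpha beta M M' C : R) (D : nat) (B : G -> nat -> {fset G}),
    [/\ [/\ 0 < alpha, 0 < beta, 0 < M, 0 < M' & 0 < C],
        (forall x, exhaustion (B x) /\ forall n, (0 < n)%N -> x \in B x n),
        (forall c, Gamma c ->
           simple_cycle (@adj G) c /\ alpha <= w c <= 1),
        (forall x n v, (0 < n)%N -> v \in boundary (B x n) ->
           exists c, [/\ Gamma c,
             {in c, forall y, [/\ y \in B x n.+1, y \notin B x n
                                & y \notin boundary (B x n.+1)]}
             & exists i,
               (beta%:E < P v (follows X (closed_sequence (rot i c))))%E])
      & (forall x n, (0 < n)%N ->
           M' * n%:R <= dist_to_set R x [set` boundary (B x n)] <= M * n%:R /\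
           (#|` boundary (B x n)|)%:R <= C * n%:R ^+ D)].

(* Main.v *)
Require Import Defs.
From mathcomp Require Import all_boot all_order all_algebra finmap.
From mathcomp Require Import all_classical all_reals all_analysis.
From mathcomp Require Import ring lra.
Import Order.TTheory GRing.Theory Num.Theory.
Import numFieldNormedType.Exports.

(* Orienting every tree towards its cycle and every cycle in one of its two
   directions turns the free measure on a finite graph into the law of a map f
   sending each vertex to a neighbour, weighted by the product of w over the
   oriented cycles of f (2-cycles get weight 0).  Freeze the cycles of weight
   larger than 1 together with a given cycle c; the other vertices can then be
   sampled by Wilson's algorithm, in which a closed loop is kept with probability
   equal to its weight, at most 1, and erased otherwise.  The law of the branch
   started at v comes from the forward equation of the loop-erased walk, whose
   solution is an explicit ratio of partition functions.

   Let x be on c and B_k the exhaustion attached to x.  A branch from v on the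
   boundary of B_n to c crosses the boundaries of all the B_k with k < n.  When the
   walk is at u on the boundary of B_k, it goes twice around the loop given by the
   assumption with probability at least beta ^ 2, whatever its past: the first
   round wipes the cycle out of the older part of the path, so that the second one
   closes exactly this cycle, which is kept with probability at least alpha.
   Hence the probability that v is connected to c decays exponentially in n, while
   the boundary of B_n has polynomial size. *)

Set Implicit Arguments.
Unset Strict Implicit.
Unset Printing Implicit Defensive.

Local Open Scope ring_scope.

(** * Maps following the edges of a finite graph *)

(** A loop can be kept with probability equal to its weight only if that weight is at most 1, so a
    heavier cycle can never be created by the walk; and the given cycle must be present from the
    start in order to be a target. No algorithm is actually run. On the finite set of simple paths
    the forward equation is a finite linear identity, and testing it against hitting probabilities
    replaces any statement about termination. Successive boundaries in an exhaustion may share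
    vertices, in which case a loop attached to one of them would not be separated from the previous
    one. Only every L-th boundary is therefore used, with L at least the inverse of the loop
    probability. Weak convergence controls cylinder events only, so connections are first confined
    to a finite set; the confinement is removed in the limit measure by monotonicity. *)

Section ArrowFunctions.
Variables (R : realType) (V : finType) (e : rel V).
Implicit Types (f : {ffun V -> V}) (A : {set V}) (k : seq V).

Definition arrows f := [forall x, e x (f x)].

Definition outdeg (x : V) : nat := #|e x|.

Definition redirect f (b y : V) : {ffun V -> V} :=
  [ffun z => if z == b then y else f z].

(* [path (backward f) y k] says that f maps each entry of [y :: k] except y
   to the previous one, so that k is a path of f ending at y, read backwards. *)
Definition backward f : rel V := fun a b => f b == a.

Lemma arrows_redirect f b y : arrows f -> e b y -> arrows (redirect f b y).
Proof.
move=> /forallP fe eby; apply/forallP => x; rewrite ffunE.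
by case: eqP => [->|_].
Qed.

Lemma redirectK f b y z : f b = y -> redirect (redirect f b z) b y = f.
Proof.
by move=> fb; apply/ffunP => x; rewrite !ffunE; case: (eqVneq x b) => [->|].
Qed.

(** [redirect] at [b] exchanges the maps with [f b = y] and those with [f b = z] without changing
    [Psi], so all the possible values of [f b] carry equal shares of the sum. *)
Lemma sum_arrow (Psi : {ffun V -> V} -> R) b y : e b y ->
    (forall f z, Psi (redirect f b z) = Psi f) ->
  (\sum_(f | arrows f && (f b == y)) Psi f) * (outdeg b)%:R =
  \sum_(f | arrows f) Psi f.
Proof.
move=> eby Psib; rewrite [RHS](partition_big (fun f => f b) (e b)) /=; last first.
  by move=> f /forallP.
rewrite [RHS](eq_bigr (fun=> \sum_(f | arrows f && (f b == y)) Psi f)).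
  by rewrite sumr_const mulr_natr.
move=> z ebz.
rewrite (reindex_onto (fun f => redirect f b z) (fun f => redirect f b y)) /=.
  apply: eq_big => [f|f _]; last exact: Psib.
  rewrite ffunE eqxx eqxx andbT; apply/andP/andP => [[af /eqP ff]|[af /eqP fb]].
    split; last by rewrite -ff ffunE eqxx.
    by rewrite -ff arrows_redirect.
  by rewrite arrows_redirect ?redirectK ?eqxx.
by move=> f /andP[_ /eqP]; apply: redirectK.
Qed.

Lemma path_backward_redirect f b z y k : b \notin k ->
  path (backward (redirect f b z)) y k = path (backward f) y k.
Proof.
elim: k y => //= a k IH y; rewrite inE negb_or => /andP[ba bk].
by rewrite IH // /backward ffunE (eq_sym a) (negbTE ba).
Qed.

(** The arrows are freed one at a time; [uniq k] ensures that freeing one of them leaves the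
    condition on the rest of the path untouched. *)
Lemma sum_arrows (Psi : {ffun V -> V} -> R) y k : uniq k ->
    path (fun a b => e b a) y k ->
    (forall f b z, b \in k -> Psi (redirect f b z) = Psi f) ->
  (\sum_(f | arrows f && path (backward f) y k) Psi f) *
    \prod_(x <- k) (outdeg x)%:R = \sum_(f | arrows f) Psi f.
Proof.
elim: k y Psi => [|b k IH] y Psi /=.
  by rewrite big_nil mulr1 => _ _ _; apply: eq_bigl => f; rewrite andbT.
case/andP=> bk uk /andP[eby pk] Psib; rewrite big_cons.
rewrite -(IH b Psi uk pk); last by move=> *; rewrite Psib // inE orbC; apply/orP; left.
rewrite mulrA; congr (_ * _).
rewrite [RHS]big_mkcondr /=.
rewrite -(sum_arrow (b := b) (y := y)) //; last first.
  by move=> f z; rewrite path_backward_redirect // Psib // mem_head.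
congr (_ * _); rewrite -big_mkcondr /=; apply: eq_bigl => f.
by rewrite -andbA.
Qed.

End ArrowFunctions.

(** * Product of the weights of the cycles inside a vertex set *)

Section CycleWeights.
Variables (R : realType) (V : finType) (w : seq V -> R).
Hypothesis w_rot : forall c i, w (rot i c) = w c.
Implicit Types (f : {ffun V -> V}) (A : {set V}).

(* froot selects one vertex on each cycle of f. *)
Definition cycles_weight A f : R :=
  \prod_(x | [&& fcycle f (orbit f x), froot f x == x & orbit f x \subset A])
    w (orbit f x).

Lemma orbit_agree f f' x : fcycle f (orbit f x) ->
  {in orbit f x, f =1 f'} -> orbit f' x = orbit f x.
Proof.
move=> fx ff'; rewrite (orbitE (p := orbit f x)) ?in_orbit ?orbit_uniq //.
  by rewrite /orbit -orderSpred /= eqxx rot0.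
rewrite -(eq_in_cycle (P := mem (orbit f x)) (e := frel f)) //.
  by move=> a b ax _ /=; rewrite ff'.
Qed.

Lemma orbit_mem f x y : fcycle f (orbit f x) -> y \in orbit f x ->
  orbit f y = rot (index y (orbit f x)) (orbit f x).
Proof. by move=> fx xy; rewrite (orbitE fx) ?orbit_uniq. Qed.

Lemma orbit_mem_cycle f x y : fcycle f (orbit f x) -> y \in orbit f x ->
  fcycle f (orbit f y).
Proof. by move=> fx xy; rewrite (orbit_mem fx) // rot_cycle. Qed.

Lemma orbit_mem_eq f x y : fcycle f (orbit f x) -> y \in orbit f x ->
  orbit f y =i orbit f x.
Proof. by move=> fx xy z; rewrite (orbit_mem fx) // mem_rot. Qed.

Lemma froot_orbit f x y : orbit f x =i orbit f y ->
  froot f x = froot f y.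
Proof.
move=> xy; rewrite /fingraph.root.
have -> : pick (fconnect f x) = pick (fconnect f y).
  by apply: eq_pick => z; rewrite !fconnect_orbit xy.
by case: pickP => //= /(_ y); rewrite connect0.
Qed.

Lemma froot_mem f x : froot f x \in orbit f x.
Proof. by rewrite -fconnect_orbit connect_root. Qed.

Lemma cycle_agree A f f' x : {in A, f =1 f'} ->
  fcycle f (orbit f x) -> orbit f x \subset A ->
  orbit f' x = orbit f x /\ fcycle f' (orbit f' x).
Proof.
move=> ff' cx xA; have E : orbit f' x = orbit f x.
  by apply: orbit_agree => // y /(fintype.subsetP xA); apply: ff'.
split=> //; rewrite E.
rewrite -(eq_in_cycle (P := mem (orbit f x)) (e := frel f)) //.
by move=> a b ax _ /=; rewrite ff' //; apply: (fintype.subsetP xA).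
Qed.

Lemma cycles_weight_agree A f f' : {in A, f =1 f'} ->
  cycles_weight A f = cycles_weight A f'.
Proof.
move=> ff'.
have sub (g g' : {ffun V -> V}) x : {in A, g =1 g'} ->
    [&& fcycle g (orbit g x), froot g x == x & orbit g x \subset A] ->
    orbit g' x = orbit g x /\
    [&& fcycle g' (orbit g' x), froot g' x == x & orbit g' x \subset A].
  move=> gg' /and3P[cx rx xA]; have [E cx'] := cycle_agree gg' cx xA.
  split=> //; rewrite cx' E xA andbT /=.
  rewrite -{2}(eqP rx) /fingraph.root.
  have -> // : pick (fconnect g' x) = pick (fconnect g x).
  by apply: eq_pick => z; rewrite !fconnect_orbit E.
apply: eq_big => [x|x /(sub f f' x ff')[-> _] //].
apply/idP/idP => [/(sub f f' x ff')[] //|].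
by case/(sub f' f x) => // y yA; rewrite ff'.
Qed.

Lemma eq_cycles_weight A A' f :
    (forall x, fcycle f (orbit f x) -> (orbit f x \subset A) = (orbit f x \subset A')) ->
  cycles_weight A f = cycles_weight A' f.
Proof.
move=> AA'; apply: eq_bigl => x.
by case cx: (fcycle f (orbit f x)) => //=; rewrite AA'.
Qed.

Lemma cycles_weightD A f x : fcycle f (orbit f x) -> orbit f x \subset A ->
  cycles_weight A f =
  w (orbit f x) * cycles_weight (A :\: [set y in orbit f x]) f.
Proof.
move=> cx xA; rewrite /cycles_weight (bigD1 (froot f x)) /=; last first.
  have rx := froot_mem f x.
  rewrite (orbit_mem_cycle cx rx) /=; apply/andP; split.
    rewrite [X in X == _](froot_orbit (y := x)) //.
    exact: orbit_mem_eq.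
  by apply/fintype.subsetP => y; rewrite (orbit_mem_eq cx rx); apply: (fintype.subsetP xA).
rewrite (orbit_mem cx) ?froot_mem // w_rot; congr (_ * _).
apply: eq_bigl => y; rewrite -!andbA.
case cy: (fcycle f (orbit f y)) => //=; case: eqP => //= ry.
apply/andP/idP => [[yA yr]|yA].
  apply/fintype.subsetP => z yz; rewrite !inE (fintype.subsetP yA) // andbT.
  apply: contraNN yr => xz; apply/eqP.
  have oxy : orbit f y =i orbit f x.
    by move=> t; rewrite -(orbit_mem_eq cx xz) (orbit_mem_eq cy yz).
  by rewrite -ry; apply: froot_orbit.
split; first by apply: (fintype.subset_trans yA); apply: finset.subsetDl.
apply/negP => /eqP yr.
have := fintype.subsetP yA y; rewrite in_orbit !inE => /(_ isT).
by rewrite yr froot_mem.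
Qed.

(** Only the cycle through [x] is lost when [x] leaves [A]. Written additively, this produces the
    factor [1 - w], the probability that a loop is erased: it is the algebraic source of the forward
    equation. *)
Lemma cycles_weightD1 A f x : x \in A ->
  cycles_weight (A :\ x) f = cycles_weight A f +
  (if fcycle f (orbit f x) && (orbit f x \subset A)
   then (1 - w (orbit f x)) * cycles_weight (A :\: [set y in orbit f x]) f
   else 0).
Proof.
move=> xA; case: ifP => [/andP[cx oA]|ncx].
  rewrite (cycles_weightD cx oA) mulrBl mul1r addrC subrK.
  apply: eq_cycles_weight => y cy; apply/idP/idP => yA.
    apply/fintype.subsetP => z yz; rewrite !inE.
    have := fintype.subsetP yA z yz; rewrite !inE => /andP[_ ->]; rewrite andbT.
    apply/negP => xz; have := fintype.subsetP yA x.
    by rewrite -(orbit_mem_eq cy yz) (orbit_mem_eq cx xz) in_orbit !inE eqxx => /(_ isT).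
  apply: (fintype.subset_trans yA); apply: finset.setDS.
  by apply/fintype.subsetP => z; rewrite !inE => /eqP ->; apply: in_orbit.
rewrite addr0; apply: eq_cycles_weight => y cy; apply/idP/idP => yA.
  by apply: (fintype.subset_trans yA); apply: finset.subsetDl.
apply/fintype.subsetP => z yz; rewrite !inE (fintype.subsetP yA) // andbT.
apply/negP => /eqP zx; rewrite zx in yz.
move: ncx; rewrite (orbit_mem_cycle cy yz) /=.
by move/negP; apply; apply/fintype.subsetP => t; rewrite (orbit_mem_eq cy yz); apply: (fintype.subsetP yA).
Qed.

Lemma cycles_weight_ge0 A f : (forall c, 0 <= w c) -> 0 <= cycles_weight A f.
Proof. by move=> w0; apply: prodr_ge0. Qed.

End CycleWeights.

(** * Loop-erased walk *)

Section LoopErasedWalk.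
Variables (R : realType) (V : finType) (e : rel V) (w : seq V -> R).
Hypothesis w_rot : forall c i, w (rot i c) = w c.
Variables (S : {set V}) (Phi : {ffun V -> V} -> R) (v : V).
Hypothesis vS : v \in S.
Hypothesis PhiS : forall f b z, b \in S -> Phi (redirect f b z) = Phi f.

(* A simple path is stored backwards, its current end being the head. *)
Definition simple_path (h : seq V) : bool :=
  [&& uniq h, all (mem S) h &
      if h is u :: t then path (fun a b => e b a) u t && (last u t == v)
      else false].

Definition simple_paths : seq (seq V) :=
  [seq h <- map val (enum {: {bseq #|V| of V}}) | simple_path h].

Lemma mem_simple_paths h : (h \in simple_paths) = simple_path h.
Proof.
rewrite mem_filter; case sh: (simple_path h) => //=.
case/and3P: sh => /card_uniqP uh _ _.
have hV : (size h <= #|V|)%N by rewrite -uh max_card.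
by apply/mapP; exists (Bseq hV) => //; rewrite mem_enum.
Qed.

Lemma simple_paths_uniq : uniq simple_paths.
Proof. by rewrite filter_uniq // map_inj_uniq ?enum_uniq //; apply: val_inj. Qed.

(** Paths are stored backwards, so reversing lists the loop in the order in which it is walked,
    starting from [y]. *)
Definition closed_loop (h : seq V) (y : V) : seq V :=
  rev (take (index y h).+1 h).

Definition erased_step (h : seq V) (y : V) : seq V :=
  if y \in h then drop (index y h) h else y :: h.

(** Survival probability: keeping the loop kills the walk, so only the erasing part [1 - w] goes
    on. *)
Definition step_weight (h : seq V) (y : V) : R :=
  if y \in h then 1 - w (closed_loop h y) else 1.

Definition partition_sum (A : {set V}) : R :=
  \sum_(f | arrows e f) Phi f * cycles_weight w A f.

Definition deg_prod (k : seq V) : R := \prod_(x <- k) (outdeg e x)%:R.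

(* Up to the degree of the end of h, the expected number of visits to h of the
   loop-erased walk started at v. *)
Definition flux (h : seq V) : R :=
  partition_sum (S :\: [set x in h]) / deg_prod h.

Hypothesis deg_gt0 : forall x, (0 < outdeg e x)%N.

Lemma deg_prod_gt0 k : 0 < deg_prod k.
Proof. by apply: prodr_gt0 => x _; rewrite ltr0n deg_gt0. Qed.

Lemma cycles_weight_redirect (A : {set V}) (f : {ffun V -> V}) b z : b \notin A ->
  cycles_weight w A (redirect f b z) = cycles_weight w A f.
Proof.
move=> bA; apply: cycles_weight_agree => x xA; rewrite ffunE.
by case: eqP => // xb; rewrite xb (negbTE bA) in xA.
Qed.

(** Neither [Phi] nor the cycles inside [A] depend on the arrows starting in [k], so prescribing
    these arrows costs exactly the inverse of their number of choices. *)
Lemma partition_sum_path (k : seq V) y (A : {set V}) : uniq k ->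
    path (fun a b => e b a) y k -> {subset k <= S} -> {in k, forall x, x \notin A} ->
  \sum_(f | arrows e f && path (backward f) y k) Phi f * cycles_weight w A f =
  partition_sum A / deg_prod k.
Proof.
move=> uk pk kS kA; apply: canRL (mulfK _) _; first by rewrite gt_eqF ?deg_prod_gt0.
apply: (sum_arrows (Psi := fun f => Phi f * cycles_weight w A f)) => // f b z bk.
by rewrite PhiS ?kS // cycles_weight_redirect ?kA.
Qed.

Lemma backward_cycle (f : {ffun V -> V}) (k : seq V) x :
  path (backward f) x (rcons k x) = fcycle f (rev (rcons k x)).
Proof.
by rewrite rev_cycle -[in RHS]rot1_cons rot_cycle.
Qed.

Lemma erased_stepE h y x t : erased_step h y = x :: t ->
  y = x /\ (if x \in h then h = take (index x h) h ++ x :: t else h = t).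
Proof.
rewrite /erased_step; case: ifP => yh; last by case=> <- <-; rewrite yh.
move=> E; have yx : y = x.
  by have := drop_nth y (n := index y h) (s := h); rewrite index_mem yh E => /(_ isT)[-> _]; rewrite nth_index.
by rewrite -yx yh; split=> //; rewrite yx -E yx cat_take_drop.
Qed.

Lemma simple_path_step h y :
  simple_path h -> e (head y h) y -> y \in S -> simple_path (erased_step h y).
Proof.
rewrite /erased_step; case: h => // u t; rewrite /simple_path.
move=> /and3P[uh Sh /andP[ph lh]] /= euy yS.
case: ifP => yh; last first.
  apply/and3P; split; first by rewrite cons_uniq yh uh.
    by apply/andP; split.
  by rewrite /= euy ph lh.
have := cat_take_drop (index y (u :: t)) (u :: t).
have := drop_nth y (n := index y (u :: t)) (s := u :: t).
rewrite index_mem yh nth_index // => /(_ isT).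
move: (take _ _) (drop _.+1 _) => a r -> E.
rewrite -E in uh Sh.
move: uh Sh; rewrite cat_uniq all_cat => /and3P[_ _ ->] /andP[_ ->] /=.
case: a E => [[-> ->]|b a [_ tE]]; first by rewrite ph.
by move: ph lh; rewrite -tE cat_path last_cat /= => /and3P[_ _ ->].
Qed.

(** A cycle through [x] avoiding [t] is recorded by the path [h] that has just walked it and is
    about to close it at [x], where erasure will leave [x :: t]. A given [f] has at most one cycle
    through [x], so at most one term is non-zero. *)
Lemma cycle_extension_sum x t (A : {set V}) (f : {ffun V -> V}) :
    simple_path (x :: t) -> A = S :\: [set y in t] -> arrows e f ->
  (if fcycle f (orbit f x) && (orbit f x \subset A)
   then (1 - w (orbit f x)) * cycles_weight w (A :\: [set y in orbit f x]) f
   else 0) =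
  \sum_(h <- simple_paths | [&& x \in h, drop (index x h) h == x :: t & e (head x h) x])
    (if path (backward f) x (rcons (take (index x h) h) x)
     then (1 - w (closed_loop h x)) * cycles_weight w (S :\: [set y in h]) f
     else 0).
Proof.
move=> sxt AE af.
have /and3P[/= /andP[xt ut] /andP[xS tS] pt] := sxt.
have inA y : (y \in A) = (y \notin t) && (y \in S) by rewrite AE !inE.
(* Any [h] with a non-zero term is forced to be the reversed orbit of [x] followed by [t]. *)
have fwd h : simple_path h -> x \in h -> drop (index x h) h = x :: t ->
    path (backward f) x (rcons (take (index x h) h) x) ->
    [/\ fcycle f (orbit f x), orbit f x \subset A & h = rev (orbit f x) ++ t].
  move=> /and3P[uh Sh _] xh dh; rewrite backward_cycle rev_rcons => ck.
  have hE := cat_take_drop (index x h) h; rewrite dh in hE.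
  set k := take _ _ in ck hE; rewrite -hE in uh Sh.
  have uk : uniq (x :: rev k).
    rewrite /= mem_rev rev_uniq; move: uh; rewrite cat_uniq /= => /and3P[-> ].
    by rewrite negb_or => /andP[->].
  have oE : orbit f x = x :: rev k.
    by rewrite (orbitE ck uk) ?mem_head //= eqxx rot0.
  split; rewrite oE //; last by rewrite rev_cons revK -cats1 -catA hE.
  apply/fintype.subsetP => y; rewrite inE mem_rev inA => /orP[/eqP->|yk].
    by rewrite xt.
  move: uh Sh; rewrite cat_uniq all_cat => /and3P[_ kt _] /andP[/allP/(_ _ yk) yS _].
  rewrite (yS : y \in S) andbT; apply: contra kt => yt; apply/hasP; exists y => //.
  by rewrite inE yt orbT.
case: ifP => [/andP[cx oA]|nc]; last first.
  rewrite big_seq_cond big1 // => h; rewrite mem_simple_paths.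
  case/andP=> sh /and3P[xh /eqP dh _]; case: ifP => // pk.
  by case: (fwd h sh xh dh pk) => cx oA _; rewrite cx oA in nc.
have [q qE] : exists q, orbit f x = x :: q.
  by rewrite /orbit -orderSpred /=; eexists.
pose h0 := rev (orbit f x) ++ t.
have xq : x \notin q by have := orbit_uniq f x; rewrite qE => /andP[].
have h0E : h0 = rev q ++ x :: t by rewrite /h0 qE rev_cons -cats1 -catA.
have ix : index x h0 = size q.
  by rewrite h0E index_cat mem_rev (negbTE xq) /= eqxx addn0 size_rev.
have tk : take (index x h0) h0 = rev q.
  by rewrite ix h0E take_size_cat ?size_rev.
have pk : path (backward f) x (rcons (rev q) x).
  by rewrite backward_cycle rev_rcons revK -qE.
have sh0 : simple_path h0.
  apply/and3P; split.
  - rewrite cat_uniq rev_uniq orbit_uniq ut andbT; apply/hasPn => y yt /=.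
    rewrite mem_rev; apply/negP => /(fintype.subsetP oA).
    by rewrite inA yt.
  - rewrite all_cat tS andbT all_rev; apply/allP => y /(fintype.subsetP oA).
    by rewrite inA => /andP[_].
  - have : path (fun a b => e b a) x (rcons (rev q) x).
      apply: sub_path pk => a b /eqP <-; exact: (forallP af).
    rewrite h0E; case: (rev q) => [|b r]; first by move: pt.
    rewrite /= rcons_path cat_path last_cat /= => /and3P[_ -> ->].
    by case/andP: pt => -> ->.
have ch0 : [&& x \in h0, drop (index x h0) h0 == x :: t & e (head x h0) x].
  apply/and3P; split; first by rewrite h0E mem_cat mem_head orbT.
    by rewrite ix h0E drop_size_cat ?size_rev.
  move: pk; rewrite h0E; case: (rev q) => [|b r]; rewrite /= => /andP[].
    by move=> /eqP {2}<- _; apply: (forallP af).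
  by move=> /eqP {2}<- _; apply: (forallP af).
rewrite big_mkcond (bigD1_seq h0) ?simple_paths_uniq ?mem_simple_paths //=.
rewrite ch0 tk pk big_seq_cond big1 ?addr0; last first.
  move=> h; rewrite mem_simple_paths => /andP[sh nh].
  case: ifP => // /and3P[xh /eqP dh _]; case: ifP => // pkh.
  by case: (fwd h sh xh dh pkh) => _ _ hE; rewrite hE eqxx in nh.
congr ((1 - w _) * cycles_weight w _ f).
  rewrite /closed_loop (take_nth x) ?tk ?nth_index.
  - by rewrite rev_rcons revK qE.
  - by rewrite h0E mem_cat mem_head orbT.
  - by rewrite index_mem h0E mem_cat mem_head orbT.
by apply/setP => y; rewrite !inE AE !inE mem_cat mem_rev negb_or andbA.
Qed.

(** This is [cycles_weightD1] summed over [f]. Prescribing the arrows of the loop turns the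
    remaining sum into [flux h], up to the factor [deg_prod t], since the arrows along [t] are not
    prescribed. *)
Lemma partition_sumD1 x t : simple_path (x :: t) ->
  partition_sum (S :\: [set y in x :: t]) =
  partition_sum (S :\: [set y in t]) +
  deg_prod t *
  \sum_(h <- simple_paths | [&& x \in h, drop (index x h) h == x :: t & e (head x h) x])
    (1 - w (closed_loop h x)) * flux h.
Proof.
move=> sxt; set A := S :\: [set y in t].
have /and3P[/= /andP[xt ut] /andP[xS tS] pt] := sxt.
have -> : S :\: [set y in x :: t] = A :\ x.
  by apply/setP => y; rewrite !inE negb_or andbA.
have xA : x \in A by rewrite !inE xt.
rewrite /partition_sum (eq_bigr _ (fun f _ => congr1 _ (cycles_weightD1 w_rot f xA))).
rewrite (eq_bigr _ (fun f _ => mulrDr _ _ _)) big_split /=; congr (_ + _).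
rewrite (eq_bigr _ (fun f af => congr1 _ (cycle_extension_sum sxt erefl af))).
rewrite (eq_bigr _ (fun f _ => mulr_sumr _ _ _ _)) exchange_big /= mulr_sumr.
rewrite big_seq_cond [RHS]big_seq_cond; apply: eq_bigr => h.
rewrite mem_simple_paths => /and3P[/and3P[uh Sh ph] xh /andP[/eqP dh ehx]].
have hE := cat_take_drop (index x h) h; rewrite dh in hE.
set k := take (index x h) h in hE *.
have uk : uniq (rcons k x) by move: uh; rewrite -hE -cat_rcons cat_uniq => /and3P[].
have tk : {in rcons k x, forall y, y \notin t}.
  move=> y yk; move: uh; rewrite -hE -cat_rcons cat_uniq => /and3P[_ /hasPn ht _].
  by apply/negP => /ht/negP.
have kS : {subset rcons k x <= S}.
  by move=> y yk; apply: (allP Sh); rewrite -hE -cat_rcons mem_cat yk.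
transitivity ((1 - w (closed_loop h x)) *
    \sum_(f | arrows e f && path (backward f) x (rcons k x))
      Phi f * cycles_weight w (S :\: [set y in h]) f).
  rewrite big_mkcondr mulr_sumr; apply: eq_bigr => f _.
  by case: ifP; rewrite ?mulr0 // mulrCA.
rewrite partition_sum_path //.
- have dE : deg_prod h = deg_prod (rcons k x) * deg_prod t.
    by rewrite -{1}hE -cat_rcons /deg_prod big_cat.
  rewrite /flux dE [RHS]mulrCA; congr (_ * _); rewrite mulrCA; congr (_ * _).
  by rewrite invfM mulrCA mulfV ?mulr1 // gt_eqF ?deg_prod_gt0.
- move: ph ehx; rewrite -hE; case: k {hE uk tk kS} => [|b r] /=.
    by rewrite andbT.
  rewrite rcons_path cat_path last_cat /= => /andP[/and3P[-> -> _] _] ->.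
  by [].
- move=> y yk; rewrite !inE -hE -cat_rcons mem_cat yk.
  by [].
Qed.

(** Balance at the state [x :: t]: the outflow equals the inflow by extension of [t] (or the source,
    when [t] is empty) plus the inflow from the paths erased down to [x :: t]. *)
Lemma flux_forward x t : simple_path (x :: t) ->
  (outdeg e x)%:R * flux (x :: t) =
  (if t is [::] then partition_sum S else flux t) +
  \sum_(h <- simple_paths | [&& x \in h, drop (index x h) h == x :: t & e (head x h) x])
    (1 - w (closed_loop h x)) * flux h.
Proof.
move=> sxt; have dx : (outdeg e x)%:R != 0 :> R by rewrite pnatr_eq0 -lt0n deg_gt0.
have dt : deg_prod t != 0 by rewrite gt_eqF ?deg_prod_gt0.
rewrite /flux partition_sumD1 // /deg_prod big_cons -/(deg_prod t).
set s := \sum_(h <- _ | _) _; set d := _%:R in dx *; set c := deg_prod t in dt *.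
rewrite (_ : d * ((_ + c * s) / (d * c)) = partition_sum (S :\: [set y in t]) / c + s); last by field; apply/andP.
congr (_ + _); rewrite /c => {s c dt}; case: t sxt => // _.
rewrite /deg_prod big_nil invr1 mulr1; congr partition_sum.
by apply/setP => y; rewrite !inE.
Qed.

(* Loop-erased walk as a substochastic chain on simple paths: [flux] solves its
   forward equation, tested here against an arbitrary function q. *)
Lemma flux_balance (q : seq V -> R) :
  \sum_(h <- simple_paths) (outdeg e (head v h))%:R * flux h * q h =
  partition_sum S * q [:: v] +
  \sum_(h <- simple_paths) flux h *
    \sum_(y | e (head v h) y && (y \in S)) step_weight h y * q (erased_step h y).
Proof.
have sv : simple_path [:: v] by rewrite /simple_path /= vS eqxx.
(* The outgoing steps are regrouped according to the path [h'] they lead to. *)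
have -> : \sum_(h <- simple_paths) flux h *
    \sum_(y | e (head v h) y && (y \in S)) step_weight h y * q (erased_step h y) =
  \sum_(h' <- simple_paths) \sum_(h <- simple_paths)
    \sum_(y | e (head v h) y && (y \in S) && (erased_step h y == h'))
      flux h * step_weight h y * q h'.
  rewrite exchange_big /=; rewrite big_seq [RHS]big_seq; apply: eq_bigr => h.
  rewrite mem_simple_paths => sh; rewrite (exchange_big_dep (fun y => e (head v h) y && (y \in S))) /=; last first.
    by move=> h' y _ /andP[].
  rewrite mulr_sumr; apply: eq_bigr => y /andP[ehy yS].
  have sh' : simple_path (erased_step h y).
    by apply: simple_path_step => //; case: h sh ehy.
  rewrite big_mkcond (bigD1_seq (erased_step h y)) ?simple_paths_uniq ?mem_simple_paths //=.
  rewrite ehy yS eqxx /= big1 ?addr0 ?mulrA // => h' nh.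
  by rewrite eq_sym (negbTE nh).
have -> : partition_sum S * q [:: v] =
    \sum_(h' <- simple_paths) (if h' == [:: v] then partition_sum S else 0) * q h'.
  rewrite (bigD1_seq [:: v]) ?simple_paths_uniq ?mem_simple_paths //= eqxx.
  by rewrite big1 ?addr0 // => h' /negbTE ->; rewrite mul0r.
rewrite -big_split /= big_seq [RHS]big_seq; apply: eq_bigr => -[|x t].
  by rewrite mem_simple_paths /simple_path !andbF.
rewrite mem_simple_paths => sxt; rewrite flux_forward //=.
have /and3P[/= /andP[xt ut] /andP[xS tS] pt] := sxt.
(* The predecessors of [x :: t] are of two kinds: paths through [x] that are erased down to it, and
   [t] itself, extended by the new vertex [x]. *)
have -> : \sum_(h <- simple_paths)
    \sum_(y | e (head v h) y && (y \in S) && (erased_step h y == x :: t))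
      flux h * step_weight h y * q (x :: t) =
  \sum_(h <- simple_paths | [&& x \in h, drop (index x h) h == x :: t & e (head x h) x])
    (1 - w (closed_loop h x)) * flux h * q (x :: t) +
  \sum_(h <- simple_paths | h == t) flux h * q (x :: t).
  rewrite [X in _ = X + _]big_mkcond [X in _ = _ + X]big_mkcond -big_split /=.
  apply: eq_big_seq => h; rewrite mem_simple_paths => sh.
  have hd y : head y h = head v h by case: h sh => //; rewrite /simple_path !andbF.
  have [xh|xh] /= := boolP (x \in h).
    have /negbTE -> : h != t by apply: contraNneq xt => <-.
    rewrite addr0 hd; case: ifP => [/andP[/eqP dh eh]|ndh].
      rewrite (big_pred1 x) ?/step_weight ?xh ?(mulrC (flux h)) // => y.
      apply/andP/eqP => [[_ /eqP /erased_stepE[]//]|->].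
      by rewrite eh xS /erased_step xh dh.
    rewrite big_pred0 // => y; apply/negP => /andP[/andP[ey yS] /eqP E].
    have [yx _] := erased_stepE E; rewrite yx in E ey.
    by move: E ndh; rewrite /erased_step xh => ->; rewrite eqxx ey.
  rewrite add0r; case: eqP => [ht|ht].
    rewrite (big_pred1 x) ?/step_weight ?(negbTE xh) ?mulr1 // => y.
    apply/andP/eqP => [[_ /eqP /erased_stepE[]//]|->].
    rewrite /erased_step (negbTE xh) ht eqxx xS andbT; split=> //.
    by move: sh pt; rewrite ht; case: (t) => [|z r]; rewrite /simple_path ?andbF //= => _ /andP[/andP[]].
  rewrite big_pred0 // => y; apply/negP => /andP[/andP[ey yS] /eqP E].
  by have [_] := erased_stepE E; rewrite (negbTE xh).
rewrite -!mulr_suml -!mulrDl; congr (_ * _).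
rewrite addrCA [RHS]addrC; congr (_ + _).
case: t {xt tS} ut pt sxt => [|y t] ut pt sxt.
  move: pt => /= /eqP ->; rewrite eqxx big_seq_cond big1 ?addr0 // => h.
  by rewrite mem_simple_paths => /andP[sh /eqP h0]; rewrite h0 /simple_path !andbF in sh.
rewrite (_ : (_ == _) = false) ?add0r; last by apply/negP => /eqP[].
rewrite big_mkcond (bigD1_seq (y :: t)) ?simple_paths_uniq //= ?eqxx.
  by rewrite big1 ?addr0 // => h /negbTE ->.
rewrite mem_simple_paths; case/and3P: sxt => _ /= /andP[_ tS] /andP[/andP[_ pt'] lt'].
by apply/and3P; split=> //; apply/andP.
Qed.

End LoopErasedWalk.

(** * Exit law of the loop-erased walk and hitting probabilities *)

Section HittingBound.
Variables (R : realType) (V : finType) (e : rel V) (w : seq V -> R).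
Hypothesis w_rot : forall c i, w (rot i c) = w c.
Hypothesis w01 : forall c, 0 <= w c <= 1.
Variables (S C : {set V}) (v : V).
Hypothesis vS : v \in S.
Hypothesis CS : forall y, y \in C -> y \notin S.
Hypothesis deg_gt0 : forall x, (0 < outdeg e x)%N.

Definition step_value (q : seq V -> R) (h : seq V) (y : V) : R :=
  if y \in C then 1
  else if y \in S then step_weight w h y * q (erased_step h y) else 0.

(* The probability that the loop-erased walk started from h, which stops at the
   first vertex off S and dies with probability [w] upon closing a loop, has
   stopped in C within N steps. *)
Fixpoint hit (N : nat) (h : seq V) : R :=
  if N is N'.+1 then
    (outdeg e (head v h))%:R^-1 *
    \sum_(y | e (head v h) y) step_value (hit N') h y
  else 0.

Lemma step_weight01 h y : 0 <= step_weight w h y <= 1.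
Proof.
rewrite /step_weight; case: ifP => _; last by rewrite ler01 lexx.
by have /andP[? ?] := w01 (closed_loop h y); lra.
Qed.

Lemma hit_ge0 N h : 0 <= hit N h.
Proof.
elim: N h => //= N IH h; rewrite mulr_ge0 ?invr_ge0 //.
apply: sumr_ge0 => y _; rewrite /step_value; do 2 case: ifP => // _.
by rewrite mulr_ge0 //; case/andP: (step_weight01 h y).
Qed.

Lemma step_value_le N h y b : y \notin C -> 0 <= b ->
  (y \in S -> hit N (erased_step h y) <= b) -> step_value (hit N) h y <= b.
Proof.
rewrite /step_value => /negbTE -> b0; case: ifP => // _ /(_ isT) hb.
apply: le_trans hb; apply: ler_piMl; first exact: hit_ge0.
by case/andP: (step_weight01 h y).
Qed.

Lemma average_le u (F : V -> R) b :
  (forall y, e u y -> F y <= b) -> (outdeg e u)%:R^-1 * \sum_(y | e u y) F y <= b.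
Proof.
move=> Fb; rewrite ler_pdivrMl ?ltr0n //.
by apply: le_trans (ler_sum _ Fb) _; rewrite sumr_const mulr_natl.
Qed.

Lemma hit_le1 N h : hit N h <= 1.
Proof.
elim: N h => [|N IH] h /=; first exact: ler01.
apply: average_le => y _; have [yC|yC] := boolP (y \in C).
  by rewrite /step_value yC.
exact: step_value_le.
Qed.

Variable Phi : {ffun V -> V} -> R.
Hypothesis Phi0 : forall f, 0 <= Phi f.
Hypothesis PhiS : forall f b z, b \in S -> Phi (redirect f b z) = Phi f.

Let flux := flux e w S Phi.
Let Z := partition_sum e w Phi S.
Let paths := simple_paths e S v.

Lemma partition_sum_ge0 A : 0 <= partition_sum e w Phi A.
Proof.
apply: sumr_ge0 => f _; rewrite mulr_ge0 ?cycles_weight_ge0 // => c.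
by case/andP: (w01 c).
Qed.

Lemma flux_ge0 h : 0 <= flux h.
Proof. by rewrite divr_ge0 ?partition_sum_ge0 // ltW ?deg_prod_gt0. Qed.

(** Tested against [hit N], the balance identity makes [X N] increase by [T - Z * hit N [:: v]] at
    each step. As [X N] stays below the constant [K], these increments cannot all exceed a fixed
    positive number, whence [T <= Z * b] without any limit of [hit N]. *)
Lemma exit_flux_le b : (forall N, hit N [:: v] <= b) ->
  \sum_(h <- paths) flux h * \sum_(y | e (head v h) y && (y \in C)) 1 <= Z * b.
Proof.
move=> hb; set T := \sum_(h <- _) _.
pose X N := \sum_(h <- paths) (outdeg e (head v h))%:R * flux h * hit N h.
have XS N : X N.+1 = T + X N - Z * hit N [:: v].
  rewrite {2}/X flux_balance // -/Z -/paths [_ * _ + _]addrC addrA addrK.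
  rewrite -big_split /=; apply: eq_bigr => h _.
  rewrite mulrACA mulfV ?mul1r ?pnatr_eq0 -?lt0n //.
  rewrite -mulrDr; congr (_ * _).
  rewrite (bigID (mem C)) /=; congr (_ + _).
    by apply: eq_bigr => y /andP[_ yC]; rewrite /step_value yC.
  rewrite [RHS](eq_bigl (fun y => e (head v h) y && (y \notin C) && (y \in S))); last first.
    move=> y; case yC: (y \in C); last by rewrite andbT.
    by rewrite !andbF (negbTE (CS yC)) andbF.
  rewrite [RHS]big_mkcondr /=; apply: eq_bigr => y /andP[_ yC].
  by rewrite /step_value (negbTE yC).
have XT N : N%:R * T <= N%:R * (Z * b) + X N.
  elim: N => [|N IH]; first by rewrite !mul0r add0r /X big1 // => h _; rewrite mulr0.
  rewrite -natr1 !mulrDl !mul1r XS.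
  have : Z * hit N [:: v] <= Z * b by rewrite ler_wpM2l // partition_sum_ge0.
  lra.
pose K := \sum_(h <- paths) (outdeg e (head v h))%:R * flux h.
have XK N : X N <= K.
  apply: ler_sum => h _; apply: ler_piMr; last exact: hit_le1.
  by rewrite mulr_ge0 ?flux_ge0.
rewrite leNgt; apply/negP => lt; rewrite -subr_gt0 in lt.
have [N KN] : exists N : nat, K / (T - Z * b) < N%:R.
  exists (Num.bound (K / (T - Z * b))); apply: archi_boundP.
  rewrite divr_ge0 ?(ltW lt) //; apply: sumr_ge0 => h _.
  by rewrite mulr_ge0 ?flux_ge0.
move: KN; rewrite ltr_pdivrMr // mulrBr => KN.
have := XT N; have := XK N; lra.
Qed.

Lemma backward_fconnect (f : {ffun V -> V}) y h x :
  path (backward f) y h -> x \in h -> fconnect f x y.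
Proof.
elim: h y => //= a h IH y /andP[/eqP fa ph]; rewrite inE => /orP[/eqP ->|xh].
  by rewrite -fa fconnect1.
by apply: connect_trans (IH a ph xh) _; rewrite -fa fconnect1.
Qed.

(** A union bound over the exit path [h] and the exit point [y]: the maps following [h] to [y] have
    total weight [flux h]. *)
Lemma exit_sum_le (E : pred {ffun V -> V}) b :
    (forall N, hit N [:: v] <= b) ->
    (forall f, arrows e f -> E f ->
       exists h y, [/\ simple_path e S v h, y \in C & path (backward f) y h]) ->
  \sum_(f | arrows e f && E f) Phi f * cycles_weight w S f <= b * Z.
Proof.
move=> hb Eh; rewrite [_ * Z]mulrC; apply: le_trans (exit_flux_le hb).
have W0 A f : 0 <= Phi f * cycles_weight w A f.
  by rewrite mulr_ge0 ?cycles_weight_ge0 // => c; case/andP: (w01 c).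
pose G h y f : R := if path (backward f) y h then Phi f * cycles_weight w S f else 0.
have G0 h y f : 0 <= G h y f by rewrite /G; case: ifP.
apply: le_trans (_ : \sum_(f | arrows e f) \sum_(h <- paths)
   \sum_(y | e (head v h) y && (y \in C)) G h y f <= _).
  rewrite big_mkcondr; apply: ler_sum => f af; case: ifP => [Ef|_]; last first.
    by do 2 apply: sumr_ge0 => ? _.
  have [h [y [sh yC ph]]] := Eh f af Ef.
  rewrite (bigD1_seq h) ?simple_paths_uniq ?mem_simple_paths //=.
  rewrite (bigD1 y) /=; last first.
    rewrite yC andbT; case: h sh ph => [|u t]; first by rewrite /simple_path !andbF.
    by move=> _ /= /andP[/eqP <- _]; apply: (forallP af).
  rewrite {1}/G ph -addrA lerDl addr_ge0 //; first exact: sumr_ge0.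
  by do 2 apply: sumr_ge0 => ? _.
rewrite exchange_big /=; rewrite big_seq [leRHS]big_seq; apply: ler_sum => h.
rewrite mem_simple_paths => sh; rewrite exchange_big mulr_sumr /=.
apply: ler_sum => y /andP[ey yC]; rewrite mulr1.
have /and3P[uh Sh ph] := sh.
have -> : flux h = \sum_(f | arrows e f && path (backward f) y h)
    Phi f * cycles_weight w (S :\: [set x in h]) f.
  rewrite (partition_sum_path w PhiS deg_gt0) //.
  - by case: (h) sh ph ey => [|u t]; rewrite /simple_path ?andbF //= => _ /andP[-> _] ->.
  - exact/allP.
  - by move=> x xh; rewrite !inE xh.
rewrite [leRHS]big_mkcondr; apply: ler_sum => f af; rewrite /G; case: ifP => // pf.
(* A cycle of [f] inside [S] cannot meet [h], because [f] leads every vertex of [h] to [y], which is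
   outside [S]. *)
rewrite (_ : cycles_weight w S f = cycles_weight w (S :\: [set x in h]) f) //.
apply: eq_cycles_weight => z cz.
apply/idP/idP => zS; last by apply: (fintype.subset_trans zS); apply: finset.subsetDl.
apply/fintype.subsetP => x xz; rewrite !inE (fintype.subsetP zS) // andbT.
apply/negP => xh; have := CS yC; rewrite (fintype.subsetP zS) //.
by rewrite -(orbit_mem_eq cz xz) -fconnect_orbit (backward_fconnect pf).
Qed.

Lemma exit_path (f : {ffun V -> V}) n : arrows e f -> iter n f v \notin S ->
  exists h y, [/\ simple_path e S v h, y \notin S & path (backward f) y h].
Proof.
(* The path stops at the first time out of [S]. It is simple, since a repetition before that time
   would trap the trajectory in [S] forever. *)
move=> af nS; have [i iS imin] := ex_minnP (ex_intro (fun n => iter n f v \notin S) n nS).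
exists (rev (traject f v i)), (iter i f v).
have pb j : path (backward f) (iter j f v) (rev (traject f v j)).
  by elim: j => [//|j IH]; rewrite trajectSr rev_rcons /= IH andbT /backward /=.
have tS x : x \in traject f v i -> x \in S.
  case/trajectP => j ji ->; apply/negPn/negP => /imin.
  by rewrite leqNgt ji.
split=> //; apply/and3P; split.
- rewrite rev_uniq; case: i iS tS {imin} => // i iS tS.
  rewrite looping_uniq; apply/negP => /loopingP/(_ i.+1) /= ti.
  by move: iS; rewrite tS // trajectSr mem_rcons inE ti orbT.
- by rewrite all_rev; apply/allP.
- case: i iS {imin tS} => [|i _]; first by rewrite vS.
  rewrite trajectSr rev_rcons; apply/andP; split.
    apply: sub_path (pb i) => a b /eqP <-; exact: (forallP af).
  by case: i => //= i; rewrite rev_cons last_rcons.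
Qed.

End HittingBound.

(** * Exponential decay of hitting probabilities across nested levels *)

Section Decay.
Variables (R : realType) (V : finType) (e : rel V) (w : seq V -> R).
Hypothesis w_rot : forall c i, w (rot i c) = w c.
Hypothesis w01 : forall c, 0 <= w c <= 1.
Variables (S C : {set V}) (v : V).
Hypothesis deg_gt0 : forall x, (0 < outdeg e x)%N.
Variables (alpha beta : R).
Hypotheses (alpha01 : 0 <= alpha <= 1) (beta01 : 0 <= beta <= 1).

Let hit := hit e w S C v.
Let invdeg (k : seq V) : R := \prod_(x <- k) (outdeg e x)%:R^-1.

Lemma invdeg01 k : 0 <= invdeg k <= 1.
Proof.
rewrite /invdeg; apply/andP; split; first by apply: prodr_ge0 => x _; rewrite invr_ge0.
elim: k => [|x k IH]; first by rewrite big_nil.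
rewrite big_cons mulr_ile1 //; first by apply: prodr_ge0 => y _; rewrite invr_ge0.
by rewrite invf_le1 ?ler1n ?ltr0n deg_gt0.
Qed.

Lemma erased_step_cons (h : seq V) y : exists r, erased_step h y = y :: r.
Proof.
rewrite /erased_step; case: ifP => yh; last by exists h.
by exists (drop (index y h).+1 h); rewrite (drop_nth y) ?index_mem ?nth_index.
Qed.

Lemma erased_step_uniq (h : seq V) y : uniq h -> uniq (erased_step h y).
Proof.
by move=> uh; rewrite /erased_step; case: ifP => yh /=; rewrite ?drop_uniq ?yh.
Qed.

Section Level.
Variables (J : {set V}) (b : R).
Hypothesis b0 : 0 <= b.
Hypothesis CJ : C \subset J.
Hypothesis hit_b :
  forall N h, uniq h -> h != [::] -> head v h \notin J -> hit N h <= b.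

Let away (z : V) := forall y, e z y -> y \notin J.

Lemma hit_step_b N h y : uniq h -> y \notin J -> hit N (erased_step h y) <= b.
Proof.
move=> uh yJ; apply: hit_b; first exact: erased_step_uniq.
  by have [r ->] := erased_step_cons h y.
by have [r ->] := erased_step_cons h y.
Qed.

(** The favourable neighbour [z] is chosen with probability [1 / outdeg]; all the others are outside
    [J], where the bound [b] is available. *)
Lemma hit_gain delta h z : 0 <= delta <= 1 -> uniq h -> away (head v h) ->
    e (head v h) z ->
    (forall N, step_weight w h z * hit N (erased_step h z) <= (1 - delta) * b) ->
  forall N, hit N h <= (1 - delta / (outdeg e (head v h))%:R) * b.
Proof.
move=> /andP[d0 d1] uh aw ez gain; set u := head v h in aw ez *.
have du : 0 < (outdeg e u)%:R :> R by rewrite ltr0n.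
have du1 : 1 <= (outdeg e u)%:R :> R by rewrite ler1n.
have delta_le : 0 <= delta / (outdeg e u)%:R <= 1.
  rewrite divr_ge0 ?(ltW du) //= ler_pdivrMr // mul1r; exact: le_trans du1.
case=> [|N] /=; first by rewrite mulr_ge0 // subr_ge0; case/andP: delta_le.
have yC y : e u y -> y \notin C.
  by move=> /aw; apply: contra; apply: (fintype.subsetP CJ).
rewrite ler_pdivrMl //.
have -> : (outdeg e u)%:R * ((1 - delta / (outdeg e u)%:R) * b) =
    (1 - delta) * b + ((outdeg e u)%:R - 1) * b.
  by field; rewrite gt_eqF.
rewrite (bigD1 z) //=; apply: lerD.
  rewrite /step_value (negbTE (yC z ez)); case: ifP => // _.
  by rewrite mulr_ge0 // subr_ge0.
apply: (@le_trans _ _ (\sum_(y | e u y && (y != z)) b)).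
  apply: ler_sum => y /andP[ey _]; apply: step_value_le => //; first exact: yC.
  by move=> _; apply: hit_step_b => //; apply: aw.
rewrite sumr_const -[leLHS]mulr_natl; apply: ler_wpM2r => //.
rewrite lerBrDr natr1 ler_nat.
rewrite /outdeg [leqRHS](cardD1 z) [z \in e u]ez ltnS.
apply: subset_leq_card; apply/fintype.subsetP => y.
by rewrite !inE unfold_in andbC.
Qed.

(** Induction on the part [t] still to be walked. As [rest] avoids the cycle, no loop closes before
    the return to [x], and the loop closed there is exactly [c], which survives with weight at most
    [1 - alpha]. *)
Lemma hit_second_round t x s rest : 
    let c := (x :: s) ++ t in
    uniq c -> cycle e c -> alpha <= w c -> {in c, forall z, away z} ->
    {in c, forall z, z \notin rest} -> uniq (rev (x :: s) ++ rest) ->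
  forall N, hit N (rev (x :: s) ++ rest) <= (1 - alpha * invdeg (last x s :: t)) * b.
Proof.
have /andP[al0 al1] := alpha01.
elim: t s => [|y t IH] s c uc ec wc awc restc uh N.
  have hE : head v (rev (x :: s) ++ rest) = last x s.
    by rewrite (lastI x s) rev_rcons.
  have xh : x \in rev (x :: s) ++ rest by rewrite mem_cat mem_rev mem_head.
  rewrite /invdeg big_seq1 -hE; apply: (hit_gain (z := x)) => //.
  - rewrite hE; apply: awc; rewrite mem_cat; apply/orP; left; exact: mem_last.
  - by move: ec; rewrite /c cats0 /= rcons_path hE => /andP[].
  - move=> M; rewrite /step_weight xh.
    have -> : closed_loop (rev (x :: s) ++ rest) x = c.
      rewrite /closed_loop; have -> : index x (rev (x :: s) ++ rest) = size s.
        rewrite rev_cons index_cat mem_rcons mem_head -cats1 index_cat mem_rev.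
        move: uc; rewrite /c cats0 /= => /andP[/negbTE -> _].
        by rewrite /= eqxx addn0 size_rev.
      by rewrite take_size_cat ?size_rev // revK /c cats0.
    have := w01 c; have hb := hit_step_b M uh; move=> /andP[w0 w1].
    have xJ : x \notin J.
      apply: (awc (last x s)); first by rewrite mem_cat mem_last.
      by move: ec; rewrite /c cats0 /= rcons_path => /andP[].
    have h0 : 0 <= hit M (erased_step (rev (x :: s) ++ rest) x) by apply: hit_ge0.
    have := hb x xJ; nra.
have hE : head v (rev (x :: s) ++ rest) = last x s.
  by rewrite (lastI x s) rev_rcons.
have cE : c = (x :: rcons s y) ++ t by rewrite /c -cat_rcons.
have yc : y \in c by rewrite mem_cat mem_head orbT.
have ely : e (last x s) y.
  move: ec; rewrite /c /= -cats1 -catA cat_path /= => /andP[_].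
  by case/andP.
rewrite /invdeg big_cons mulrCA [X in 1 - X]mulrC -hE; apply: (hit_gain (z := y)) => //.
- rewrite -/(invdeg (y :: t)); have /andP[i0 i1] := invdeg01 (y :: t).
  by rewrite mulr_ge0 //= mulr_ile1.
- by rewrite hE; apply: awc; rewrite mem_cat mem_last.
- by rewrite hE.
- move=> M; have yh : y \notin rev (x :: s) ++ rest.
    rewrite mem_cat mem_rev negb_or restc // andbT.
    move: uc; rewrite /c cat_uniq => /and3P[_ /hasPn/(_ y) + _]; apply; exact: mem_head.
  rewrite /step_weight /erased_step (negbTE yh) mul1r.
  have -> : y :: rev (x :: s) ++ rest = rev (x :: rcons s y) ++ rest.
    by rewrite -rcons_cons rev_rcons.
  rewrite -/(invdeg (y :: t)) -[y in invdeg (y :: t)](last_rcons x s y).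
  apply: IH; rewrite -?cE //.
  by rewrite -rcons_cons rev_rcons /= yh.
Qed.

Lemma invdeg_cat k k' : invdeg (k ++ k') = invdeg k * invdeg k'.
Proof. exact: big_cat. Qed.

(* Whatever the past, a first round along the cycle leaves a path whose last part
   consists of cycle vertices and whose earlier part avoids the cycle; a second
   round then closes exactly the cycle. *)
Lemma hit_first_round t p x s rest :
    let c := p ++ (x :: s) ++ t in
    uniq c -> cycle e c -> alpha <= w c -> {in c, forall z, away z} ->
    {in p ++ x :: s, forall z, z \notin rest} -> uniq (rev (x :: s) ++ rest) ->
  forall N, hit N (rev (x :: s) ++ rest) <=
    (1 - alpha * invdeg c * invdeg (last x s :: t)) * b.
Proof.
have /andP[al0 al1] := alpha01.
elim: t p x s rest => [|y t IH] p x s rest c uc ec wc awc restc uh N.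
  have cE : c = p ++ (x :: s) by rewrite /c cats0.
  have rotE : rot (size p) c = (x :: s) ++ p by rewrite cE rot_size_cat.
  (* The first round is over and [rest] avoids all of [c]. The current segment starts at [x], so
     only the vertices of [p] remain to be walked before closing at [x]. *)
  apply: le_trans (hit_second_round (t := p) _ _ _ _ _ uh N) _.
  - by rewrite -rotE rot_uniq.
  - by rewrite -rotE rot_cycle.
  - by rewrite -rotE w_rot.
  - by move=> z; rewrite -rotE mem_rot; apply: awc.
  - by move=> z; rewrite -rotE mem_rot cE; apply: restc.
  apply: ler_wpM2r => //; rewrite lerD2l lerN2 -mulrA; apply: ler_wpM2l => //.
  rewrite cE invdeg_cat.
  have -> : invdeg (last x s :: p) = invdeg [:: last x s] * invdeg p.
    by rewrite -invdeg_cat.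
  have /andP[ip0 _] := invdeg01 p; have /andP[_ is1] := invdeg01 (x :: s).
  have /andP[il0 _] := invdeg01 [:: last x s].
  by rewrite mulrAC [leRHS]mulrC; apply: ler_piMr; rewrite ?mulr_ge0.
have hE : head v (rev (x :: s) ++ rest) = last x s.
  by rewrite (lastI x s) rev_rcons.
have ely : e (last x s) y.
  have : cycle e (rot (size p) c) by rewrite rot_cycle.
  rewrite /c rot_size_cat /= -cats1 -!catA cat_path /= => /andP[_].
  by case/andP.
have lc : last x s \in c by rewrite !mem_cat mem_last orbT.
have yc : y \in c by rewrite !mem_cat mem_head !orbT.
have /andP[ic0 ic1] := invdeg01 c; have /andP[i0 i1] := invdeg01 (y :: t).
have gain : forall M, hit M (erased_step (rev (x :: s) ++ rest) y) <=
    (1 - alpha * invdeg c * invdeg (y :: t)) * b.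
  move=> M; have ysp : y \notin p ++ x :: s.
    move: uc; rewrite /c catA cat_uniq => /and3P[_ /hasPn/(_ y) + _]; apply.
    exact: mem_head.
  have /norP[yp ys] : ~~ ((y \in p) || (y \in x :: s)) by rewrite -mem_cat.
  rewrite /erased_step; case: ifP => yh.
    have yr : y \in rest by move: yh; rewrite mem_cat mem_rev (negbTE ys).
    (* Stepping on the old vertex [y] erases the current segment and [r1]: the vertices [x :: s]
       join [p], and a new segment starts at [y]. *)
    case/splitPr: {yh} yr restc uh => r1 r2 restc uh.
    have -> : drop (index y (rev (x :: s) ++ r1 ++ y :: r2)) (rev (x :: s) ++ r1 ++ y :: r2) =
        rev [:: y] ++ r2.
      rewrite catA index_cat; case: ifP => [|_] /=.
        move: uh; rewrite catA cat_uniq => /and3P[_ /hasPn/(_ y (mem_head _ _))].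
        by move=> /negbTE /= ->.
      by rewrite eqxx addn0 drop_size_cat.
    have cE : c = (p ++ x :: s) ++ [:: y] ++ t by rewrite /c -catA.
    rewrite cE; apply: (IH (p ++ x :: s) y [::]); rewrite -?cE //.
      move=> z; rewrite mem_cat => /orP[zp|].
        have := restc z zp; rewrite mem_cat inE !negb_or.
        by case/and3P.
      rewrite inE => /eqP ->.
      by move: uh; rewrite catA cat_uniq /= => /and4P[].
    by move: uh; rewrite catA cat_uniq /= => /and3P[_ _].
  have -> : y :: rev (x :: s) ++ rest = rev (x :: rcons s y) ++ rest.
    by rewrite -rcons_cons rev_rcons.
  have cE : c = p ++ (x :: rcons s y) ++ t by rewrite /c -rcons_cons cat_rcons.
  rewrite cE -[y in invdeg (y :: t)](last_rcons x s y).
  apply: IH; rewrite -?cE //.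
    move=> z; rewrite -rcons_cons -cats1 catA mem_cat => /orP[/restc //|].
    rewrite inE => /eqP ->; move: yh; rewrite mem_cat => /norP[_ //].
  by rewrite -rcons_cons rev_rcons /= yh.
have -> : alpha * invdeg c * invdeg (last x s :: y :: t) =
    (alpha * invdeg c * invdeg (y :: t)) / (outdeg e (last x s))%:R.
  by rewrite [invdeg (_ :: _ :: _)]/invdeg big_cons mulrCA mulrC.
rewrite -hE; apply: (hit_gain (z := y)); rewrite ?hE //.
- by rewrite !mulr_ge0 //= mulr_ile1 ?mulr_ge0 // mulr_ile1.
- exact: awc.
(* A loop closed during the first round can only lower the value, the survival weight being at most
   1. *)
- move=> M; apply: le_trans (gain M); apply: ler_piMl; first exact: hit_ge0.
  by case/andP: (step_weight01 w01 (rev (x :: s) ++ rest) y).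
Qed.

Lemma hit_two_rounds h c : uniq h -> away (head v h) -> uniq c -> cycle e c ->
    e (head v h) (head v c) -> c != [::] -> alpha <= w c ->
    {in c, forall z, away z} -> beta <= invdeg (head v h :: c) ->
  forall N, hit N h <= (1 - alpha * beta ^+ 2) * b.
Proof.
case: c => // x t uh ah uc ec ex _ wc awc bc N.
have /andP[al0 al1] := alpha01; have /andP[be0 be1] := beta01.
have /andP[ic0 ic1] := invdeg01 (x :: t).
have [r rE] := erased_step_cons h x.
have ur : uniq (x :: r) by rewrite -rE erased_step_uniq.
have gain M : hit M (erased_step h x) <=
    (1 - alpha * invdeg (x :: t) * invdeg (x :: t)) * b.
  rewrite rE; apply: (@hit_first_round t [::] x [::] r) => //.
  by move=> z; rewrite inE => /eqP ->; case/andP: ur.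
apply: le_trans (hit_gain (z := x) (delta := alpha * invdeg (x :: t) * invdeg (x :: t)) _ uh ah ex _ N) _.
- by rewrite !mulr_ge0 //= mulr_ile1 ?mulr_ge0 // mulr_ile1.
- move=> M; apply: le_trans (gain M); apply: ler_piMl; first exact: hit_ge0.
  by case/andP: (step_weight01 w01 h x).
(* One factor [invdeg (x :: t)] absorbs the inverse degree of the end of [h] and becomes the
   quantity bounded below by [beta]; the other factor is even larger. *)
apply: ler_wpM2r => //; rewrite lerD2l lerN2 -!mulrA; apply: ler_wpM2l => //.
rewrite expr2; apply: ler_pM => //; last first.
  by apply: le_trans bc _; rewrite /invdeg big_cons mulrC.
apply: le_trans bc _; rewrite [X in X <= _]/invdeg big_cons; apply: ler_piMl => //.
by rewrite invf_le1 ?ler1n ?ltr0n deg_gt0.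
Qed.

End Level.

Definition away_from (J : {set V}) (z : V) := forall y, e z y -> y \notin J.

(** A vertex outside [J j.+1] either cannot enter it in one step or is offered a loop. Keeping [u]
    and the loop away from the smaller set [J j] makes the bound of level [j] available during both
    rounds. *)
Definition loop_level (J : nat -> {set V}) (j : nat) := forall u, u \notin J j.+1 ->
  away_from (J j.+1) u \/
  exists c, [/\ uniq c && cycle e c, e u (head u c) && (c != [::]), alpha <= w c,
    {in u :: c, forall z, away_from (J j) z} & beta <= invdeg (u :: c)].

(** To enter [J j.+1], the walk must first stand at a vertex of the second kind in [loop_level],
    where the two rounds gain one factor over the bound of level [j]. *)
Lemma hit_decay (J : nat -> {set V}) n : C \subset J 0 ->
    (forall j, (j < n)%N -> J j \subset J j.+1) ->
    (forall j, (j < n)%N -> loop_level J j) ->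
  forall N h, uniq h -> h != [::] -> head v h \notin J n ->
  hit N h <= (1 - alpha * beta ^+ 2) ^+ n.
Proof.
move=> CJ Jmono lev.
have /andP[al0 al1] := alpha01; have /andP[be0 be1] := beta01.
have eps : 0 <= 1 - alpha * beta ^+ 2.
  by rewrite subr_ge0 mulr_ile1 ?exprn_ge0 ?exprn_ile1.
have CJn j : (j <= n)%N -> C \subset J j.
  elim: j => // j IH jn; apply: fintype.subset_trans (Jmono j jn).
  exact/IH/ltnW.
suff H j : (j <= n)%N -> forall N h, uniq h -> h != [::] -> head v h \notin J j ->
    hit N h <= (1 - alpha * beta ^+ 2) ^+ j by apply: H.
elim: j => [|j IH] jn N h uh h0 hJ; first by rewrite expr0 hit_le1.
have {}IH := IH (ltnW jn).
(* The inner induction on the number of steps lets the walk wander as long as it cannot enter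
   [J j.+1]. *)
rewrite exprS; elim: N h uh h0 hJ => [|N IHN] h uh h0 hJ.
  by rewrite /= mulr_ge0 // exprn_ge0.
have := lev j jn _ hJ; case=> [aw|[c [/andP[uc ec] /andP[eu c0] wc awc bc]]].
  apply: average_le => // y ey; apply: step_value_le.
  - by [].
  - by apply/negP => /(fintype.subsetP (CJn _ jn)); apply/negP/aw.
  - by rewrite mulr_ge0 // exprn_ge0.
  move=> yS; have [r rE] := erased_step_cons h y.
  by rewrite rE; apply: IHN => //; rewrite -?rE ?erased_step_uniq ?rE //=; apply: aw.
apply: (@hit_two_rounds (J j) _ _ _ _ h c) => //.
- by rewrite exprn_ge0.
- exact/CJn/ltnW.
- by apply: awc; exact: mem_head.
- by case: c c0 eu {uc ec wc awc bc}.
- by move=> z zc; apply: awc; rewrite inE zc orbT.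
Qed.

End Decay.

(** * Freezing the special cycles *)

Section SpecialCycles.
Variables (R : realType) (V : finType) (e : rel V) (w : seq V -> R).
Hypothesis w_rot : forall c i, w (rot i c) = w c.
Hypothesis w_ge0 : forall c, 0 <= w c.
Variable special : pred (seq V).
Hypothesis special_rot : forall c i, special (rot i c) = special c.
Hypothesis w_le1 : forall c, ~~ special c -> w c <= 1.

Definition ordinary_weight (c : seq V) : R := if special c then 0 else w c.

Let w' := ordinary_weight.

Lemma ordinary_weight_rot c i : w' (rot i c) = w' c.
Proof. by rewrite /w' /ordinary_weight special_rot w_rot. Qed.

Lemma ordinary_weight01 c : 0 <= w' c <= 1.
Proof.
rewrite /w' /ordinary_weight; case: ifP => [_|/negbT /w_le1 ->].
  by rewrite lexx ler01.
by rewrite w_ge0.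
Qed.

Implicit Types (f : {ffun V -> V}) (U : {set V}).

Definition special_vertices f : {set V} :=
  [set x | fcycle f (orbit f x) && special (orbit f x)].

(** It only involves the values of [f] on [U], and can therefore serve as [Phi] for the walk on the
    complement of [U]. *)
Definition special_factor U f : R :=
  if [forall x in U, [&& fcycle f (orbit f x), special (orbit f x) & orbit f x \subset U]]
  then cycles_weight w U f else 0.

Lemma special_factor_ge0 U f : 0 <= special_factor U f.
Proof. by rewrite /special_factor; case: ifP => // _; apply: cycles_weight_ge0. Qed.

Lemma special_factor_redirect U f b z : b \in ~: U ->
  special_factor U (redirect f b z) = special_factor U f.
Proof.
rewrite inE => bU.
have fU : {in U, redirect f b z =1 f}.
  by move=> x xU; rewrite ffunE; case: eqP => // xb; rewrite -xb xU in bU.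
rewrite /special_factor (cycles_weight_agree _ fU); congr (if _ then _ else _).
apply/eq_forallb => x; case xU: (x \in U) => //=; apply/and3P/and3P => -[cx sx oU].
  by have [E cx'] := cycle_agree fU cx oU; rewrite cx' E.
have [E cx'] := cycle_agree (f' := redirect f b z) (fun y yU => esym (fU y yU)) cx oU.
by rewrite cx' E.
Qed.

Lemma special_vertices_orbit f x y : fcycle f (orbit f x) -> y \in orbit f x ->
  (y \in special_vertices f) = (x \in special_vertices f).
Proof.
move=> cx xy; rewrite !inE cx (orbit_mem_cycle cx xy) /=.
by rewrite (orbit_mem cx xy) special_rot.
Qed.

(** A special cycle not contained in [U] contributes weight 0 to the second factor, so the product
    vanishes unless [U] carries exactly the special cycles; in that case the cycles split into those
    in [U] and those off [U]. *)
Lemma special_factorE U f :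
  special_factor U f * cycles_weight w' (~: U) f =
  if special_vertices f == U then cycles_weight w [set: V] f else 0.
Proof.
rewrite /special_factor; case: ifP => [/forall_inP sU|nU]; last first.
  rewrite mul0r; case: eqP => // fU; case/negP: (negbT nU).
  apply/forall_inP => x; rewrite -{1}fU => xs.
  have := xs; rewrite inE => /andP[cx sx]; apply/and3P; split=> //.
  by apply/fintype.subsetP => y yx; rewrite -fU (special_vertices_orbit cx yx).
have oT x : orbit f x \subset [set: V] by apply/fintype.subsetP => y _; rewrite inE.
have [fU|nfU] := eqVneq (special_vertices f) U.
  rewrite [RHS](bigID (mem U)) /=; congr (_ * _); apply: eq_big => x.
  - rewrite -!andbA; case cx: (fcycle f (orbit f x)) => //=; case: eqP => //= _.
    rewrite oT /=; apply/idP/idP => [/fintype.subsetP/(_ x (in_orbit _ _)) //|xU].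
    by case/and3P: (sU x xU).
  - by [].
  - rewrite -!andbA; case cx: (fcycle f (orbit f x)) => //=; case: eqP => //= _.
    rewrite oT /=; apply/idP/idP => [/fintype.subsetP/(_ x (in_orbit _ _))|xU].
      by rewrite inE.
    apply/fintype.subsetP => y yx.
    by rewrite inE -fU (special_vertices_orbit cx yx) fU.
  - case/and3P=> cx _ /fintype.subsetP/(_ x (in_orbit _ _)).
    by rewrite inE -fU inE cx /= /w' /ordinary_weight => /negbTE ->.
have : ~~ (special_vertices f \subset U).
  apply: contra nfU => fU; rewrite finset.eqEsubset fU; apply/fintype.subsetP => x /sU.
  by case/and3P=> cx sx _; rewrite inE cx.
case/fintype.subsetPn => x; rewrite inE => /andP[cx sx] xU.
rewrite (cycles_weightD ordinary_weight_rot cx).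
  by rewrite /w' {1}/ordinary_weight sx mul0r mulr0.
apply/fintype.subsetP => y yx; rewrite inE; apply: contra xU => /sU /and3P[_ _ /fintype.subsetP].
by apply; rewrite (orbit_mem_eq cx yx) in_orbit.
Qed.

(** Whichever of [x] and [y] is visited first on the trajectory of [v] leads to the other one. *)
Lemma fconnect_cycles f v x y : fconnect f v x -> fconnect f v y ->
  fcycle f (orbit f x) -> fcycle f (orbit f y) -> y \in orbit f x.
Proof.
move=> vx vy cx cy; rewrite -fconnect_orbit.
rewrite -(iter_findex vx) -(iter_findex vy).
have [ij|/ltnW ji] := leqP (findex f v x) (findex f v y).
  by rewrite -(subnK ij) iterD fconnect_iter.
have yx : x \in orbit f y.
  rewrite -fconnect_orbit -(iter_findex vx) -(iter_findex vy) -(subnK ji) iterD.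
  exact: fconnect_iter.
by rewrite !iter_findex // fconnect_orbit (orbit_mem_eq cy yx) in_orbit.
Qed.

Variables (alpha beta : R).
Hypotheses (alpha01 : 0 <= alpha <= 1) (beta01 : 0 <= beta <= 1).

Definition leads_to_cycle f (v : V) (C : {set V}) : bool :=
  [exists x in C, [&& fcycle f (orbit f x), [set y in orbit f x] == C & fconnect f v x]].

(* The special cycles are frozen; the rest of the configuration is sampled by
   loop-erased walks stopped at the special cycles. *)
Lemma leads_to_cycle_le (v : V) (C : {set V}) (J : nat -> {set V}) n :
    (forall c, [set x in c] = C -> special c) ->
    C \subset J 0%N -> (forall j, (j < n)%N -> J j \subset J j.+1) -> v \notin J n ->
    (forall j, (j < n)%N -> loop_level e w' alpha beta J j) ->
  \sum_(f | arrows e f && leads_to_cycle f v C) cycles_weight w [set: V] f <=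
  (1 - alpha * beta ^+ 2) ^+ n * \sum_(f | arrows e f) cycles_weight w [set: V] f.
Proof.
move=> Cs CJ Jmono vJ lev; set r := _ ^+ n.
have [f0 af0|noarr] := pickP (arrows e); last first.
  by rewrite !big_pred0 ?mulr0 // => f; rewrite noarr.
have deg_gt0 x : (0 < outdeg e x)%N.
  by apply/card_gt0P; exists (f0 x); apply: (forallP af0).
have vC : v \notin C.
  apply: contra vJ; apply: fintype.subsetP.
  have : forall j, (j <= n)%N -> C \subset J j; last exact.
  elim=> // j IH jn; apply: fintype.subset_trans (Jmono j jn); exact/IH/ltnW.
rewrite (partition_big special_vertices predT) //= mulr_sumr.
rewrite [leRHS](_ : _ = \sum_(U : {set V}) r *
    \sum_(f | arrows e f && (special_vertices f == U)) cycles_weight w [set: V] f); last first.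
  by rewrite -!mulr_sumr (partition_big special_vertices predT).
apply: ler_sum => U _.
pose E := [pred f | leads_to_cycle f v C && (special_vertices f == U)].
have sumE (P : pred {ffun V -> V}) :
    \sum_(f | P f && (special_vertices f == U)) cycles_weight w [set: V] f =
    \sum_(f | P f) special_factor U f * cycles_weight w' (~: U) f.
  by rewrite big_mkcondr; apply: eq_bigr => f _; rewrite special_factorE.
rewrite !sumE.
rewrite (_ : \sum_(f | arrows e f && leads_to_cycle f v C) _ =
   \sum_(f | arrows e f && E f) special_factor U f * cycles_weight w' (~: U) f); last first.
  rewrite [RHS](eq_bigl (fun f => arrows e f && leads_to_cycle f v C && (special_vertices f == U))).
    rewrite [RHS]big_mkcondr; apply: eq_bigr => f _.
    by rewrite special_factorE; case: ifP.
  by move=> f; rewrite /= andbA.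
have Z0 : 0 <= r * \sum_(f | arrows e f) special_factor U f * cycles_weight w' (~: U) f.
  apply: mulr_ge0; last apply: sumr_ge0 => f _.
    case/andP: alpha01 => a0 a1; case/andP: beta01 => b0 b1.
    by rewrite exprn_ge0 // subr_ge0 mulr_ile1 ?exprn_ge0 ?exprn_ile1.
  rewrite mulr_ge0 ?special_factor_ge0 ?cycles_weight_ge0 // => c.
  by case/andP: (ordinary_weight01 c).
(* If a map contributes, it shows that [C] lies in [U] and that [v] does not: two facts about [U]
   alone, valid for all the maps of this class. *)
have [f1 /andP[af1 /andP[lf1 /eqP sf1]]|noE] := pickP (fun f => arrows e f && E f); last first.
  by rewrite big_pred0.
have CU : {subset C <= U}.
  case/exists_inP: lf1 => x xC /and3P[cx /eqP oC _] y.
  rewrite -oC inE => yx; rewrite -sf1 (special_vertices_orbit cx yx) inE cx /=.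
  exact: Cs.
have vU : v \in ~: U.
  rewrite inE -sf1 inE; apply/negP => /andP[cv _].
  case/exists_inP: lf1 => x xC /and3P[cx /eqP oC vx].
  case/negP: vC; rewrite -oC inE; exact: fconnect_cycles vx (connect0 _ _) cx cv.
have CS y : y \in C -> y \notin ~: U by move=> /CU yU; rewrite inE yU.
apply: (exit_sum_le ordinary_weight_rot ordinary_weight01 vU CS deg_gt0) => //.
- exact: special_factor_ge0.
- by move=> f b z; apply: special_factor_redirect.
- by move=> N; apply: (hit_decay ordinary_weight_rot ordinary_weight01) CJ Jmono lev _ _ _ _ _.
- move=> f af /andP[lf /eqP sf].
  case/exists_inP: lf => x xC /and3P[cx /eqP oC vx].
  have [|h [y [sh yU pf]]] := exit_path vU (n := findex f v x) af.
    by rewrite iter_findex // CS.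
  (* The first frozen vertex [y] met from [v] lies on a cycle, and a trajectory reaches a single
     cycle, which here is [C]. *)
  exists h, y; split=> //; rewrite -oC inE.
  have yf : y \in special_vertices f by rewrite sf; rewrite inE negbK in yU.
  have vy : fconnect f v y.
    apply: (backward_fconnect pf); case/and3P: sh => _ _; case: (h) => // u t /andP[_ /eqP <-].
    exact: mem_last.
  by move: yf; rewrite inE => /andP[cy _]; apply: fconnect_cycles vx vy cx cy.
Qed.

End SpecialCycles.

(** * Cycles and orientations *)

Section CycleSequences.
Variable T : eqType.
Implicit Types (f : T -> T) (c p q : seq T).

Lemma next_next_neq c x : uniq c -> (2 < size c)%N -> x \in c ->
  next c (next c x) != x.
Proof.
move=> uc sc xc; have [i s E] := rot_to xc.
rewrite -(next_rot i uc) -(next_rot i uc) E.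
have : uniq (x :: s) by rewrite -E rot_uniq.
have : (2 < size (x :: s))%N by rewrite -E size_rot.
case: s {E} => [|y [|z s]] // _ /=; rewrite !inE !negb_or => /andP[/and3P[xy xz _] _].
by rewrite eqxx (eq_sym y) (negbTE xy) eqxx (eq_sym z).
Qed.

Lemma cycle_closed (P : T -> Prop) c x : uniq c -> x \in c -> P x ->
  {in c, forall y, P y -> P (next c y)} -> {in c, forall y, P y}.
Proof.
move=> uc xc Px Pn; have [i s E] := rot_to xc.
have : fcycle (next c) (x :: s) by rewrite -E rot_cycle cycle_next.
have sc : {subset x :: s <= c} by move=> y; rewrite -E mem_rot.
suff H : forall y, y \in x :: s -> fcycle (next c) (x :: s) -> P y.
  by move=> cn y yc; apply: H => //; rewrite -E mem_rot.
rewrite /= => y + /=; rewrite rcons_path => + /andP[+ _].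
elim: s x xc Px sc {E} => [|z s IH] x xc Px sc; first by rewrite inE => /eqP ->.
rewrite inE => /orP[/eqP -> //|ys] /= /andP[/eqP xz ps].
apply: (IH z) => //; first by apply: sc; rewrite !inE eqxx orbT.
  by rewrite -xz; apply: Pn.
by move=> t tz; apply: sc; rewrite inE tz orbT.
Qed.

(* On a cycle of the undirected graph of f, an edge used backwards forces the
   next one to be used backwards too. *)
Lemma oriented_cycle f c : uniq c -> (2 < size c)%N ->
    cycle (fun a b => (f a == b) || (f b == a)) c ->
  fcycle f c \/ fcycle f (rev c).
Proof.
move=> uc sc cc; have symn x : x \in c -> (f x == next c x) || (f (next c x) == x).
  by move=> xc; apply: (next_cycle cc xc).
have [/hasP[x xc /eqP fx]|/hasPn nb] := boolP (has (fun x => f (next c x) == x) c).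
  right; have back : {in c, forall y, f (next c y) = y}.
    apply: (cycle_closed uc xc fx) => y yc fy.
    have := symn (next c y); rewrite mem_next fy => /(_ yc)/orP[|/eqP //].
    by move=> /eqP/esym/eqP; rewrite (negbTE (next_next_neq uc sc yc)).
  have := cycle_next (p := rev c); rewrite rev_uniq => /(_ uc).
  rewrite (eq_in_cycle (P := mem (rev c)) (e' := frel f)) //.
  move=> a b /=; rewrite !mem_rev => ac bc.
  by rewrite next_rev // -{2}(next_prev uc a) back ?mem_prev.
left; have := cycle_next uc.
rewrite (eq_in_cycle (P := mem c) (e' := frel f)) //.
move=> a b /= ac bc.
by have := symn a ac; rewrite (negbTE (nb a ac)) orbF => /eqP ->.
Qed.

(** Rotated so as to begin at [x], both sequences are the trajectory of [x] up to its first
    return. *)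
Lemma fcycle_rot f p q x : uniq p -> uniq q -> fcycle f p -> fcycle f q ->
  x \in p -> x \in q -> exists i j, q = rot i (rot j p).
Proof.
move=> up uq cp cq xp xq; have [i s E] := rot_to xp; have [j t F] := rot_to xq.
suff st : s = t.
  exists (size q - j)%N, i; rewrite E st -F.
  by rewrite -{1}[q](rotK j) /rotr size_rot.
have : fcycle f (x :: s) by rewrite -E rot_cycle.
have : fcycle f (x :: t) by rewrite -F rot_cycle.
have : uniq (x :: s) by rewrite -E rot_uniq.
have : uniq (x :: t) by rewrite -F rot_uniq.
have traj r : fcycle f (x :: r) ->
    iter (size r).+1 f x = x /\ r = traject f (f x) (size r).
  move=> /fpathE; rewrite size_rcons trajectSr => /rcons_inj[rE xE].
  by split=> //; rewrite iterSr -xE.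
move=> ut us /traj[xt tE] /traj[xs sE].
(* If the lengths differed, the early return of the shorter cycle would put [x] in the tail of the
   longer one. *)
have ne r r' : (size r < size r')%N -> iter (size r).+1 f x = x ->
    r' = traject f (f x) (size r') -> x \in r'.
  move=> rr' xr ->; rewrite -[X in X \in _]xr iterSr -(nth_traject f rr').
  by rewrite mem_nth // size_traject.
rewrite sE tE; have [] := ltngtP (size s) (size t); last by move=> ->.
- by move=> /ne/(_ xs tE); move: ut; rewrite /= => /andP[/negbTE ->].
- by move=> /ne/(_ xt sE); move: us; rewrite /= => /andP[/negbTE ->].
Qed.

End CycleSequences.

Section CycleEdges.
Variable T : choiceType.
Implicit Types (c : seq T).

Lemma cycle_edgesP c A : reflect (exists2 x, x \in c & A = [fset x; next c x]%fset)
  (A \in cycle_edges c).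
Proof.
apply: (iffP (imfsetP _ _ _ _)) => -[x xc ->]; exists x => //.
Qed.

Lemma cycle_edges_rot i c : uniq c -> cycle_edges (rot i c) = cycle_edges c.
Proof.
move=> uc; apply/fsetP => A; apply/cycle_edgesP/cycle_edgesP => -[x xc ->];
  by exists x; rewrite ?next_rot ?mem_rot // mem_rot in xc *.
Qed.

Lemma cycle_edges_rev c : uniq c -> cycle_edges (rev c) = cycle_edges c.
Proof.
move=> uc; apply/fsetP => A; apply/cycle_edgesP/cycle_edgesP => -[x xc ->].
  exists (prev c x); first by rewrite mem_prev -mem_rev.
  by rewrite next_rev // next_prev // fsetUC.
exists (next c x); first by rewrite mem_rev mem_next.
by rewrite next_rev // prev_next // fsetUC.
Qed.

Lemma fset2_eq (a b c d : T) : [fset a; b]%fset = [fset c; d]%fset ->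
  (a = c /\ b = d) \/ (a = d /\ b = c).
Proof.
move=> E; have : c \in [fset a; b]%fset /\ d \in [fset a; b]%fset.
  by rewrite E fset21 fset22.
have : a \in [fset c; d]%fset /\ b \in [fset c; d]%fset.
  by rewrite -E fset21 fset22.
rewrite !inE => -[/orP[]/eqP ? /orP[]/eqP ?] [/orP[]/eqP ? /orP[]/eqP ?]; subst; auto.
Qed.

(** In the undirected graph of [next c], the sequence [c'] is a cycle; [oriented_cycle] makes it or
    its inverse a cycle of [next c], with a vertex in common with [c]. *)
Lemma cycle_edges_inj c c' : uniq c -> uniq c' -> (2 < size c)%N -> (2 < size c')%N ->
    cycle_edges c = cycle_edges c' ->
  exists i j, c' = rot i (rot j c) \/ rev c' = rot i (rot j c).
Proof.
move=> uc uc' sc sc' E.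
have c0 : exists x, x \in c by case: (c) sc => // x ? _; exists x; apply: mem_head.
have [x xc] := c0.
have xc' : x \in c'.
  have /cycle_edgesP[y yc' yE] : [fset x; next c x]%fset \in cycle_edges c'.
    by rewrite -E; apply/cycle_edgesP; exists x.
  by case: (fset2_eq yE) => -[-> _] //; rewrite mem_next.
have : cycle (fun a b => (next c a == b) || (next c b == a)) c'.
  have := cycle_next uc'; apply: (sub_in_cycle (P := mem c')) => //.
  move=> a b ac' bc' /eqP ab.
  have /cycle_edgesP[y yc yE] : [fset a; next c' a]%fset \in cycle_edges c.
    by rewrite E; apply/cycle_edgesP; exists a.
  rewrite -ab; case: (fset2_eq yE) => -[-> ->]; rewrite eqxx ?orbT //.
case/(oriented_cycle uc' sc') => cc'.
  by have [i [j H]] := fcycle_rot uc uc' (cycle_next uc) cc' xc xc'; exists i, j; left.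
have ur : uniq (rev c') by rewrite rev_uniq.
have xr : x \in rev c' by rewrite mem_rev.
have [i [j H]] := fcycle_rot uc ur (cycle_next uc) cc' xc xr.
by exists i, j; right.
Qed.

End CycleEdges.

(** The representative picked by [xget] has the same edges, hence is a rotation of [c] or of its
    inverse, and the sum is symmetric in the two orientations. *)
Lemma unoriented_weightE (R : realType) (G : graph) (w : seq G -> R) c :
    cycle_weight w -> simple_cycle (@adj G) c ->
  unoriented_weight w (cycle_edges c) = w c + w (rev c).
Proof.
move=> [w_ge0 w_rot] sc; rewrite /unoriented_weight.
set c' := xget _ _.
have [sc' E] : simple_cycle (@adj G) c' /\ cycle_edges c' = cycle_edges c.
  rewrite /c'; case: xgetP => [x -> //|/(_ c)]; by case.
have /and3P[zc ec uc] := sc; have /and3P[zc' ec' uc'] := sc'.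
have srot i s : simple_cycle (@adj G) s -> simple_cycle (@adj G) (rot i s).
  by rewrite /simple_cycle size_rot rot_cycle rot_uniq.
have srev s : simple_cycle (@adj G) s -> simple_cycle (@adj G) (rev s).
  rewrite /simple_cycle size_rev rev_uniq rev_cycle.
  have -> // : cycle (fun z => (@adj G)^~ z) s = cycle (@adj G) s.
  by apply: eq_cycle => x y; rewrite adj_sym.
have wrr i j s : simple_cycle (@adj G) s -> w (rot i (rot j s)) = w s.
  by move=> ss; rewrite !w_rot //; apply: srot.
have wrev i j s : simple_cycle (@adj G) s -> w (rev (rot i (rot j s))) = w (rev s).
  move=> ss; rewrite !rev_rot /rotr !w_rot //; first exact: srev.
  by apply: srot; apply: srev.
have [i [j [H|H]]] := cycle_edges_inj uc uc' zc zc' (esym E).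
  by rewrite H wrr // wrev.
by rewrite H -[c']revK H wrr // wrev // addrC.
Qed.

Section Orientations.
Variables (R : realType) (V : finType) (e : rel V) (w : seq V -> R).
Hypothesis e_sym : symmetric e.
Hypothesis w_rot : forall c i, w (rot i c) = w c.
Implicit Types (f : {ffun V -> V}) (g : {ffun V -> bool}).

Definition undirected f : rel V := fun a b => (f a == b) || (f b == a).

Definition no_two_cycle f : bool := [forall x, f (f x) != x].

Definition same_graph f f' : bool :=
  [forall x, forall y, undirected f x y == undirected f' x y].

Lemma same_graphP f f' : reflect (undirected f =2 undirected f') (same_graph f f').
Proof.
apply: (iffP forallP) => [H x y|H x]; first by have /forallP/(_ y)/eqP := H x.
by apply/forallP => y; rewrite H.
Qed.

Definition cycle_root f : pred V :=
  fun x => fcycle f (orbit f x) && (froot f x == x).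

Lemma cycles_weightT f :
  cycles_weight w [set: V] f = \prod_(x | cycle_root f x) w (orbit f x).
Proof.
apply: eq_bigl => x; rewrite /cycle_root andbA andb_idr //.
Qed.

Lemma next_orbit f x y : fcycle f (orbit f x) -> y \in orbit f x ->
  next (orbit f x) y = f y.
Proof. by move=> cx yx; have /eqP := next_cycle cx yx. Qed.

Lemma prev_orbit f x y : fcycle f (orbit f x) -> y \in orbit f x ->
  f (prev (orbit f x) y) = y.
Proof.
by move=> cx yx; rewrite -(next_orbit cx) ?mem_prev // next_prev // orbit_uniq.
Qed.

Lemma prev_orbit_f f x y : fcycle f (orbit f x) -> y \in orbit f x ->
  prev (orbit f x) (f y) = y.
Proof. by move=> cx yx; rewrite -(next_orbit cx) // prev_next // orbit_uniq. Qed.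

Lemma orbit_size f x : no_two_cycle f -> fcycle f (orbit f x) ->
  (2 < size (orbit f x))%N.
Proof.
move=> /forallP/(_ x) n2 /(orbitPcycle 0 4); rewrite size_orbit.
have := order_gt0 f x; case: (order f x) => [|[|[|k]]] //= _ fx.
  by rewrite !fx eqxx in n2.
by rewrite fx eqxx in n2.
Qed.

Lemma prev_neq_next f x : no_two_cycle f -> fcycle f (orbit f x) ->
  prev (orbit f x) x != f x.
Proof.
move=> n2 cx; apply/eqP => E; have /forallP/(_ x) := n2.
by rewrite -E prev_orbit ?in_orbit ?eqxx.
Qed.

Lemma froot_cycle f x y : fcycle f (orbit f x) -> y \in orbit f x ->
  froot f y = froot f x.
Proof. by move=> cx yx; apply: froot_orbit; apply: orbit_mem_eq. Qed.

Lemma cycle_root_froot f x : fcycle f (orbit f x) -> cycle_root f (froot f x).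
Proof.
move=> cx; rewrite /cycle_root (orbit_mem_cycle cx (froot_mem f x)) /=.
by rewrite (froot_cycle cx (froot_mem f x)).
Qed.

Lemma undirected_cycle f f' x : no_two_cycle f -> undirected f =2 undirected f' ->
    fcycle f (orbit f x) ->
  {in orbit f x, f' =1 f} \/ {in orbit f x, forall y, f' y = prev (orbit f x) y}.
Proof.
move=> n2 ff' cx; set c := orbit f x; have uc : uniq c := orbit_uniq f x.
have cc : cycle (fun a b => (f' a == b) || (f' b == a)) c.
  have := cx; apply: sub_cycle => a b /eqP ab.
  by have := ff' a b; rewrite /undirected ab eqxx /= => <-.
case: (oriented_cycle uc (orbit_size n2 cx) cc) => fc; [left|right] => y yc.
  by have /eqP -> := next_cycle fc yc; rewrite next_orbit.
have yc' : y \in rev c by rewrite mem_rev.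
by have /eqP -> := next_cycle fc yc'; rewrite next_rev.
Qed.

(** If [f'] reversed the edge from [x] to [f x], it would have to reverse every later edge of the
    trajectory, having one arrow per vertex; the trajectory would then never enter a cycle, which is
    absurd on a finite set. *)
Lemma undirected_acyclic f f' x : no_two_cycle f -> undirected f =2 undirected f' ->
  ~~ fcycle f (orbit f x) -> f' x = f x.
Proof.
move=> n2 ff' nx; have := ff' x (f x); rewrite /undirected eqxx /= => /esym.
case/orP => [/eqP //|/eqP fx].
have step y : ~~ fcycle f (orbit f y) -> f' (f y) = y ->
    ~~ fcycle f (orbit f (f y)) /\ f' (f (f y)) = f y.
  move=> ny fy; have ncf : ~~ fcycle f (orbit f (f y)).
    apply: contra ny => cf; suff : y \in orbit f (f y) by apply: orbit_mem_cycle.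
    rewrite -[X in X \in _]fy.
    case: (undirected_cycle n2 ff' cf) => ->; rewrite ?in_orbit //.
      by rewrite -fconnect_orbit fconnect1.
    by rewrite mem_prev in_orbit.
  split=> //; have := ff' (f y) (f (f y)); rewrite /undirected eqxx /= fy => /esym.
  case/orP => /eqP // yff; have /forallP/(_ y) := n2.
  by rewrite -yff eqxx.
have it i : ~~ fcycle f (orbit f (iter i f x)) /\ f' (f (iter i f x)) = iter i f x.
  by elim: i => //= i [n1 n3]; apply: step.
have := looping_order f x; rewrite /looping => /trajectP[i io fi].
case: (it i) => /negP[]; apply/(orbitPcycle 0 3).
exists (order f x - i).-1; rewrite prednK ?subn_gt0 // -iterD subnK ?fi //.
exact: ltnW.
Qed.

(** Reading [g] at the root gives one bit per cycle; only its values on [cycle_root f] matter. *)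
Definition flip f g : {ffun V -> V} :=
  [ffun x => if fcycle f (orbit f x) && g (froot f x) then prev (orbit f x) x else f x].

Lemma flip_cycle f g x y : fcycle f (orbit f x) -> y \in orbit f x ->
  flip f g y = if g (froot f x) then prev (orbit f x) y else f y.
Proof.
move=> cx yx; rewrite ffunE (orbit_mem_cycle cx yx) (froot_cycle cx yx) /=.
by case: ifP => // _; rewrite (orbit_mem cx yx) prev_rot ?orbit_uniq.
Qed.

Lemma undirected_flip f g : undirected (flip f g) =2 undirected f.
Proof.
have sub a b : flip f g a = b -> undirected f a b.
  rewrite ffunE; case: ifP => [/andP[ca _] <-|_ <-]; rewrite /undirected ?eqxx //.
  by rewrite prev_orbit ?in_orbit ?eqxx ?orbT.
have sup a b : f a = b -> undirected (flip f g) a b.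
  move=> <-; rewrite /undirected; case ca: (fcycle f (orbit f a)); last first.
    by rewrite ffunE ca eqxx.
  have fa : f a \in orbit f a by apply: mem_orbit; apply: in_orbit.
  rewrite (flip_cycle g ca (in_orbit f a)) (flip_cycle g ca fa).
  by case: ifP; rewrite ?eqxx // prev_orbit_f ?in_orbit ?eqxx ?orbT.
have symC f1 a b : undirected f1 a b = undirected f1 b a by rewrite /undirected orbC.
move=> a b; apply/idP/idP => /orP[] /eqP.
- exact: sub.
- by rewrite symC; apply: sub.
- exact: sup.
- by rewrite symC; apply: sup.
Qed.

Lemma arrows_flip f g : arrows e f -> arrows e (flip f g).
Proof.
move=> /forallP af; apply/forallP => x; rewrite ffunE; case: ifP => // /andP[cx _].
by have := af (prev (orbit f x) x); rewrite prev_orbit ?in_orbit // e_sym.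
Qed.

Lemma no_two_cycle_flip f g : no_two_cycle f -> no_two_cycle (flip f g).
Proof.
move=> n2; apply/forallP => x; case cx: (fcycle f (orbit f x)); last first.
  have -> : flip f g x = f x by rewrite ffunE cx.
  case cfx: (fcycle f (orbit f (f x))); last first.
    by rewrite ffunE cfx; apply: (forallP n2).
  have H : flip f g (f x) \in orbit f (f x).
    rewrite (flip_cycle g cfx) ?in_orbit //; case: ifP => _.
      by rewrite mem_prev in_orbit.
    by apply: mem_orbit; apply: in_orbit.
  by apply: contraFN cx => /eqP xE; rewrite xE in H; apply: orbit_mem_cycle cfx H.
rewrite (flip_cycle g cx (in_orbit f x)); case: ifP => gx; last first.
  have fx : f x \in orbit f x by apply: mem_orbit; apply: in_orbit.
  by rewrite (flip_cycle g cx fx) gx; apply: (forallP n2).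
rewrite (flip_cycle g cx) ?mem_prev ?in_orbit // gx.
apply/eqP => E; have /forallP/(_ x) := n2; rewrite -{1}E.
by rewrite !prev_orbit ?mem_prev ?in_orbit ?eqxx.
Qed.

Lemma flip_onto f f' : no_two_cycle f -> undirected f =2 undirected f' ->
  flip f [ffun x => cycle_root f x && (f' x != f x)] = f'.
Proof.
move=> n2 ff'; apply/ffunP => x; case cx: (fcycle f (orbit f x)); last first.
  by rewrite ffunE cx /= (undirected_acyclic n2 ff') // cx.
rewrite (flip_cycle _ cx) ?in_orbit // ffunE cycle_root_froot //=.
have rx := froot_mem f x.
case: (undirected_cycle n2 ff' cx) => fE; rewrite !fE ?in_orbit //.
  by rewrite eqxx.
rewrite ifT //.
have cr := orbit_mem_cycle cx rx.
have := prev_neq_next n2 cr; rewrite (orbit_mem cx rx) prev_rot ?orbit_uniq //.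
Qed.

Lemma flip_inj f g : no_two_cycle f -> (forall x, g x -> cycle_root f x) ->
  [ffun x => cycle_root f x && (flip f g x != f x)] = g.
Proof.
move=> n2 gf; apply/ffunP => x; rewrite ffunE.
case rx: (cycle_root f x); last by apply/esym/negbTE/negP => /gf; rewrite rx.
case/andP: (rx) => cx /eqP fx; rewrite (flip_cycle g cx) ?in_orbit // fx /=.
by case: (g x); rewrite ?eqxx // prev_neq_next.
Qed.

Lemma orbit_flip f g x : fcycle f (orbit f x) ->
  fcycle (flip f g) (orbit (flip f g) x) /\
  orbit (flip f g) x = if g (froot f x)
    then rot (index x (rev (orbit f x))) (rev (orbit f x)) else orbit f x.
Proof.
move=> cx; case: ifP => gx.
  have cr : fcycle (flip f g) (rev (orbit f x)).
    have := cycle_next (p := rev (orbit f x)); rewrite rev_uniq orbit_uniq => /(_ isT).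
    rewrite (eq_in_cycle (P := mem (rev (orbit f x))) (e' := frel (flip f g))) //.
    move=> a b /=; rewrite !mem_rev => ac bc.
    by rewrite (flip_cycle g cx) // gx next_rev // orbit_uniq.
  have E : orbit (flip f g) x = rot (index x (rev (orbit f x))) (rev (orbit f x)).
    by rewrite (orbitE cr) ?rev_uniq ?orbit_uniq ?mem_rev ?in_orbit.
  by rewrite E rot_cycle.
have agree : {in [set y in orbit f x], f =1 flip f g}.
  by move=> y; rewrite inE => yx; rewrite (flip_cycle g cx yx) gx.
have [|-> ->//] := cycle_agree agree cx.
by apply/fintype.subsetP => y; rewrite inE.
Qed.

Lemma cycle_root_flip f g : no_two_cycle f -> cycle_root (flip f g) =1 cycle_root f.
Proof.
move=> n2 x; have n2' := no_two_cycle_flip g n2.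
have cE : fcycle (flip f g) (orbit (flip f g) x) = fcycle f (orbit f x).
  apply/idP/idP => cx; last by case: (orbit_flip g cx).
  case: (undirected_cycle n2' (undirected_flip f g) cx) => fE.
    have agree : {in [set y in orbit (flip f g) x], flip f g =1 f}.
      by move=> y; rewrite inE => yx; rewrite fE.
    by have [|//] := cycle_agree agree cx; apply/fintype.subsetP => y; rewrite inE.
  set c := orbit (flip f g) x in cx fE.
  have cr : fcycle f (rev c).
    have := cycle_next (p := rev c); rewrite rev_uniq orbit_uniq => /(_ isT).
    rewrite (eq_in_cycle (P := mem (rev c)) (e' := frel f)) //.
    move=> a b /=; rewrite !mem_rev => ac bc.
    by rewrite fE // next_rev // orbit_uniq.
  have xc : x \in rev c by rewrite mem_rev in_orbit.
  by rewrite (orbitE cr) ?rot_cycle // rev_uniq orbit_uniq.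
rewrite /cycle_root cE; case cx: (fcycle f (orbit f x)) => //=.
congr (_ == _); have [_ oE] := orbit_flip g cx; rewrite /fingraph.root.
have -> // : pick (fconnect (flip f g) x) = pick (fconnect f x).
apply: eq_pick => z; rewrite !fconnect_orbit oE; case: ifP => // _.
by rewrite mem_rot mem_rev.
Qed.

(** Maps without 2-cycles and with the same undirected graph differ by reversing some of the cycles;
    expanding the product of sums enumerates these choices. *)
Lemma sum_orientations f : arrows e f -> no_two_cycle f ->
  \sum_(f' | [&& arrows e f', no_two_cycle f' & same_graph f f'])
    cycles_weight w [set: V] f' =
  \prod_(x | cycle_root f x) (w (orbit f x) + w (rev (orbit f x))).
Proof.
move=> af n2.
rewrite [RHS]big_mkcond /=.
(* Vertices that are not roots receive the factor [(~~ b)%:R], so that only the functions [g]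
   supported on the roots survive the expansion. *)
rewrite (eq_bigr (fun x => \sum_(b : bool)
    if cycle_root f x then (if b then w (rev (orbit f x)) else w (orbit f x))
    else (~~ b)%:R)); last first.
  by move=> x _; rewrite big_bool; case: ifP => _ /=; rewrite ?add0r // addrC.
rewrite bigA_distr_bigA /=.
rewrite (reindex_onto (fun g => flip f g)
  (fun f' => [ffun x => cycle_root f x && (f' x != f x)])) /=; last first.
  by move=> f' /and3P[_ _ /same_graphP ff']; apply: flip_onto.
rewrite [RHS](bigID (fun g : {ffun V -> bool} => [forall x, g x ==> cycle_root f x])) /=.
rewrite [X in _ = _ + X]big1 ?addr0; last first.
  move=> g /forallPn[x]; rewrite negb_imply => /andP[gx nx].
  by rewrite (bigD1 x) //= (negbTE nx) gx mul0r.
apply: eq_big => [g|g].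
  rewrite arrows_flip ?no_two_cycle_flip //=.
  have -> : same_graph f (flip f g).
    by apply/same_graphP => a b; rewrite undirected_flip.
  apply/eqP/forallP => [<- x|gf]; first by rewrite ffunE; apply/implyP => /andP[].
  by apply: flip_inj => // x; apply/implyP.
move=> /andP[_ /eqP gE].
have gf x : g x -> cycle_root f x by rewrite -gE ffunE => /andP[].
rewrite cycles_weightT (eq_bigl _ _ (cycle_root_flip g n2)) big_mkcond.
apply: eq_bigr => x _; case: ifP => [|nx]; last first.
  by case gx: (g x) => //; rewrite gf ?gx in nx.
case/andP=> cx /eqP rx; have [_ ->] := orbit_flip g cx; rewrite rx.
by case: ifP; rewrite ?w_rot.
Qed.

Lemma cycles_weight_two_cycle f : (forall c, (size c <= 2)%N -> w c = 0) ->
  ~~ no_two_cycle f -> cycles_weight w [set: V] f = 0.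
Proof.
move=> w2 /forallPn[x]; rewrite negbK => /eqP ffx.
have cx : fcycle f (orbit f x) by apply/(orbitPcycle 0 3); exists 1%N.
rewrite (cycles_weightD w_rot cx); last first.
  by apply/fintype.subsetP => y _; rewrite inE.
rewrite w2 ?mul0r // size_orbit.
apply: (@order_le_cycle _ f [:: x; f x]); last exact: mem_head.
by rewrite /= ffx !eqxx.
Qed.

End Orientations.

(** * Cycle-rooted spanning forests *)

Section Embedding.
Variables (R : realType) (G : graph) (B : {fset G}).
Implicit Types (f : {ffun B -> B}) (c : seq B).

Definition induced_adj : rel B := fun a b => adj (val a) (val b).

Lemma induced_adj_sym : symmetric induced_adj.
Proof. by move=> a b; apply: adj_sym. Qed.

Definition graph_of f : config G :=
  fun ed => [exists a : B, val ed == [fset val a; val (f a)]%fset].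

Lemma adj_edge (x y : G) : adj x y -> exists ed : edge G, val ed = [fset x; y]%fset.
Proof.
move=> xy; have P : `[< exists x' y' : G, adj x' y' /\ [fset x; y]%fset = [fset x'; y']%fset >].
  by apply/asboolP; exists x, y.
by exists (exist (fun A : {fset G} => `[< exists x' y' : G, adj x' y' /\ A = [fset x'; y']%fset >]) _ P).
Qed.

Lemma open_adjC (F : config G) x y : open_adj F x y = open_adj F y x.
Proof.
by apply/asboolP/asboolP => -[ed edE Fe]; exists ed; rewrite // edE fsetUC.
Qed.

Lemma open_adj_adj (F : config G) x y : open_adj F x y -> adj x y.
Proof.
move=> /asboolP[[A PA] /= AE _]; have /asboolP[x' [y' [xy' E]]] := PA.
rewrite AE in E.
by case: (fset2_eq E) => -[-> ->] //; rewrite adj_sym.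
Qed.

Lemma open_graph_of f a b : arrows induced_adj f ->
  open_adj (graph_of f) (val a) (val b) = undirected f a b.
Proof.
move=> /forallP af; apply/asboolP/idP.
  case=> ed edE /existsP[c /eqP cE]; rewrite edE in cE.
  rewrite /undirected; case: (fset2_eq cE) => -[/val_inj -> /val_inj ->];
    by rewrite eqxx ?orbT.
case/orP => /eqP E.
  have [ed edE] := adj_edge (af a); exists ed; first by rewrite edE E.
  by apply/existsP; exists a; rewrite edE.
have [ed edE] := adj_edge (af b); exists ed; first by rewrite edE E fsetUC.
by apply/existsP; exists b; rewrite edE.
Qed.

Lemma open_graph_of_val f x y : open_adj (graph_of f) x y ->
  exists a b : B, x = val a /\ y = val b.
Proof.
move=> /asboolP[ed edE /existsP[c /eqP cE]]; rewrite edE in cE.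
by case: (fset2_eq cE) => -[-> ->]; [exists c, (f c)|exists (f c), c].
Qed.

Lemma graph_of_eq f f' : arrows induced_adj f -> arrows induced_adj f' ->
  graph_of f = graph_of f' <-> same_graph f f'.
Proof.
move=> af af'; split=> [E|/same_graphP ff'].
  by apply/same_graphP => a b; rewrite -!open_graph_of // E.
have sub f1 f2 ed : undirected f1 =2 undirected f2 -> graph_of f1 ed -> graph_of f2 ed.
  move=> H /existsP[a /eqP edE]; rewrite /graph_of edE; apply/existsP.
  have := H a (f1 a); rewrite /undirected eqxx /= => /esym/orP[]/eqP E.
    by exists a; rewrite E.
  by exists (f1 a); rewrite E fsetUC.
apply/funext => ed; apply/idP/idP; apply: sub => // a b; by rewrite ff'.
Qed.

Lemma graph_of_in f : config_in B (graph_of f).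
Proof.
move=> ed /existsP[a /eqP ->]; apply/fsubsetP => x; rewrite !inE.
by case/orP => /eqP ->; apply: valP.
Qed.

Lemma cycle_lift f (s : seq G) : arrows induced_adj f ->
    simple_cycle (open_adj (graph_of f)) s ->
  exists c, [/\ s = map val c, uniq c, (2 < size c)%N & cycle (undirected f) c].
Proof.
move=> af /and3P[zs cs us].
have sB x : x \in s -> x \in B.
  move=> xs; have := next_cycle cs xs.
  by move=> /open_graph_of_val[a [b [-> _]]]; apply: valP.
have [c cE] : exists c : seq B, s = map val c.
  elim: s sB {zs cs us} => [|x s IH] sB; first by exists [::].
  have [|c ->] := IH; first by move=> y ys; apply: sB; rewrite inE ys orbT.
  by exists ([` sB x (mem_head x s)]%fset :: c).
exists c; split=> //; rewrite cE ?(map_inj_uniq val_inj) ?size_map // in us zs cs.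
case: c cE cs {us zs} => // a c _ /=; rewrite -map_rcons path_map.
by apply: sub_path => x y /=; rewrite open_graph_of.
Qed.

Lemma lift_cycle f c : arrows induced_adj f -> uniq c -> (2 < size c)%N ->
  cycle (undirected f) c -> simple_cycle (open_adj (graph_of f)) (map val c).
Proof.
move=> af uc zc cc; rewrite /simple_cycle size_map zc (map_inj_uniq val_inj) uc andbT /=.
case: c cc {uc zc} => //= a c; rewrite -map_rcons path_map.
by apply: sub_path => x y /=; rewrite open_graph_of.
Qed.

(** Each edge is an arrow in one of its directions, so adjacent vertices have merging trajectories,
    and merging propagates along a path. *)
Lemma joined_graph_of f (a : B) y : arrows induced_adj f ->
    joined (open_adj (graph_of f)) (val a) y ->
  exists b t, [/\ y = val b, fconnect f a t & fconnect f b t].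
Proof.
move=> af [p + <-]; elim: p a => [|x p IH] a /=.
  by exists a, a.
case/andP=> ax px; have [_ [b [_ xE]]] := open_graph_of_val ax.
rewrite xE open_graph_of // in ax px *.
have [b' [t [-> bt b't]]] := IH b px.
case/orP: ax => /eqP fE.
  by exists b', t; split=> //; apply: connect_trans bt; rewrite -fE fconnect1.
(* Here the arrow goes from [b] to [a]. If the meeting point is [b] itself, it is moved on to [a];
   otherwise it already lies on the trajectory of [a]. *)
have [i it] : exists i, t = iter i f b by exists (findex f b t); rewrite iter_findex.
case: i it => [|i] it.
  exists b', a; split=> //; apply: connect_trans b't _.
  by rewrite it /= -fE fconnect1.
by exists b', t; split=> //; rewrite it iterSr fE fconnect_iter.
Qed.

Lemma joined_fconnect f (a b : B) : arrows induced_adj f -> fconnect f a b ->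
  joined (open_adj (graph_of f)) (val a) (val b).
Proof.
move=> af /connectP[p pp ->]; exists (map val p); last by rewrite last_map.
rewrite path_map; apply: sub_path pp => x y /= /eqP xy.
by rewrite open_graph_of // /undirected xy eqxx.
Qed.

Lemma simple_cycle_orbit f (s : seq G) x : arrows induced_adj f ->
    simple_cycle (open_adj (graph_of f)) s -> x \in s ->
  exists a, [/\ x = val a, fcycle f (orbit f a), s =i map val (orbit f a) &
     cycle_edges s = cycle_edges (map val (orbit f a))].
Proof.
move=> af ss xs; have [c [sE uc zc cc]] := cycle_lift af ss.
rewrite sE in xs *; case/mapP: xs => a ac ->; exists a.
have oE d : uniq d -> fcycle f d -> a \in d -> fcycle f (orbit f a) /\
    map val (orbit f a) = rot (index a d) (map (val : B -> G) d).
  by move=> ud cd ad; rewrite (orbitE cd ud ad) rot_cycle map_rot.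
have umc : uniq (map (val : B -> G) c) by rewrite map_inj_uniq //; apply: val_inj.
case: (oriented_cycle uc zc cc) => cf.
  have [ca ->] := oE c uc cf ac.
  split=> // [y|]; first by rewrite mem_rot.
  by rewrite cycle_edges_rot.
have uc' : uniq (rev c) by rewrite rev_uniq.
have ac' : a \in rev c by rewrite mem_rev.
have [ca ->] := oE (rev c) uc' cf ac'.
split=> // [y|]; first by rewrite mem_rot map_rev mem_rev.
by rewrite cycle_edges_rot map_rev ?rev_uniq // cycle_edges_rev.
Qed.

Lemma orbit_simple_cycle f a : arrows induced_adj f -> no_two_cycle f ->
  fcycle f (orbit f a) -> simple_cycle (open_adj (graph_of f)) (map val (orbit f a)).
Proof.
move=> af n2 ca; apply: (lift_cycle af (orbit_uniq f a) (orbit_size n2 ca)).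
by apply: sub_cycle ca => x y /=; rewrite /undirected => /eqP ->; rewrite eqxx.
Qed.

Lemma fconnect_cycle_root (f : {ffun B -> B}) a : exists b,
  fconnect f a b /\ fcycle f (orbit f b).
Proof.
have := looping_order f a; rewrite /looping => /trajectP[i io fi].
exists (iter i f a); split; first exact: fconnect_iter.
apply/(orbitPcycle 0 3); exists (order f a - i).-1.
by rewrite prednK ?subn_gt0 // -iterD subnK ?fi // ltnW.
Qed.

(** The trajectory of [x] ends in a cycle. Any cycle of the component contains a vertex whose
    trajectory merges with that of [x], so it is the same cycle. *)
Lemma graph_of_CRSF f : arrows induced_adj f -> no_two_cycle f -> CRSF B (graph_of f).
Proof.
move=> af n2; split; first exact: graph_of_in.
move=> x xB; have [b [ab cb]] := fconnect_cycle_root f [` xB]%fset.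
exists (cycle_edges (map val (orbit f b))); apply/seteqP; split=> A /=.
  case=> s [ss sx] <-; have /and3P[zs _ _] := ss.
  have [y ys] : exists y, y \in s by case: (s) zs => // y ? _; exists y; apply: mem_head.
  have [a [yE ca _ ->]] := simple_cycle_orbit af ss ys.
  have := sx y ys; rewrite /component /= => jxy.
  have [a' [t [ya' xt at']]] := joined_graph_of (a := [` xB]%fset) af jxy.
  have aa' : a' = a by apply: val_inj; rewrite -ya' yE.
  rewrite aa' in at'.
  have tc : t \in orbit f a by rewrite -fconnect_orbit.
  have tb : t \in orbit f b.
    by apply: (fconnect_cycles ab xt cb); apply: orbit_mem_cycle ca tc.
  have u d : uniq (map (val : B -> G) (orbit f d)).
    by rewrite map_inj_uniq ?orbit_uniq //; apply: val_inj.
  transitivity (cycle_edges (map val (orbit f t))).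
    by rewrite (orbit_mem ca tc) map_rot cycle_edges_rot.
  by rewrite (orbit_mem cb tb) map_rot cycle_edges_rot.
move=> ->; exists (map val (orbit f b)) => //; split.
  exact: orbit_simple_cycle.
move=> _ /mapP[z zb ->]; apply: (joined_fconnect (a := [` xB]%fset) af).
by apply: connect_trans ab _; rewrite fconnect_orbit.
Qed.

End Embedding.

(** * Every cycle-rooted spanning forest comes from a map *)

Section OrientedForest.
Variables (G : graph) (B : {fset G}) (F : config G).

Lemma joined_refl (x : G) : joined (open_adj F) x x.
Proof. by exists [::]. Qed.

Lemma joined_trans (x y z : G) :
  joined (open_adj F) x y -> joined (open_adj F) y z -> joined (open_adj F) x z.
Proof.
move=> [p pp <-] [q pq <-]; exists (p ++ q); last by rewrite last_cat.
by rewrite cat_path pp.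
Qed.

Lemma joined_sym (x y : G) : joined (open_adj F) x y -> joined (open_adj F) y x.
Proof.
move=> [p pp <-]; exists (rev (belast x p)).
  rewrite rev_path; apply: sub_path pp => a b; by rewrite open_adjC.
by case: p {pp} => // a p; rewrite /= rev_cons last_rcons.
Qed.

Lemma component_eq (x y : G) : joined (open_adj F) x y -> component F x = component F y.
Proof.
move=> xy; apply/seteqP; split=> z /=; first exact/joined_trans/joined_sym.
exact: joined_trans.
Qed.

Hypothesis FB : CRSF B F.

Lemma open_adj_in (x y : G) : open_adj F x y -> x \in B /\ y \in B.
Proof.
case: FB => inB _ /asboolP[ed edE Fed].
have /fsubsetP := inB ed Fed; rewrite edE => H.
by split; apply: H; rewrite !inE eqxx ?orbT.
Qed.

(** The choice depends on the component only as a set, so adjacent vertices get the same cycle with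
    the same orientation. *)
Let component_cycle (x : G) : seq G :=
  xget [::] [set c | simple_cycle (open_adj F) c /\ {in c, forall y, component F x y}]%classic.

Lemma component_cycleP (a : B) :
  simple_cycle (open_adj F) (component_cycle (val a)) /\
  {in component_cycle (val a), forall y, component F (val a) y}.
Proof.
case: FB => _ /(_ (val a) (valP a))[A cA]; rewrite /component_cycle.
case: xgetP => [c -> //|no].
have : cycles_in F (component F (val a)) A by rewrite cA.
by case=> c cP _; case: (no c cP).
Qed.

Lemma component_cycle_eq (x y : G) : joined (open_adj F) x y ->
  component_cycle x = component_cycle y.
Proof. by move=> xy; rewrite /component_cycle (component_eq xy). Qed.

Let reach (k : nat) (a : B) : bool :=
  `[< exists p, [/\ path (open_adj F) (val a) p, size p = k
       & last (val a) p \in component_cycle (val a)] >].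

Lemma reach_min : exists depth : B -> nat, forall a : B,
  reach (depth a) a /\ forall k, reach k a -> (depth a <= k)%N.
Proof.
suff /choice[depth depthP] : forall a, exists n, reach n a /\ forall k, reach k a -> (n <= k)%N.
  by exists depth.
move=> a; have ex : exists k, reach k a.
  have [sc cc] := component_cycleP a; have /and3P[zc _ _] := sc.
  have [y yc] : exists y, y \in component_cycle (val a).
    by case: component_cycle zc => // y ? _; exists y; apply: mem_head.
  have [p pp py] := cc y yc; exists (size p); apply/asboolP; exists p.
  by rewrite py.
by have [k rk km] := ex_minnP ex; exists k.
Qed.

(** Cycle vertices follow [next]; the others step to a neighbour strictly closer to the cycle. The
    point is that no edge of [F] is left out, and this is where uniqueness of the cycle in a
    component enters. *)
Lemma CRSF_orientation : exists f : {ffun B -> B},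
  [/\ arrows (@induced_adj G B) f, no_two_cycle f & graph_of f = F].
Proof.
have [depth depthP] := reach_min.
pose cyc (a : B) := component_cycle (val a).
have cycP (a : B) : [/\ uniq (cyc a), (2 < size (cyc a))%N & cycle (open_adj F) (cyc a)].
  by have [/and3P[]] := component_cycleP a.
have cyc_eq (a b : B) : open_adj F (val a) (val b) -> cyc a = cyc b.
  by move=> ab; apply: component_cycle_eq; exists [:: val b]; rewrite //= ab.
have [f0 f0P] : exists f : B -> B, forall a, [/\ open_adj F (val a) (val (f a)),
    val a \in cyc a -> val (f a) = next (cyc a) (val a) &
    val a \notin cyc a -> (depth (f a) < depth a)%N].
  suff /choice[f0 f0P] : forall a, exists b : B, [/\ open_adj F (val a) (val b),
    val a \in cyc a -> val b = next (cyc a) (val a) &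
    val a \notin cyc a -> (depth b < depth a)%N] by exists f0.
  move=> a.
  have [ac|nac] := boolP (val a \in cyc a).
    have [uc zc cc] := cycP a; have on := next_cycle cc ac.
    by have [_ nB] := open_adj_in on; exists [` nB]%fset.
  have [/asboolP[[|y p] [pp sp lp]] _] := depthP a.
    by rewrite /= -/(cyc a) (negbTE nac) in lp.
  move: pp => /= /andP[ay py]; have [_ yB] := open_adj_in ay.
  exists [` yB]%fset; split=> // _; rewrite -sp ltnS.
  have [_] := depthP [` yB]%fset; apply; apply/asboolP; exists p; split=> //.
  by move: lp; rewrite -/(cyc a) (cyc_eq a [` yB]%fset).
pose f := [ffun a => f0 a]; have fP a : [/\ open_adj F (val a) (val (f a)),
    val a \in cyc a -> val (f a) = next (cyc a) (val a) &
    val a \notin cyc a -> (depth (f a) < depth a)%N] by rewrite ffunE.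
have fcyc a : cyc (f a) = cyc a by case: (fP a) => /cyc_eq.
have fin a : val a \in cyc a -> val (f a) \in cyc a.
  by move=> ac; case: (fP a) => _ /(_ ac) -> _; rewrite mem_next.
have af : arrows (@induced_adj G B) f.
  by apply/forallP => a; case: (fP a) => /open_adj_adj.
have n2 : no_two_cycle f.
  apply/forallP => a; apply/negP => /eqP ffa.
  have [ac|nac] := boolP (val a \in cyc a).
    have [uc zc _] := cycP a; have := next_next_neq uc zc ac.
    case: (fP a) => _ /(_ ac) E1 _; case: (fP (f a)) => _.
    by rewrite fcyc ffa => /(_ (fin a ac)) E2 _; rewrite -E1 -E2 eqxx.
  have nb : val (f a) \notin cyc (f a).
    by apply: contra nac => /fin; rewrite ffa fcyc.
  case: (fP a) => _ _ /(_ nac) l1; case: (fP (f a)) => _ _ /(_ nb).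
  by rewrite ffa => l2; have := ltn_trans l1 l2; rewrite ltnn.
have to_cycle a : exists b, fconnect f a b /\ val b \in cyc a.
  have [k] := ubnP (depth a); elim: k a => // k IH a dk.
  have [ac|nac] := boolP (val a \in cyc a); first by exists a; rewrite connect0.
  case: (fP a) => _ _ /(_ nac) l; have [|b [fb bc]] := IH (f a).
    by apply: leq_trans l _; rewrite -ltnS.
  exists b; rewrite -fcyc; split=> //; apply: connect_trans fb; exact: fconnect1.
exists f; split=> //; apply/funext => ed; apply/idP/idP.
  case/existsP => a /eqP edE; case: (fP a) => /asboolP[ed' ed'E Fed'] _ _.
  by have -> : ed = ed' by apply: val_inj; rewrite edE ed'E.
move=> Fed; have /asboolP[x [y [xy edE]]] := valP ed.
have oxy : open_adj F x y by apply/asboolP; exists ed.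
have [xB yB] := open_adj_in oxy; pose a : B := [` xB]%fset; pose b : B := [` yB]%fset.
have oab : open_adj F (val a) (val b) by [].
suff : undirected f a b.
  rewrite -open_graph_of // => /asboolP[ed' ed'E Fed'].
  by have <- : ed' = ed by apply: val_inj; rewrite ed'E edE.
apply/negPn/negP => nab.
have csym : connect_sym (undirected f).
  by apply: sym_connect_sym => s t; rewrite /undirected orbC.
have sub s t : fconnect f s t -> connect (undirected f) s t.
  by apply: connect_sub => {}s {}t /eqP st; apply: connect1; rewrite /undirected st eqxx.
have [a' [aa' a'c]] := to_cycle a; have [b' [bb' b'c]] := to_cycle b.
have cab : cyc a = cyc b := cyc_eq a b oab.
have cyc_iter s t : fconnect f s t -> cyc t = cyc s.
  move=> st; rewrite -(iter_findex st).
  by elim: (findex f s t) => //= i IH; rewrite fcyc.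
have ca'b' : connect (undirected f) a' b'.
  have H : {in cyc a, forall z, forall t : B, val t = z -> connect (undirected f) a' t}.
    have [uc _ _] := cycP a; apply: (cycle_closed uc a'c) => [t /val_inj -> //|].
    move=> z zc Pz t tE.
    have zB : z \in B.
      by have [_ _ cc] := cycP a; have [] := open_adj_in (next_cycle cc zc).
    have := Pz [` zB]%fset erefl => a'z.
    have zcyc : cyc [` zB]%fset = cyc a.
      apply/esym/component_cycle_eq; have [_ H] := component_cycleP a; exact: H.
    have -> : t = f [` zB]%fset.
      by apply: val_inj; case: (fP [` zB]%fset) => _; rewrite zcyc tE => /(_ zc) ->.
    by apply: connect_trans a'z _; apply: sub; apply: fconnect1.
  by apply: (H (val b')) => //; rewrite cab.
have : connect (undirected f) a b.
  apply: connect_trans (sub _ _ aa') _; apply: connect_trans ca'b' _.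
  by rewrite csym; apply: sub.
case/connectP => p0 pp0 bE; case: (shortenP pp0) bE => p pp up _ bE.
have F_adj s t : undirected f s t -> open_adj F (val s) (val t).
  by case/orP => /eqP <-; [case: (fP s)|rewrite open_adjC; case: (fP t)].
have p2 : (1 < size p)%N.
  case: p pp up bE => [|p1 [|p2 p]] //=; first by move=> _ _ E; move: xy; rewrite -[x]/(val a) -[y]/(val b) E adj_irr.
  by rewrite andbT => ap _ E; rewrite E ap in nab.
pose c := map val (a :: p).
have uc : uniq c by rewrite map_inj_uniq //; apply: val_inj.
have pF : path (open_adj F) (val a) (map val p).
  by rewrite path_map; apply: sub_path pp => s t; apply: F_adj.
have lc : last (val a) (map val p) = val b by rewrite last_map -bE.
have sc : simple_cycle (open_adj F) c.
  apply/and3P; split=> //; first by rewrite size_map.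
  by rewrite /c /= rcons_path pF lc open_adjC.
have [A cA] : has_unique_cycle F (component F (val a)).
  by case: FB => _; apply; apply: valP.
have inA s : simple_cycle (open_adj F) s -> {in s, forall z, component F (val a) z} ->
    cycle_edges s = A.
  move=> ss sa; have : cycles_in F (component F (val a)) (cycle_edges s) by exists s.
  by rewrite cA.
(* By uniqueness [c] has the edges of the chosen cycle, all of which are arrows of [f]; so the edge
   was used after all. *)
have cE : cycle_edges c = cycle_edges (cyc a).
  have [s1 s2] := component_cycleP a; rewrite [RHS]inA //; apply: inA => // z.
  rewrite /c /= inE => /orP[/eqP ->|zp]; first exact: joined_refl.
  case/splitPr: zp pF => p1 p2' pF; exists (rcons p1 z); last by rewrite last_rcons.
  by move: pF; rewrite -cat_rcons cat_path => /andP[].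
have : [fset x; y]%fset \in cycle_edges c.
  apply/cycle_edgesP; exists (val b).
    by have := mem_last (val a) (map val p); rewrite lc.
  have : path (frel (next c)) (val a) (rcons (map val p) (val a)) := cycle_next uc.
  by rewrite rcons_path lc => /andP[_ /eqP ->]; rewrite fsetUC.
rewrite cE => /cycle_edgesP[z zc xyE].
have zB : z \in B.
  by have [_ _ cc] := cycP a; have [] := open_adj_in (next_cycle cc zc).
have zcyc : cyc [` zB]%fset = cyc a.
  apply/esym/component_cycle_eq; have [_ H] := component_cycleP a; exact: H.
have fz : val (f [` zB]%fset) = next (cyc a) z.
  by case: (fP [` zB]%fset) => _; rewrite zcyc => /(_ zc).
rewrite -fz in xyE; case/negP: nab; rewrite /undirected.
case: (fset2_eq xyE) => -[xE yE].
  have -> : a = [` zB]%fset by apply: val_inj.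
  by apply/orP; left; apply/eqP/val_inj.
have -> : b = [` zB]%fset by apply: val_inj.
by apply/orP; right; apply/eqP/val_inj.
Qed.

End OrientedForest.

(** * Forest weight as a sum over orientations *)

Section ForestSum.
Variables (R : realType) (G : graph) (B : {fset G}) (w : seq G -> R).
Hypothesis w_weight : cycle_weight w.
Implicit Types (f : {ffun B -> B}) (c : seq B).

(** The extension by 0 makes rotation invariance and non-negativity hold for all sequences, and
    gives weight 0 to 2-cycles. *)
Definition induced_weight c : R :=
  if simple_cycle (@induced_adj G B) c then w (map val c) else 0.

Let e := @induced_adj G B.

Lemma simple_cycle_val c : simple_cycle (@adj G) (map val c) = simple_cycle e c.
Proof.
rewrite /simple_cycle size_map (map_inj_uniq val_inj); congr [&& _, _ & _].
by case: c => //= a c; rewrite -map_rcons path_map.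
Qed.

Lemma induced_weight_rot c i : induced_weight (rot i c) = induced_weight c.
Proof.
rewrite /induced_weight; have -> : simple_cycle e (rot i c) = simple_cycle e c.
  by rewrite /simple_cycle size_rot rot_cycle rot_uniq.
case: ifP => // sc; rewrite map_rot; case: w_weight => _; apply.
by rewrite simple_cycle_val.
Qed.

Lemma induced_weight_ge0 c : 0 <= induced_weight c.
Proof.
rewrite /induced_weight; case: ifP => // sc; case: w_weight => + _; apply.
by rewrite simple_cycle_val.
Qed.

Lemma induced_weight_small c : (size c <= 2)%N -> induced_weight c = 0.
Proof. by rewrite /induced_weight /simple_cycle ltnNge => ->. Qed.

Lemma orbit_simple f a : arrows e f -> no_two_cycle f -> fcycle f (orbit f a) ->
  simple_cycle e (orbit f a).
Proof.
move=> af n2 ca; rewrite /simple_cycle orbit_size // orbit_uniq andbT /=.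
by apply: sub_cycle ca => x y /eqP <-; apply: (forallP af).
Qed.

Lemma forest_weight_graph_of f : arrows e f -> no_two_cycle f ->
  forest_weight w (graph_of f) =
  \prod_(a | cycle_root f a) (induced_weight (orbit f a) + induced_weight (rev (orbit f a))).
Proof.
move=> af n2.
pose ce (a : B) := cycle_edges (map (val : B -> G) (orbit f a)).
have u (a : B) : uniq (map (val : B -> G) (orbit f a)).
  by rewrite map_inj_uniq ?orbit_uniq //; apply: val_inj.
pose r := [seq ce a | a <- enum (cycle_root f)].
(* Two roots labelling the same edge set have orbits with a common vertex, hence are equal. *)
have ur : uniq r.
  rewrite map_inj_in_uniq ?enum_uniq // => a b; rewrite !mem_enum.
  case/andP=> ca /eqP ra /andP[cb /eqP rb] ab.
  have : [fset val a; next (map val (orbit f a)) (val a)]%fset \in ce b.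
    rewrite -ab; apply/cycle_edgesP; exists (val a) => //.
    by rewrite mem_map ?in_orbit //; apply: val_inj.
  case/cycle_edgesP => z zb zE.
  have : val a \in map val (orbit f b).
    by case: (fset2_eq zE) => -[-> _]; rewrite ?mem_next.
  rewrite mem_map; last exact: val_inj.
  by move=> ab'; rewrite -ra -rb (froot_cycle cb ab').
have -> : forest_weight w (graph_of f) = \prod_(A <- r) unoriented_weight w A.
  rewrite fsbig_seq //; apply: eq_fsbigl; apply/seteqP; split=> A /=.
    case=> s [ss _] <-; have /and3P[zs _ _] := ss.
    have [y ys] : exists y, y \in s by case: (s) zs => // y ? _; exists y; apply: mem_head.
    have [a [_ ca _ ->]] := simple_cycle_orbit af ss ys.
    apply/mapP; exists (froot f a); first by rewrite mem_enum; apply: cycle_root_froot.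
    by rewrite /ce (orbit_mem ca (froot_mem f a)) map_rot cycle_edges_rot.
  case/mapP => a; rewrite mem_enum => /andP[ca _] ->.
  by exists (map val (orbit f a)) => //; split=> //; apply: orbit_simple_cycle.
rewrite big_map big_enum; apply: eq_bigr => a /andP[ca _].
have sa := orbit_simple af n2 ca.
rewrite unoriented_weightE ?simple_cycle_val // /induced_weight sa map_rev.
have -> // : simple_cycle e (rev (orbit f a)).
move: sa; rewrite /simple_cycle size_rev rev_uniq rev_cycle => /and3P[-> + ->].
rewrite andbT /=; case: (orbit f a) => //= x s.
by apply: sub_path => y z; rewrite /= /e induced_adj_sym.
Qed.

Lemma sum_graph_of f : arrows e f -> no_two_cycle f ->
  \sum_(f' | [&& arrows e f', no_two_cycle f' & `[< graph_of f' = graph_of f >]])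
    cycles_weight induced_weight [set: B] f' = forest_weight w (graph_of f).
Proof.
move=> af n2; rewrite forest_weight_graph_of //.
rewrite -(sum_orientations (@induced_adj_sym G B) induced_weight_rot af n2).
apply: eq_bigl => f'; case af': (arrows e f') => //=; congr (_ && _).
apply/asboolP/idP => [E|ff']; first by apply/(graph_of_eq af af').
by apply/esym/(graph_of_eq af af').
Qed.

End ForestSum.

(** * Measurability of configurations *)

Section ConfigurationMeasure.
Variables (R : realType) (G : graph).
Local Open Scope classical_set_scope.

Lemma measurable_open (ed : edge G) :
  measurable ([set F | F ed] : set (configurations G)).
Proof. by apply: sub_sigma_algebra; exists ed. Qed.

Lemma measurable_config (F : configurations G) : measurable [set F].
Proof.
(* An injective coding of edges by integers makes the singleton a countable intersection of
   conditions on at most one edge each. *)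
pose code (ed : edge G) : nat := @choice.pickle (seq G) (enum_fset (sval ed)).
have code_inj : injective code.
  by move=> ed ed' /(pcan_inj (@choice.pickleK (seq G))) E; do 2 apply: val_inj.
pose D n := [set F' : configurations G | forall ed, code ed = n -> F' ed = F ed].
have -> : [set F] = \bigcap_n D n.
  apply/seteqP; split=> [F' /= -> n _ //|F' DF'].
  by apply/funext => ed; apply: (DF' (code ed)).
apply: bigcapT_measurable => n.
have [[ed edn]|no] := pselect (exists ed, code ed = n); last first.
  rewrite (_ : D n = setT) //; apply/seteqP; split=> // F' _ ed edn.
  by case: no; exists ed.
have DE : D n = [set F' | F' ed = F ed].
  apply/seteqP; split=> F' /=; first exact.
  move=> E ed' ed'n; have -> // : ed' = ed.
  by apply: code_inj; rewrite ed'n edn.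
rewrite DE; case: (F ed); first exact: measurable_open.
rewrite (_ : [set F' : configurations G | F' ed = false] = ~` [set F' | F' ed]); first by apply: measurableC; apply: measurable_open.
apply/seteqP; split=> F' /= => [->//|/negP/negbTE //].
Qed.

Lemma measure_seq (nu : probability (configurations G) R) (s : seq (configurations G)) :
  uniq s -> measurable [set` s] /\ nu [set` s] = (\sum_(F <- s) nu [set F])%E.
Proof.
elim: s => [_|F s IH /= /andP[Fs /IH[ms sE]]].
  by rewrite set_nil big_nil measure0.
have E : [set` F :: s] = [set F] `|` [set` s].
  apply/seteqP; split=> x /=; rewrite inE.
    by case/orP => [/eqP ->|xs]; [left|right].
  by case=> [->|xs]; rewrite ?eqxx // (xs : x \in s) orbT.
have mF := measurable_config F; rewrite E; split; first exact: measurableU.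
rewrite measureU //; first by rewrite big_cons; congr (_ + _)%E; exact: sE.
by apply/seteqP; split=> // x [/= -> xs]; rewrite (xs : F \in s) in Fs.
Qed.

End ConfigurationMeasure.

(** * The free measure as the law of a random map *)

Section FreeMeasure.
Variables (R : realType) (G : graph) (B : {fset G}) (w : seq G -> R).
Hypothesis w_weight : cycle_weight w.
Variable nu : probability (configurations G) R.
Hypothesis nu_free : free_measure w B nu.
Local Open Scope classical_set_scope.

Let e := @induced_adj G B.
Let W (f : {ffun B -> B}) : R := cycles_weight (induced_weight w (B := B)) finset.setT f.

(** [k] is the constant of the forest measure; each forest is split into its orientations, whose
    weights add up to its forest weight. *)
Lemma free_measureE : exists k : R, forall E : set (configurations G), measurable E ->
  nu E = (k * \sum_(f | [&& arrows e f, no_two_cycle f & `[< E (graph_of f) >]]) W f)%:E.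
Proof.
case: nu_free => nuC [k kE]; exists k => E mE.
pose s : seq (configurations G) := undup [seq (graph_of f : configurations G) |
  f <- enum (fun f : {ffun B -> B} => arrows e f && no_two_cycle f)].
have sP F : reflect (exists2 f : {ffun B -> B}, arrows e f && no_two_cycle f & F = graph_of f)
    (F \in s).
  rewrite mem_undup; apply: (iffP mapP) => -[f fP ->]; exists f => //.
    by rewrite mem_enum in fP.
  by rewrite mem_enum.
have us : uniq s := undup_uniq _.
have sC : [set` s] = CRSF B.
  apply/seteqP; split=> F /=.
    by case/sP => f /andP[af n2] ->; apply: graph_of_CRSF.
  move=> /CRSF_orientation[f [af n2 <-]]; apply/sP; exists f => //.
  by rewrite /e af n2.
have [ms _] := measure_seq nu us.
pose sE := [seq F <- s | `[< E F >]].
have [msE sEE] := measure_seq nu (filter_uniq (fun F => `[< E F >]) us).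
(* The part of [E] outside the finite support has measure 0. *)
have -> : nu E = nu [set` sE].
  have -> : [set` sE] = E `&` [set` s].
    apply/seteqP; split=> F /=; rewrite mem_filter.
      by case/andP => /asboolP.
    by case=> EF Fs; apply/andP; split=> //; apply/asboolP.
  rewrite [LHS](measureDI nu mE ms) -[RHS]add0e; congr (_ + _)%E.
  apply/eqP; rewrite eq_le measure_ge0 andbT.
  have -> : 0%E = nu (~` [set` s]).
    by rewrite probability_setC // sC nuC subee.
  apply: le_measure; rewrite ?inE; [exact: measurableD|exact: measurableC|].
  by move=> F [].
rewrite sEE.
rewrite (eq_big_seq (fun F => (k * forest_weight w F)%:E)); last first.
  move=> F; rewrite mem_filter => /andP[_ Fs]; apply: kE.
  by have : [set` s] F by []; rewrite sC.
rewrite sumEFin -mulr_sumr big_filter; congr (_ * _)%:E.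
rewrite big_seq_cond.
rewrite (eq_bigr (fun F => \sum_(f : {ffun B -> B} | [&& arrows e f, no_two_cycle f & graph_of f == F :> configurations G]) W f)); last first.
  move=> F /andP[/sP[f /andP[af n2] ->] _]; rewrite -(sum_graph_of w_weight af n2).
  by apply: eq_bigl => f'; congr [&& _, _ & _]; apply/asboolP/eqP.
rewrite -big_seq_cond.
rewrite (exchange_big_dep (fun f : {ffun B -> B} => [&& arrows e f, no_two_cycle f & `[< E (graph_of f) >]])) /=; last first.
  by move=> F f EF /and3P[-> -> /eqP ->].
apply: eq_bigr => f /and3P[af n2 Ef].
rewrite big_mkcond (bigD1_seq (graph_of f : configurations G)) //=; last first.
  by apply/sP; exists f => //; rewrite af n2.
rewrite Ef af n2 eqxx /= big1 ?addr0 // => F nF.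
by case: ifP => // /andP[_ /eqP fF]; rewrite fF eqxx in nF.
Qed.

Lemma leads_to_cycle_graph_of (f : {ffun B -> B}) (c : seq G) (x : G) (v : B) :
    arrows e f -> simple_cycle (open_adj (graph_of f)) c -> x \in c ->
    joined (open_adj (graph_of f)) (val v) x ->
  leads_to_cycle f v (finset.finset (fun a : B => val a \in c)).
Proof.
move=> af sc xc vx; have [a [xa ca ac _]] := simple_cycle_orbit af sc xc.
have [b [t [xb vt bt]]] := joined_graph_of af vx.
have ab : b = a by apply: val_inj; rewrite -xb xa.
rewrite ab in bt; have ta : t \in orbit f a by rewrite -fconnect_orbit.
have mc (z : B) : (val z \in c) = (z \in orbit f a).
  by rewrite ac mem_map //; apply: val_inj.
apply/exists_inP; exists t; first by rewrite inE mc.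
apply/and3P; split=> //; first exact: orbit_mem_cycle ca ta.
by apply/eqP/setP => z; rewrite !inE mc (orbit_mem_eq ca ta).
Qed.

Lemma free_measure_le (E : set (configurations G)) (v : B) (C : {set B}) (r : R) :
    measurable E -> 0 <= r ->
    (forall f : {ffun B -> B}, arrows e f -> E (graph_of f) -> leads_to_cycle f v C) ->
    \sum_(f | arrows e f && leads_to_cycle f v C) W f <= r * \sum_(f | arrows e f) W f ->
  (nu E <= r%:E)%E.
Proof.
move=> mE r0 El Wr; have [k kE] := free_measureE.
have W0 f : 0 <= W f by apply: cycles_weight_ge0 => c; apply: induced_weight_ge0.
have tot : k * \sum_(f | arrows e f) W f = 1.
  have := kE setT measurableT; rewrite probability_setT => -[/esym <-]; congr (_ * _).
  (* Maps with a 2-cycle have weight 0, so the normalising sum may include them. *)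
  rewrite [LHS](bigID (@no_two_cycle B)) /= [X in _ + X]big1 ?addr0; last first.
    move=> f /andP[_ n2]; apply: cycles_weight_two_cycle n2.
      exact: induced_weight_rot.
    exact: induced_weight_small.
  by apply: eq_bigl => f; congr (_ && _); rewrite (_ : `[< _ >] = true) ?andbT //; apply/asboolP.
have k0 : 0 <= k.
  rewrite leNgt; apply/negP => k0.
  have : k * \sum_(f | arrows e f) W f <= 0.
    by apply: mulr_le0_ge0; [apply: ltW|apply: sumr_ge0].
  by rewrite tot ler10.
rewrite kE // lee_fin -[leRHS]mulr1 -tot mulrCA; apply: ler_wpM2l => //.
apply: le_trans Wr; rewrite big_mkcond [leRHS]big_mkcond; apply: ler_sum => f _.
case: ifP => [/and3P[af _ /asboolP Ef]|_]; last by case: ifP.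
by rewrite af El.
Qed.

End FreeMeasure.

(** * Random walk and annuli *)

Section RandomWalk.
Variables (R : realType) (G : graph).
Local Open Scope classical_set_scope.

Definition walk_prob (x : G) (s : seq G) : R :=
  \prod_(z <- pairmap (@srw_step R G) x s) z.

Lemma walk_prob_rcons x s y :
  walk_prob x (rcons s y) = walk_prob x s * srw_step R (last x s) y.
Proof. by rewrite /walk_prob -cats1 pairmap_cat big_cat /= big_seq1. Qed.

Lemma walk_prob_degree x s : 0 < walk_prob x s ->
  path (@adj G) x s /\ walk_prob x s = \prod_(z <- belast x s) (degree z)%:R^-1.
Proof.
elim: s x => [|y s IH] x /=; first by rewrite /walk_prob /= !big_nil.
rewrite /walk_prob /= !big_cons -/(walk_prob y s) /srw_step.
case: ifP => xy; last by rewrite mul0r ltxx.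
have [->|dx] := eqVneq (degree x) 0%N; first by rewrite invr0 mul0r ltxx.
by rewrite pmulr_rgt0 ?invr_gt0 ?ltr0n ?lt0n // => /IH[-> ->].
Qed.

Variables (d : measure_display) (T : measurableType d).

Lemma measurable_mkseq (Y : nat -> T -> G) n (s : seq G) :
  (forall n x, measurable [set t | Y n t = x]) ->
  measurable [set t | mkseq (Y ^~ t) n = s].
Proof.
move=> mY; elim: n s => [|n IH] s.
  case: s => [|x s]; first by rewrite (_ : [set _ | _] = setT) //; apply/seteqP; split.
  by rewrite (_ : [set t | _] = set0) //; apply/seteqP; split.
have mkS t : mkseq (Y ^~ t) n.+1 = rcons (mkseq (Y ^~ t) n) (Y n t).
  by rewrite /mkseq -addn1 iotaD map_cat add0n cats1.
case: (lastP s) => [|s' y].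
  rewrite (_ : [set t | mkseq (Y ^~ t) n.+1 = [::]] = set0) //.
  by apply/seteqP; split.
rewrite (_ : [set t | mkseq (Y ^~ t) n.+1 = rcons s' y] =
    [set t | mkseq (Y ^~ t) n = s'] `&` [set t | Y n t = y]).
  by apply: measurableI.
apply/seteqP; split=> t /=; rewrite mkS; first by move=> /rcons_inj[].
by case=> -> ->.
Qed.

Variables (P : probability T R) (X : nat -> T -> G) (v : G).
Hypothesis X_srw : simple_random_walk P X v.

Lemma walk_law s : P [set t | mkseq (X ^~ t) (size s).+1 = v :: s] = (walk_prob v s)%:E.
Proof.
case: X_srw => mX X0 Xstep; elim/last_ind: s => [|s y IH].
  rewrite /walk_prob /= big_nil -X0; congr (P _).
  by apply/seteqP; split=> t /=; rewrite /mkseq /=; [case|move=> ->].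
rewrite walk_prob_rcons EFinM -IH.
have := Xstep (belast v s) (last v s) y.
by rewrite -lastI size_belast rcons_cons size_rcons.
Qed.

(** Outside the null event where [X 0] is not [v], following [s] prescribes the whole beginning of
    the walk. *)
Lemma follows_le s : (P (follows X s) <= (walk_prob v s)%:E)%E.
Proof.
case: (X_srw) => mX X0 _; rewrite -walk_law.
set A := [set t | _ = v :: s]; pose N := ~` [set t | X 0 t = v].
have mA : measurable A by apply: measurable_mkseq.
have mN : measurable N by apply: measurableC.
have mF : measurable (follows X s).
  exact: (@measurable_mkseq (fun i => X i.+1) (size s) s (fun n => mX n.+1)).
have N0 : P N = 0%E by rewrite probability_setC // X0 subee.
apply: (@le_trans _ _ (P (A `|` N))).
  apply: le_measure; rewrite ?inE //; first exact: measurableU.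
  move=> t Ft; have [X0t|] := pselect (X 0 t = v); [left|by right].
  rewrite /A /= /mkseq /= X0t; congr (_ :: _); rewrite -[RHS]Ft.
  by rewrite /mkseq (iotaDl 1 0) -map_comp.
by rewrite -[leRHS]adde0 -N0; apply: measureU2.
Qed.

End RandomWalk.

(** * Boundaries, interiors and loops in annuli *)

Section Boundary.
Variables (G : graph).
Implicit Types (B : {fset G}).

Definition interior B : {fset G} := [fset x in B | x \notin boundary B]%fset.

Lemma boundaryP B x : reflect (x \in B /\ exists2 y, adj x y & y \notin B) (x \in boundary B).
Proof.
rewrite !inE /=; apply: (iffP andP) => -[xB H]; split=> //; exact/asboolP.
Qed.

Lemma interiorP B x : reflect (x \in B /\ forall y, adj x y -> y \in B) (x \in interior B).
Proof.
rewrite !inE /=; apply: (iffP andP) => -[xB H]; split=> //.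
  move=> y xy; apply/negPn/negP => yB; case/negP: H; rewrite xB /=.
  by apply/asboolP; exists y.
by rewrite xB /=; apply/asboolPn => -[y /H yB /negP].
Qed.

Lemma interior_or_boundary B x : x \in B -> x \notin interior B -> x \in boundary B.
Proof. by rewrite !inE /= => -> /=; rewrite negbK. Qed.

Lemma interiorS B B' : (B `<=` B')%fset -> (interior B `<=` interior B')%fset.
Proof.
move=> /fsubsetP BB'; apply/fsubsetP => x /interiorP[xB nx]; apply/interiorP.
by split=> [|y /nx]; apply: BB'.
Qed.

End Boundary.

Section Loops.
Variables (R : realType) (G : graph) (w : seq G -> R).
Hypothesis G_lf : locally_finite_graph G.
Hypothesis w_weight : cycle_weight w.

Definition inv_degrees (s : seq G) : R := \prod_(z <- s) (degree z)%:R^-1.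

Lemma inv_degrees01 s : 0 <= inv_degrees s <= 1.
Proof.
rewrite /inv_degrees; elim: s => [|x s /andP[s0 s1]]; first by rewrite big_nil ler01 lexx.
rewrite big_cons; have x0 : 0 <= (degree x)%:R^-1 :> R by rewrite invr_ge0.
rewrite mulr_ge0 //= mulr_ile1 //.
have [->|dx] := eqVneq (degree x) 0%N; first by rewrite invr0 ler01.
by rewrite invf_le1 ?ler1n ?ltr0n lt0n.
Qed.

(* [inv_degrees (u :: c)] is the probability that the walk at u steps to the head
   of c and then goes once around c. *)
Definition annulus_loop (B : nat -> {fset G}) (alpha beta : R) (n : nat) (u : G)
    (c : seq G) : Prop :=
  [/\ cycles_minus w c, alpha <= w c,
      {in c, forall y, [/\ y \in B n.+1, y \notin B n & y \notin boundary (B n.+1)]},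
      adj u (head u c) & beta < inv_degrees (u :: c)].

Lemma cycles_minus_rot i c : cycles_minus w c -> cycles_minus w (rot i c).
Proof.
case: w_weight => w0 wr [sc nc].
have srot j s : simple_cycle (@adj G) s -> simple_cycle (@adj G) (rot j s).
  by rewrite /simple_cycle size_rot rot_cycle rot_uniq.
have srev s : simple_cycle (@adj G) s -> simple_cycle (@adj G) (rev s).
  rewrite /simple_cycle size_rev rev_uniq rev_cycle => /and3P[-> + ->].
  rewrite andbT /=; congr (is_true _).
  by apply: eq_cycle => x y; rewrite adj_sym.
split; first exact: srot.
by move=> [_]; rewrite rev_rot /rotr !wr //; [move=> H; apply: nc|apply: srev].
Qed.

(** The probability involves the degrees of the vertices that the walk leaves, which are [u] and
    each vertex of the cycle once: the closing vertex is only entered. On [Gamma], [weight_minus] is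
    [w]. *)
Lemma uniform_annulus_loops (d : measure_display) (T : measurableType d)
    (P : G -> probability T R) (X : nat -> T -> G)
    (Gamma : set (seq G)) (B : nat -> {fset G}) (alpha beta : R) n u :
    (forall v : G, simple_random_walk (P v) X v) ->
    (Gamma `<=` cycles_minus w)%classic ->
    0 < beta ->
    (forall c, Gamma c -> simple_cycle (@adj G) c /\ alpha <= weight_minus w c <= 1) ->
    (exists c, [/\ Gamma c,
       {in c, forall y, [/\ y \in B n.+1, y \notin B n & y \notin boundary (B n.+1)]}
       & exists i, (beta%:E < P u (follows X (closed_sequence (rot i c))))%E]) ->
  exists c, annulus_loop B alpha beta n u c.
Proof.
move=> X_srw Gm b0 Ga [c [Gc cB [i bc]]]; exists (rot i c).
have mc := Gm c Gc; have [sc nc] := mc.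
have [_ /andP[ac _]] := Ga c Gc.
have wE : weight_minus w c = w c.
  by rewrite /weight_minus; case: asboolP.
have /and3P[zc _ _] := sc.
have := lt_le_trans bc (follows_le (X_srw u) _); rewrite lte_fin => bp.
have [pp pE] := walk_prob_degree (lt_trans b0 bp); rewrite pE in bp.
have [x [t E]] : exists x t, rot i c = x :: t.
  case: (rot i c) (size_rot i c) => [|x t] sE; last by exists x, t.
  by rewrite -sE in zc.
split.
- exact: cycles_minus_rot.
- by rewrite (proj2 w_weight) // -wE.
- by move=> y; rewrite mem_rot; apply: cB.
- by move: pp; rewrite E /= => /andP[].
- by move: bp; rewrite E (_ : closed_sequence (x :: t) = rcons (x :: t) x) // belast_rcons.
Qed.

(** Otherwise [u] lies on all the intermediate boundaries, and the loop attached to each gives a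
    neighbour of [u] in a different annulus. That makes [L + 1] neighbours, whereas the loop
    probability forces the degree of [u] below [1 / beta]. *)
Lemma boundary_disjoint (B : nat -> {fset G}) (alpha beta : R) (L : nat) n u :
    (forall n, (0 < n)%N -> (B n `<=` B n.+1)%fset) ->
    (forall n u, (0 < n)%N -> u \in boundary (B n) ->
       exists c, annulus_loop B alpha beta n u c) ->
    0 < beta -> beta^-1 <= L%:R -> (0 < n)%N ->
  u \in boundary (B (n + L)%N) -> u \notin B n.
Proof.
move=> Bmono loops b0 bL n0 ub; apply/negP => un.
have Ble i j : (0 < i)%N -> (i <= j)%N -> (B i `<=` B j)%fset.
  move=> i0; elim: j => [|j IH]; first by rewrite leqn0 => /eqP ->.
  rewrite leq_eqVlt => /orP[/eqP -> //|]; rewrite ltnS => ij.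
  by apply: fsubset_trans (IH ij) _; apply: Bmono; apply: leq_trans ij.
have /boundaryP[_ [z uz zB]] := ub.
have ubi i : (i <= L)%N -> u \in boundary (B (n + i)%N).
  move=> iL; apply/boundaryP; split.
    by apply: (fsubsetP (Ble n _ n0 _)) un; apply: leq_addr.
  exists z => //; apply: contra zB; apply: (fsubsetP (Ble _ _ _ _)).
    by rewrite addn_gt0 n0.
  by rewrite leq_add2l.
have /choice[y yP] : forall i, exists y, (i <= L)%N ->
    [/\ y \in B (n + i).+1, y \notin B (n + i)%N & adj u y].
  move=> i; have [iL|] := leqP i L; last by exists u.
  have [|c [[sc _] _ cB uc _]] := loops _ _ _ (ubi i iL); first by rewrite addn_gt0 n0.
  exists (head u c) => _; have hc : head u c \in c.
    by case/and3P: sc; case: (c) => // a s _ _ _; exact: mem_head.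
  by have [? ? _] := cB _ hc.
have dL : (L.+1 <= degree u)%N.
  have := @uniq_leq_size _ [seq y i | i <- iota 0 L.+1] (enum_fset (fset_set (neighbours u))).
  rewrite size_map size_iota; apply.
    rewrite map_inj_in_uniq ?iota_uniq // => i j; rewrite !mem_iota /= !add0n !ltnS.
    have ne k l : (k < l)%N -> (k <= L)%N -> (l <= L)%N -> y k <> y l.
      move=> kl kL lL E; have [yk _ _] := yP k kL; have [_ yl _] := yP l lL.
      case/negP: yl; rewrite -E; apply: (fsubsetP (Ble _ _ _ _)) yk => //.
      by rewrite -addnS leq_add2l.
    move=> iL jL E; case: (ltngtP i j) => // [/ne/(_ iL jL)|/ne/(_ jL iL)] //.
    by rewrite E.
  move=> x /mapP[i]; rewrite mem_iota add0n /= ltnS => iL ->.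
  have [_ _ ui] := yP i iL; rewrite -[_ \in _]/(_ \in fset_set (neighbours u)).
  by rewrite in_fset_set ?inE //; apply: G_lf.
have [|c [_ _ _ _ bc]] := loops _ _ _ (ubi 0%N (leq0n L)); first by rewrite addn0.
have d0 : (0 < degree u)%N by apply: leq_trans dL.
have : beta < (degree u)%:R^-1.
  apply: lt_le_trans bc _; rewrite /inv_degrees big_cons; apply: ler_piMr.
    by rewrite invr_ge0.
  by have /andP[] := inv_degrees01 c.
rewrite -[X in X < _]invrK ltf_pV2 ?posrE ?invr_gt0 ?ltr0n // => /lt_le_trans/(_ bL).
by rewrite ltr_nat ltnNge (ltnW dL).
Qed.

End Loops.

(** * Decay and infinite volume *)

Section FiniteVolume.
Variables (R : realType) (G : graph) (w : seq G -> R).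
Hypothesis G_lf : locally_finite_graph G.
Hypothesis w_weight : cycle_weight w.

Lemma outdeg_le_degree (V : {fset G}) (a : V) :
  (outdeg (@induced_adj G V) a <= degree (val a))%N.
Proof.
rewrite /outdeg /degree cardE -(size_map val); apply: uniq_leq_size.
  by rewrite map_inj_uniq ?enum_uniq //; apply: val_inj.
move=> x /mapP[b]; rewrite mem_enum => ab ->.
rewrite -[_ \in _]/(_ \in fset_set (neighbours (val a))).
by rewrite in_fset_set ?inE //; apply: G_lf.
Qed.

Variables (B : nat -> {fset G}) (alpha beta : R) (L k0 n : nat).
Hypothesis Bmono : forall n, (0 < n)%N -> (B n `<=` B n.+1)%fset.
Hypothesis loops : forall n u, (0 < n)%N -> u \in boundary (B n) ->
  exists c, annulus_loop w B alpha beta n u c.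
Hypotheses (alpha01 : 0 <= alpha <= 1) (beta01 : 0 < beta <= 1).
Hypotheses (bL : beta^-1 <= L%:R) (k00 : (0 < k0)%N).
Variables (V : {fset G}) (c0 : seq G) (x0 : G) (v : V).
Hypothesis c0B : {in c0, forall x, x \in interior (B k0)}.
Hypothesis x0c0 : x0 \in c0.
Hypothesis vB : val v \in boundary (B (k0 + n * L)%N).
Hypothesis BV : (B (k0 + n * L)%N.+1 `<=` V)%fset.

Let e := @induced_adj G V.
Let C : {set V} := finset.finset (fun a : V => val a \in c0).
Let level j := (k0 + j * L)%N.
(** With interiors, a vertex outside [J j] that can step into it lies on the boundary of
    [B (level j)], where a loop is available. *)
Let J j : {set V} := finset.finset (fun a : V => val a \in interior (B (level j))).

(** The target is only known as the vertex set [C], so every cycle on that set is frozen, whatever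
    its cyclic order. *)
Let special (c : seq V) : bool :=
  simple_cycle e c && ((1 < w (map val c)) || (1 < w (rev (map val c)))) ||
  (finset.finset (fun a : V => a \in c) == C).

Let Ble i j : (0 < i)%N -> (i <= j)%N -> (B i `<=` B j)%fset.
Proof.
move=> i0; elim: j => [|j IH]; first by rewrite leqn0 => /eqP ->.
rewrite leq_eqVlt => /orP[/eqP -> //|]; rewrite ltnS => ij.
by apply: fsubset_trans (IH ij) _; apply: Bmono; apply: leq_trans ij.
Qed.

Let level_gt0 j : (0 < level j)%N.
Proof. by rewrite addn_gt0 k00. Qed.

Let level_mono i j : (i <= j)%N -> (level i <= level j)%N.
Proof. by move=> ij; rewrite leq_add2l leq_mul2r ij orbT. Qed.

Let Jmono j : J j \subset J j.+1.
Proof.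
have /fsubsetP H := interiorS (Ble (level_gt0 j) (level_mono (leqnSn j))).
by apply/fintype.subsetP => a; rewrite !finset.in_set; apply: H.
Qed.

Let special_rot c i : special (rot i c) = special c.
Proof.
have sr : simple_cycle e (rot i c) = simple_cycle e c.
  by rewrite /simple_cycle size_rot rot_cycle rot_uniq.
rewrite /special sr; congr (_ || _); last first.
  by congr (_ == _); apply/setP => a; rewrite !inE mem_rot.
case sc: (simple_cycle e c) => //=; case: w_weight => _ wr.
have sc' : simple_cycle (@adj G) (map val c) by rewrite simple_cycle_val.
have sc'' : simple_cycle (@adj G) (rev (map val c)).
  move: sc'; rewrite /simple_cycle size_rev rev_uniq rev_cycle => /and3P[-> + ->].
  rewrite andbT /=; congr (is_true _).
  by apply: eq_cycle => x y; rewrite adj_sym.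
by rewrite map_rot wr // rev_rot /rotr wr.
Qed.

Let special_le1 c : ~~ special c -> induced_weight w c <= 1.
Proof.
rewrite /special /induced_weight -/e negb_or => /andP[+ _].
case: ifP => //= _; rewrite negb_or => /andP[+ _].
by rewrite -leNgt.
Qed.

Let levels j : (j < n)%N ->
  loop_level e (ordinary_weight (induced_weight w (B := V)) special) alpha beta J j.
Proof.
move=> jn u; rewrite finset.in_set => uJ.
have [uB|uB] := boolP (val u \in B (level j.+1)); last first.
  left=> y uy; rewrite finset.in_set; apply: contra uB => /interiorP[_]; apply.
  by rewrite adj_sym.
right; have ub := interior_or_boundary uB uJ.
have [c [[sc nc] ac cB uc bc]] := loops (level_gt0 j.+1) ub.
have BVj : (B (level j.+1).+1 `<=` V)%fset.
  by apply: fsubset_trans BV; apply: Ble => //; rewrite ltnS; apply: level_mono.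
have [c' cE] : exists c' : seq V, c = map val c'.
  elim: (c) cB => [|x s IH] sB; first by exists [::].
  have [|s' ->] := IH; first by move=> y ys; apply: sB; rewrite inE ys orbT.
  have [xB _ _] := sB x (mem_head x s).
  by exists ([` fsubsetP BVj x xB]%fset :: s').
have sc' : simple_cycle e c' by rewrite -simple_cycle_val -cE.
have c'0 : c' != [::] by case/and3P: sc'; case: (c').
have hc' : val (head u c') = head (val u) c by rewrite cE; case: (c') c'0.
have farB y : y \in c -> y \notin B (level j).
  move=> /cB[_ + _]; apply: contra; apply: fsubsetP.
  by apply: Ble => //; apply: level_mono.
(* The loop is in [cycles_minus], and it avoids [B (level j)], while [c0] is contained in [B k0]. *)
have nspec : ~~ special c'.
  rewrite /special sc' /= negb_or -cE; apply/andP; split.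
    apply/negP => H; apply: nc; split=> //; case/orP: H; [by left|by right].
  apply/eqP => /setP/(_ (head u c')); rewrite !finset.in_set hc'.
  have hc : head (val u) c \in c.
    by case/and3P: sc; case: (c) => // a s _ _ _; exact: mem_head.
  have -> : head u c' \in c' by case: (c') c'0 => // ? ? _; exact: mem_head.
  move=> /esym /c0B/interiorP[hB _]; case/negP: (farB _ hc).
  by apply: (fsubsetP (Ble k00 _)) hB; apply: leq_addr.
exists c'; split.
- by case/and3P: sc' => _ -> ->.
- by rewrite c'0 andbT /e /induced_adj hc'.
- rewrite /ordinary_weight (negbTE nspec) /induced_weight -/e sc' -cE //.
- move=> z; rewrite inE => zc y zy; rewrite finset.in_set; apply/negP => /interiorP[_] yB.
  have zB : val z \in B (level j) by apply: yB; rewrite adj_sym.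
  (* For the starting vertex [u], being away from the inner level is the effect of the spacing [L]
     between levels. *)
  case/orP: zc => [/eqP zu|zc].
    have ub' : val u \in boundary (B (level j + L)%N).
      by move: ub; rewrite /level mulSn addnA addnAC.
    have := boundary_disjoint G_lf Bmono loops (proj1 (andP beta01)) bL (level_gt0 j) ub'.
    by rewrite -zu zB.
  have zc' : val z \in c by rewrite cE mem_map //; exact: val_inj.
  by have := farB _ zc'; rewrite zB.
(* Degrees in [V] are at most those in [G], which only makes the loop more likely; they must be
   shown positive, since the inverse of 0 is 0. *)
- apply: le_trans (ltW bc) _; rewrite cE -map_cons /inv_degrees big_map.
  rewrite big_seq [leRHS]big_seq; apply: ler_prod => z zc.
  have dz : (0 < outdeg e z)%N.
    have [y yz] : exists y, e y z.
      move: zc; rewrite inE => /orP[/eqP ->|zc].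
        by exists (head u c'); rewrite /e induced_adj_sym /induced_adj hc'.
      exists (prev c' z); have /and3P[_ cc' uc'] := sc'.
      by have := prev_cycle cc' zc.
    by apply/card_gt0P; exists y; rewrite -[_ \in _]/(e z y) /e induced_adj_sym.
  have dd := outdeg_le_degree z.
  rewrite invr_ge0 ler0n /= lef_pV2 ?posrE ?ltr0n ?ler_nat //.
  exact: leq_trans dd.
Qed.

Lemma finite_volume_decay (nu : probability (configurations G) R)
    (E : set (configurations G)) : free_measure w V nu -> measurable E ->
    (E `<=` [set F | simple_cycle (open_adj F) c0 /\ joined (open_adj F) (val v) x0])%classic ->
  (nu E <= ((1 - alpha * beta ^+ 2) ^+ n)%:E)%E.
Proof.
move=> nu_free mE Esub.
have b01 : 0 <= beta <= 1 by case/andP: beta01 => /ltW ->.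
apply: (free_measure_le w_weight nu_free (v := v) (C := C) mE).
- case/andP: alpha01 => a0 a1; case/andP: b01 => b0 b1.
  by rewrite exprn_ge0 // subr_ge0 mulr_ile1 ?exprn_ge0 ?exprn_ile1.
- move=> f af /Esub[sc vx]; exact: leads_to_cycle_graph_of af sc x0c0 vx.
- apply: (@leads_to_cycle_le R V e _ _ _ special _ _ alpha beta _ _ v C J n) => //.
  + exact: induced_weight_rot.
  + exact: induced_weight_ge0.
  + by move=> c cC; rewrite /special orbC; apply/orP; left; apply/eqP.
  + apply/fintype.subsetP => a; rewrite !finset.in_set /level mul0n addn0; exact: c0B.
  + by rewrite finset.in_set; apply/negP => /interiorP[_]; case/boundaryP: vB => _ [y vy /negP yB] /(_ y vy).
Qed.

End FiniteVolume.

Local Open Scope classical_set_scope.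

(** * Cylinder events and passage to the limit *)

Section Cylinders.
Variables (R : realType) (G : graph).

(** Induction on [s]: split on the state of one edge and force it on each side. Entries of [s] that
    are not edges are dropped. *)
Lemma measurable_cylinder (s : seq {fset G}) (E : set (configurations G)) :
    (forall F F' : configurations G, (forall ed : edge G, val ed \in s -> F ed = F' ed) ->
       E F -> E F') ->
  measurable E.
Proof.
elim: s E => [|A s IH] E Es.
  have [[F EF]|noE] := pselect (exists F, E F).
    by rewrite (_ : E = setT) //; apply/seteqP; split=> // F' _; apply: (Es F).
  by rewrite (_ : E = set0) //; apply/seteqP; split=> // F EF; case: noE; exists F.
have [[ed edA]|noA] := pselect (exists ed : edge G, val ed = A); last first.
  apply: IH => F F' FF'; apply: Es => ed; rewrite inE => /orP[/eqP edA|]; last exact: FF'.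
  by case: noA; exists ed.
pose force (b : bool) (F : configurations G) : configurations G :=
  fun ed' => if val ed' == A then b else F ed'.
have forceE (F : configurations G) : force (F ed) F = F.
  apply/funext => ed'; rewrite /force; case: eqP => // ed'A.
  by congr (F _); apply: val_inj; rewrite edA.
pose O := [set F : configurations G | F ed].
have -> : E = (O `&` [set F | E (force true F)]) `|` (~` O `&` [set F | E (force false F)]).
  apply/seteqP; split=> F /=.
    rewrite -{1}(forceE F) /O; case Fed: (F ed) => EF; [left|right]; split=> //=;
      by rewrite ?Fed.
  by case=> -[Fed]; rewrite -{2}(forceE F); [rewrite Fed|move/negP/negbTE: Fed => ->].
have mf b : measurable [set F | E (force b F)].
  apply: IH => F F' FF' /=; apply: Es => ed'; rewrite /force inE.
  by case: eqP => //= _; apply: FF'.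
apply: measurableU; apply: measurableI => //; first exact: measurable_open.
by apply: measurableC; apply: measurable_open.
Qed.

Lemma weak_convergence_le (mu_ : nat -> probability (configurations G) R)
    (mu : probability (configurations G) R) (s : seq {fset G})
    (E : set (configurations G)) (b : \bar R) :
    weak_convergence mu_ mu ->
    (forall F F' : configurations G, (forall ed : edge G, val ed \in s -> F ed = F' ed) ->
       E F -> E F') ->
    (\forall n \near \oo, (mu_ n E <= b)%E) ->
  (mu E <= b)%E.
Proof.
move=> cv Es nb; have mE := measurable_cylinder Es.
have dep : depends_on_finitely_many (\1_E : config G -> R).
  exists [set ed | val ed \in s].
    apply: (@finite_preimage _ _ [set` s] (fun ed : edge G => val ed)) => //.
    by move=> x y _ _; apply: val_inj.
  move=> F F' FF'; rewrite !indicE; congr (_%:R); congr nat_of_bool.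
  apply/idP/idP; rewrite !inE; apply: Es => ed eds; first exact: FF'.
  by rewrite FF'.
have := cv _ dep.
have intE (nu : probability (configurations G) R) : (\int[nu]_F (\1_E F)%:E = nu E)%E.
  by rewrite integral_indic // setIT.
rewrite intE => cvE; apply: (cvge_to_le cvE).
by apply: filterS nb => n; rewrite intE.
Qed.

Lemma measure_union_le (nu : probability (configurations G) R) (I : eqType) (s : seq I)
    (A : I -> set (configurations G)) (b : R) :
    (forall i, measurable (A i)) -> {in s, forall i, (nu (A i) <= b%:E)%E} ->
  measurable [set F | exists2 i, i \in s & A i F] /\
  (nu [set F | exists2 i, i \in s & A i F] <= ((size s)%:R * b)%:E)%E.
Proof.
move=> mA; elim: s => [|i s IH] Ab.
  rewrite (_ : [set F | _] = set0); last by apply/seteqP; split=> // F [].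
  by rewrite measure0 mul0r.
have [|ms sb] := IH; first by move=> j js; apply: Ab; rewrite inE js orbT.
rewrite (_ : [set F | exists2 j, j \in i :: s & A j F] =
   A i `|` [set F | exists2 j, j \in s & A j F]); last first.
  apply/seteqP; split=> F /=.
    by case=> j; rewrite inE => /orP[/eqP ->|js]; [left|right; exists j].
  by case=> [AF|[j js AF]]; [exists i => //; exact: mem_head|exists j; rewrite // inE js orbT].
split; first exact: measurableU.
apply: le_trans (measureU2 _ _ _) _ => //.
rewrite /= -natr1 mulrDl mul1r addrC EFinD; apply: leeD => //.
by apply: Ab; exact: mem_head.
Qed.

End Cylinders.

(** Combine [1 - eps <= exp (- eps)] with [exp y >= y ^ (D + 1) / (D + 1)!] for [y = eps * j]; one
    power more than the polynomial factor leaves [1 / j]. *)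
Lemma polynomial_geometric_bound (R : realType) (eps c : R) (a L D : nat) :
  0 < eps <= 1 -> 0 <= c ->
  exists K : R, forall j, (0 < j)%N ->
    c * (a + j * L)%:R ^+ D * (1 - eps) ^+ j <= K / j%:R.
Proof.
move=> /andP[e0 e1] c0.
exists (c * (a + L)%:R ^+ D * (D.+1`!%:R / eps ^+ D.+1)) => j j0.
have jR : 0 < j%:R :> R by rewrite ltr0n.
have ej : 0 < eps * j%:R by rewrite mulr_gt0.
have geo : (1 - eps) ^+ j <= D.+1`!%:R / (eps * j%:R) ^+ D.+1.
  apply: (@le_trans _ _ (expR (- eps) ^+ j)).
    apply: lerXn2r; rewrite ?nnegrE ?subr_ge0 ?expR_ge0 //.
    exact: expR_ge1Dx.
  rewrite -expRM_natr mulNr expRN -[leRHS]invf_div lef_pV2.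
  - by apply: le_trans (expR_ge1Dxn D (ltW ej)); rewrite lerDr ler01.
  - by rewrite posrE expR_gt0.
  - by rewrite posrE divr_gt0 ?exprn_gt0 // ltr0n fact_gt0.
have poly : (a + j * L)%:R ^+ D <= ((a + L)%:R * j%:R) ^+ D :> R.
  apply: lerXn2r; rewrite ?nnegrE ?mulr_ge0 //.
  rewrite -natrM ler_nat mulnDl [(L * j)%N]mulnC leq_add2r.
  by rewrite -[X in (X <= _)%N]muln1 leq_mul2l j0 orbT.
apply: le_trans (_ : c * ((a + L)%:R * j%:R) ^+ D * (D.+1`!%:R / (eps * j%:R) ^+ D.+1) <= _).
  apply: ler_pM => //; rewrite ?mulr_ge0 ?exprn_ge0 ?subr_ge0 //.
  exact: ler_wpM2l.
rewrite le_eqVlt; apply/orP; left; apply/eqP.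
rewrite !exprMn [j%:R ^+ D.+1]exprS; field.
by rewrite !expf_neq0 ?gt_eqF.
Qed.

(** * Infinite components cross every boundary *)

Section InfiniteComponents.
Variable G : graph.

Lemma exhaustion_mono (B : nat -> {fset G}) i j : exhaustion B ->
  (0 < i)%N -> (i <= j)%N -> (B i `<=` B j)%fset.
Proof.
case=> _ Bmono _ i0; elim: j => [|j IH]; first by rewrite leqn0 => /eqP ->.
rewrite leq_eqVlt => /orP[/eqP -> //|]; rewrite ltnS => ij.
by apply: fsubset_trans (IH ij) _; apply: Bmono; apply: leq_trans ij.
Qed.

Lemma exhaustion_seq (B : nat -> {fset G}) (s : seq G) : exhaustion B ->
  exists2 n, (0 < n)%N & {subset s <= B n}.
Proof.
move=> eB; elim: s => [|x s [n n0 sn]]; first by exists 1%N.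
have [_ _ /(_ x)[m m0 xm]] := eB.
exists (maxn m n) => [|y]; first by rewrite leq_max m0.
rewrite inE => /orP[/eqP ->|ys].
  by apply: (fsubsetP (exhaustion_mono eB m0 (leq_maxl m n))).
by apply: (fsubsetP (exhaustion_mono eB n0 (leq_maxr m n))); apply: sn.
Qed.

Lemma crossing_boundary (F : config G) (B : {fset G}) x p :
    path (open_adj F) x p -> x \in B -> last x p \notin B ->
  exists2 v, v \in boundary B & joined (open_adj F) x v.
Proof.
elim: p x => [|y p IH] x /=; first by move=> _ ->.
case/andP => xy py xB lB; have [yB|yB] := boolP (y \in B).
  by have [v vB yv] := IH y py yB lB; exists v => //; apply: joined_trans yv; exists [:: y]; rewrite //= xy.
exists x; last exact: joined_refl.
by apply/boundaryP; split=> //; exists y => //; apply: open_adj_adj xy.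
Qed.

Lemma infinite_component_boundary (F : config G) (B : {fset G}) x :
    x \in B -> infinite_set (component F x) ->
  exists2 v, v \in boundary B & joined (open_adj F) v x.
Proof.
move=> xB inf; have [[z xz zB]|no] := pselect (exists2 z, component F x z & z \notin B).
  have [p pp pz] := xz; have [|v vB xv] := crossing_boundary pp xB; first by rewrite pz.
  by exists v => //; apply: joined_sym.
case: inf; apply: (@sub_finite_set _ _ [set` B]); last exact: finite_fset.
by move=> z xz; apply/negPn/negP => zB; case: no; exists z.
Qed.

Lemma open_adj_agree (A : {fset G}) (F F' : config G) x y :
    (forall ed : edge G, val ed \in fpowerset A -> F ed = F' ed) ->
    x \in A -> y \in A -> open_adj F x y -> open_adj F' x y.
Proof.
move=> FF' xA yA /asboolP[ed edE Fed]; apply/asboolP; exists ed => //.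
rewrite -FF' // fpowersetE edE; apply/fsubsetP => z; rewrite !inE.
by case/orP => /eqP ->.
Qed.

End InfiniteComponents.

(** * The component of a fixed cycle *)

Section CycleComponent.
Variables (R : realType) (G : graph) (w : seq G -> R).
Hypothesis G_lf : locally_finite_graph G.
Hypothesis w_weight : cycle_weight w.
Variables (Gn : nat -> {fset G}) (muF : nat -> probability (configurations G) R).
Variable mu : probability (configurations G) R.
Hypothesis Gn_exhaustion : exhaustion Gn.
Hypothesis muF_free : \forall n \near \oo, free_measure w (Gn n) (muF n).
Hypothesis muF_cvg : weak_convergence muF mu.
Variables (c : seq G) (x : G).
Hypotheses (sc : simple_cycle (@adj G) c) (xc : x \in c).

(* The vertices of c and of the connection are required to lie in a finite set so
   as to obtain a cylinder event. *)
Definition connected_within (v : G) (j : nat) : set (configurations G) :=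
  [set F | [/\ simple_cycle (open_adj F) c, {subset c <= Gn j.+1} &
     exists p, [/\ path (open_adj F) v p, last v p = x & {subset v :: p <= Gn j.+1}]]].

Lemma connected_within_cylinder v j (F F' : configurations G) :
  (forall ed : edge G, val ed \in enum_fset (fpowerset (Gn j.+1)) -> F ed = F' ed) ->
  connected_within v j F -> connected_within v j F'.
Proof.
move=> FF' [scF cj [p [pp lp pj]]].
have agree : {in mem (Gn j.+1) &, forall a b, open_adj F a b -> open_adj F' a b}.
  by move=> a b aj bj; apply: open_adj_agree FF' aj bj.
split=> //.
  move: scF; rewrite /simple_cycle => /and3P[-> cc ->]; rewrite andbT /=.
  by apply: (sub_in_cycle agree) cc; apply/allP.
exists p; split=> //; apply: (sub_in_path agree) pp; exact/allP.
Qed.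

Lemma measurable_connected_within v j : measurable (connected_within v j).
Proof. by apply: measurable_cylinder => F F'; apply: connected_within_cylinder. Qed.

Lemma connected_within_mono v : {homo connected_within v : i j / (i <= j)%N >-> (i <= j)%O}.
Proof.
move=> i j ij; apply/subsetPset => F [scF ci [p [pp lp pi]]].
have /fsubsetP H := exhaustion_mono Gn_exhaustion (ltn0Sn i) (ij : (i < j.+1)%N).
split=> // [y /ci /H //|]; by exists p; split=> // y /pi /H.
Qed.

Variables (B : nat -> {fset G}) (alpha beta : R) (L k0 : nat).
Hypothesis B_exhaustion : exhaustion B.
Hypothesis loops : forall n u, (0 < n)%N -> u \in boundary (B n) ->
  exists c, annulus_loop w B alpha beta n u c.
Hypotheses (alpha01 : 0 < alpha <= 1) (beta01 : 0 < beta <= 1).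
Hypotheses (bL : beta^-1 <= L%:R) (k00 : (0 < k0)%N).
Hypothesis cB : {in c, forall y, y \in interior (B k0)}.

Lemma connected_within_le n v j : v \in boundary (B (k0 + n * L)%N) ->
  (mu (connected_within v j) <= ((1 - alpha * beta ^+ 2) ^+ n)%:E)%E.
Proof.
move=> vB; apply: (weak_convergence_le muF_cvg (@connected_within_cylinder v j)).
have [m0 m00 Bm0] := exhaustion_seq (enum_fset (B (k0 + n * L).+1)) Gn_exhaustion.
(* For large [m], [Gn m] contains all the loops used up to level [n]. *)
near=> m.
have BV : (B (k0 + n * L).+1 `<=` Gn m)%fset.
  apply/fsubsetP => y /Bm0; apply: fsubsetP; apply: exhaustion_mono => //.
  by near: m; exists m0.
have Bmono i : (0 < i)%N -> (B i `<=` B i.+1)%fset.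
  by move=> i0; apply: exhaustion_mono.
have vG : v \in Gn m.
  apply: (fsubsetP BV); apply: (fsubsetP (Bmono _ _)); first by rewrite addn_gt0 k00.
  by case/boundaryP: vB.
have a01 : 0 <= alpha <= 1 by case/andP: alpha01 => /ltW ->.
apply: (@finite_volume_decay R G w G_lf w_weight B alpha beta L k0 n Bmono loops a01 beta01
  bL k00 (Gn m) c x [` vG]%fset cB xc vB BV).
- by near: m.
- exact: measurable_connected_within.
- by move=> F [scF _ [p [pp lp _]]]; split=> //; exists p.
Unshelve. all: by end_near.
Qed.

Variables (D : nat) (Cst : R).
Hypothesis Cst0 : 0 < Cst.
Hypothesis boundary_size : forall n, (0 < n)%N ->
  (#|` boundary (B n)|)%:R <= Cst * n%:R ^+ D.

Lemma cycle_component_negligible :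
  mu.-negligible [set F | simple_cycle (open_adj F) c /\ infinite_set (component F x)].
Proof.
pose A v := \bigcup_j connected_within v j.
have mA v : measurable (A v).
  by apply: bigcupT_measurable => j; apply: measurable_connected_within.
pose eps := alpha * beta ^+ 2.
have eps01 : 0 < eps <= 1.
  case/andP: alpha01 => a0 a1; case/andP: beta01 => b0 b1.
  have b20 : 0 < beta ^+ 2 by rewrite exprn_gt0.
  have b21 : beta ^+ 2 <= 1 by rewrite exprn_ile1 // ltW.
  by rewrite /eps mulr_gt0 //= mulr_ile1 // ltW.
have Ale n v : v \in boundary (B (k0 + n * L)%N) -> (mu (A v) <= ((1 - eps) ^+ n)%:E)%E.
  (* [A v] is the increasing union of the confined connections, so their common bound passes to
     it. *)
  move=> vB; have cv := nondecreasing_cvg_mu (mu := mu) (measurable_connected_within v)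
    (mA v) (@connected_within_mono v).
  by apply: (cvge_to_le cv); apply: nearW => j; apply: connected_within_le.
pose U n := [set F : configurations G |
  exists2 v, v \in enum_fset (boundary (B (k0 + n * L)%N)) & A v F].
have mU n : measurable (U n) /\
    (mu (U n) <= ((size (enum_fset (boundary (B (k0 + n * L)%N))))%:R * (1 - eps) ^+ n)%:E)%E.
  by apply: measure_union_le => // v; apply: Ale.
have [Kb KbP] := polynomial_geometric_bound k0 L D eps01 (ltW Cst0).
have Ule n : (0 < n)%N -> (mu (U n) <= (Kb / n%:R)%:E)%E.
  move=> n0; apply: le_trans (proj2 (mU n)) _; rewrite lee_fin.
  apply: le_trans (KbP n n0); apply: ler_wpM2r.
    by rewrite exprn_ge0 // subr_ge0; case/andP: eps01.
  by apply: boundary_size; rewrite addn_gt0 k00.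
have mN : measurable (\bigcap_n U n.+1).
  by apply: bigcapT_measurable => n; case: (mU n.+1).
exists (\bigcap_n U n.+1); split=> //.
  have Nle n : (mu (\bigcap_n U n.+1) <= (Kb / n.+1%:R)%:E)%E.
    apply: le_trans (Ule n.+1 (ltn0Sn n)); apply: le_measure; rewrite ?inE //.
      by case: (mU n.+1).
    by move=> F /(_ n I).
  apply/eqP; rewrite eq_le measure_ge0 andbT.
  have fin : mu (\bigcap_n U n.+1) \is a fin_num by apply: fin_num_measure.
  rewrite -(fineK fin) lee_fin leNgt; apply/negP => pos.
  set q := fine _ in pos; have qle n : q * n.+1%:R <= Kb.
    by have := Nle n; rewrite -(fineK fin) lee_fin ler_pdivlMr ?ltr0n.
  have Kb0 : 0 <= Kb by apply: le_trans (qle 0%N); rewrite mulr_ge0 // ltW.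
  have := archi_boundP (divr_ge0 Kb0 (ltW pos)); rewrite ltr_pdivrMr // mulrC.
  move=> /lt_le_trans/(_ (_ : _ <= q * (Num.bound (Kb / q)).+1%:R)).
  have H : q * (Num.bound (Kb / q))%:R <= q * (Num.bound (Kb / q)).+1%:R.
    by rewrite ler_pM2l // ler_nat.
  by move=> /(_ H) /lt_le_trans/(_ (qle _)); rewrite ltxx.
(* An infinite component crosses the boundary of every level, so the bad event is contained in each
   [U n.+1]. *)
move=> F [scF inf] n _.
have xB : x \in B (k0 + n.+1 * L)%N.
  have /interiorP[xk _] := cB xc; apply: (fsubsetP (exhaustion_mono B_exhaustion k00 _)) xk.
  exact: leq_addr.
have [v vB [p pp px]] := infinite_component_boundary xB inf.
exists v => //; have [[|j] // _ pj] := exhaustion_seq (v :: p ++ c) Gn_exhaustion.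
exists j => //; split=> // [y yc|].
  by apply: pj; rewrite inE mem_cat yc !orbT.
exists p; split=> // y; rewrite inE => yp; apply: pj; rewrite inE mem_cat.
by case/orP: yp => ->; rewrite ?orbT.
Qed.

End CycleComponent.

Theorem theorem5p2p8 (R : realType) (G : graph)
    (G_infinite : infinite_set [set: G])
    (G_connected : connected_graph G)
    (G_locally_finite : locally_finite_graph G)
    (Gn : nat -> {fset G}) (Gn_exhaustion : exhaustion Gn)
    (w : seq G -> R) (w_weight : cycle_weight w)
    (muF muW : nat -> probability (configurations G) R)
    (mu : probability (configurations G) R)
    (muF_free : \forall n \near \oo, free_measure w (Gn n) (muF n))
    (muW_wired : \forall n \near \oo, wired_measure w (Gn n) (muW n))
    (muF_cvg : weak_convergence muF mu)
    (muW_cvg : weak_convergence muW mu)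
    (d : measure_display) (T : measurableType d)
    (P : G -> probability T R) (X : nat -> T -> G)
    (X_srw : forall v : G, simple_random_walk (P v) X v)
    (Gamma : set (seq G)) (Gamma_minus : Gamma `<=` cycles_minus w)
    (w_minus_loops : uniform_loop_assumption P X (weight_minus w) Gamma) :
  {ae mu, forall F : configurations G, forall x : G,
     cycles_in F (component F x) !=set0 -> finite_set (component F x)}.
Proof.
have [alpha [beta [M [M' [Cst [D [B [[a0 b0 _ _ C0] Bexh Ga loops sizes]]]]]]]] :=
  w_minus_loops.
(* Truncation at 1 puts both constants in the unit interval and only weakens the lower bounds. *)
pose al := Num.min alpha 1; pose be := Num.min beta 1.
have al01 : 0 < al <= 1 by rewrite lt_min a0 ltr01 ge_min lexx orbT.
have be01 : 0 < be <= 1 by rewrite lt_min b0 ltr01 ge_min lexx orbT.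
have be0 : 0 < be by case/andP: be01.
have Bloops x n u : (0 < n)%N -> u \in boundary (B x n) ->
    exists c, annulus_loop w (B x) al be n u c.
  move=> n0 ub; apply: (uniform_annulus_loops w_weight X_srw Gamma_minus be0).
    move=> c /Ga[sc /andP[ac c1]]; split=> //; rewrite c1 andbT.
    by apply: le_trans ac; rewrite ge_min lexx.
  have [c [Gc cB [i bi]]] := loops x n u n0 ub.
  exists c; split=> //; exists i; apply: le_lt_trans bi.
  by rewrite lee_fin ge_min lexx.
(* There are countably many pairs of a cycle and a vertex on it, so each pair can be treated
   separately, with the exhaustion attached to that vertex. *)
pose bad (cx : seq G * G) := [set F : configurations G |
  [/\ simple_cycle (open_adj F) cx.1, cx.2 \in cx.1 & infinite_set (component F cx.2)]].
have bad0 cx : mu.-negligible (bad cx).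
  case: cx => c x.
  have [/andP[sc xc]|no] := boolP (simple_cycle (@adj G) c && (x \in c)); last first.
    rewrite (_ : bad (c, x) = set0); first exact: negligible_set0.
    apply/seteqP; split=> // F [/= scF xc _]; case/negP: no; rewrite xc andbT.
    move: scF; rewrite /simple_cycle => /and3P[-> + ->]; rewrite andbT /=.
    by apply: sub_cycle => a b; apply: open_adj_adj.
  have [Bx _] := Bexh x.
  (* [k0] is large enough for [B x k0] to contain [c] and all the neighbours of its vertices, which
     puts [c] in the interior. *)
  have [k0 k00 cB] := exhaustion_seq
    (c ++ flatten [seq enum_fset (fset_set (neighbours y)) | y <- c]) Bx.
  apply: negligibleS (cycle_component_negligible G_locally_finite w_weight
    Gn_exhaustion muF_free muF_cvg xc Bx (@Bloops x) al01 be01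
    (L := Num.bound be^-1) _ k00 _ C0 (D := D) _).
  - by move=> F [].
  - by apply/ltW/archi_boundP; rewrite invr_ge0 ltW.
  - move=> y yc; apply/interiorP; split; first by apply: cB; rewrite mem_cat yc.
    move=> z yz; apply: cB; rewrite mem_cat; apply/orP; right.
    apply/flattenP; exists (enum_fset (fset_set (neighbours y))); first exact: map_f.
    by rewrite -[_ \in _]/(z \in fset_set (neighbours y)) in_fset_set ?inE.
  - by move=> n n0; case: (sizes x n n0).
pose badn n := if @choice.unpickle (seq G * G)%type n is Some cx then bad cx else set0.
have badn0 n : mu.-negligible (badn n).
  by rewrite /badn; case: choice.unpickle => [cx|]; [exact: bad0|exact: negligible_set0].
apply: negligibleS (negligible_bigcup badn0) => F /= /existsNP[x /not_implyP[[A]]].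
case=> c [sc cx _] inf.
(* The vertex [x] need not lie on the cycle; it is replaced by a cycle vertex of the same
   component. *)
have [y yc] : exists y, y \in c.
  by case/and3P: sc; case: (c) => // y s _ _ _; exists y; exact: mem_head.
exists (@choice.pickle (seq G * G)%type (c, y)) => //.
rewrite /badn (@choice.pickleK (seq G * G)%type); split=> //=.
by rewrite -(component_eq (cx y yc)).
Qed.
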